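(* Let $\Bbbk$ be an algebraically closed field and let $\mathcal V$ be a polarized arrangement, with set of bounded feasible sign vectors $\mathcal P$ partially ordered by $\le$. Let $\tilde A(\mathcal V)$ denote the hypertoric convolution algebra with coefficients in $\Bbbk$, and let $\tilde A(\mathcal V)\text{-gmod}$ be the category of finitely generated graded left $\tilde A(\mathcal V)$-modules. Then $(\tilde A(\mathcal V)\text{-gmod},\mathcal P,\le)$ is a polynomial highest weight category, with standard modules $\{\tilde V_\alpha\}_{\alpha\in\mathcal P}$.
   Context: **Polarized arrangements.** Let $0\le k\le n$ and $I=\{1,\dots,n\}$. A polarized arrangement $\mathcal V=(V,\eta,\xi)$ consists of a $k$-dimensional subspace $V\subset\mathbb R^n$, $\eta\in\mathbb R^n/V$ and $\xi\in V^*=(\mathbb R^n)^*/V^\perp$ such that every lift of $\eta$ to $\mathbb R^n$ has at least $n-k$ nonzero entries and every lift of $\xi$ to $(\mathbb R^n)^*$ has at least $k$ nonzero entries. Put $V_\eta=\{x\in\mathbb R^n: x+V=\eta\}$ (an affine space over $V$), $H_i=\{x\in V_\eta:x_i=0\}$, $H_S=\bigcap_{i\in S}H_i$. For a sign vector $\alpha\in\{\pm1\}^n$ let $\Delta_\alpha=\{x\in V_\eta:\alpha(i)x_i\ge0\ \forall i\}$ and $\Sigma_\alpha=\{x\in V:\alpha(i)x_i\ge0\ \forall i\}$. Set $\mathcal F=\{\alpha:\Delta_\alpha\ne\emptyset\}$ (feasible), $\mathcal B=\{\alpha:\xi(\Sigma_\alpha)\text{ bounded above}\}$ (bounded), $\mathcal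 P=\mathcal F\cap\mathcal B$. Write $\alpha\leftrightarrow\beta$ if $\alpha,\beta$ differ in exactly one entry, and $\alpha^i$ for $\alpha$ with the $i$-th entry flipped. Let $\mathbb B$ be the set of $k$-element subsets $\mathbf x\subset I$ with $H_{\mathbf x}\neq\emptyset$ (then $H_{\mathbf x}$ is a point). There is a bijection $\mu:\mathbb B\to\mathcal P$ sending $\mathbf x$ to the unique $\alpha\in\mathcal P$ such that $\xi$ attains its maximum on $\Delta_\alpha$ at $H_{\mathbf x}$; write $\mathbf x_\alpha=\mu^{-1}(\alpha)$. The partial order $\le$ on $\mathbb B\cong\mathcal P$ is generated by $\mathbf x<\mathbf x'$ whenever $|\mathbf x\cap\mathbf x'|=k-1$ and $\xi(H_{\mathbf x})<\xi(H_{\mathbf x'})$. **The algebra $\tilde A(\mathcal V)$.** Take the quiver with vertex set $\mathcal F$ and an arrow $p(\alpha,\beta)$ from $\alpha$ to $\beta$ whenever $\alpha\leftrightarrow\beta$ in $\mathcal F$; products of paths are read left to right, so $p(\alpha,\beta)=e_\alpha p(\alpha,\beta)e_\beta$. $\tilde A(\mathcal V)$ is the path algebra tensored with the polynomial ring in $t_1,\dots,t_n$ modulo the two-sided ideal generated by: (A1) $e_\alpha$ for $\alpha\in\mathcal F\setminus\mathcal B$; (A2) $p(\alpha,\beta)p(\beta,\gamma)-p(\alpha,\delta)p(\delta,\gamma)$ for distinct $\alpha,\beta,\gamma,\delta\in\mathcal F$ with $\alpha\leftrightarrow\beta\leftrightarrow\gamma\leftrightarrow\delta\leftrightarrow\alpha$;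 (A3) $p(\alpha,\beta)p(\beta,\alpha)-t_ie_\alpha$ for $\alpha\leftrightarrow\beta$ in $\mathcal F$ differing in coordinate $i$. Grading: $\deg p(\alpha,\beta)=1$, $\deg t_i=2$. The simple modules (up to shift) are one-dimensional modules $L_\alpha$, $\alpha\in\mathcal P$, with projective covers $\tilde P_\alpha=\tilde A(\mathcal V)e_\alpha$. The standard module is $\tilde V_\alpha=\tilde A e_\alpha/\sum_{i\in\mathbf x_\alpha}\tilde A\,p(\alpha^i,\alpha)$. **Polynomial highest weight categories.** A graded vector space is Laurentian if its components are finite-dimensional and vanish in sufficiently negative degrees. $q$ denotes the grading shift $(qM)_m=M_{m-1}$, and $\mathrm{Hom}(U,W)=\bigoplus_m\hom(q^mU,W)$ with $\hom$ the degree-preserving maps. A graded $\Bbbk$-linear abelian category $\mathcal C$ with complete irredundant set of simples $\{L(\alpha):\alpha\in\Pi\}$ up to isomorphism and shift is Noetherian Laurentian if every object is Noetherian with a separated filtration $W\supset W_1\supset W_2\supset\cdots$ ($\bigcap W_m=0$) such that each $W/W_m$ has finite length, each $L(\alpha)$ has a projective cover $P(\alpha)$, and all $\mathrm{Hom}(P(\alpha),P(\beta))$ are Laurentian. Given a partial order on $\Pi$, $\Delta(\alpha)$ is the largest quotient of $P(\alpha)$ all of whose composition factors $L(\beta)$ (up to shift) satisfy $\beta\le\alpha$. A $\Delta$-filtration is a separated filtration with subquotients shifts of objects $\Delta(\beta)$. $(\mathcal C,\Pi,\le)$ is a polynomial highest weight category if for every $\alpha\in\Pi$: (PHW1) the kernel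 of $P(\alpha)\to\Delta(\alpha)$ has a $\Delta$-filtration with subquotients shifts of $\Delta(\beta)$, $\beta>\alpha$; (PHW2) $B_\alpha:=\mathrm{End}(\Delta(\alpha))^{\mathrm{op}}$ is isomorphic to a graded polynomial ring $\Bbbk[z_1,\dots,z_{n_\alpha}]$ with $\deg z_i>0$; (PHW3) for all $\beta\in\Pi$, $\mathrm{Hom}(P(\alpha),\Delta(\beta))$ is free of finite rank over $B_\beta$. ''With standard modules $\tilde V_\alpha$'' means $\Delta(\alpha)=\tilde V_\alpha$. *)

(* Defs.v *)
From HB Require Import structures.
From mathcomp Require Import all_boot all_order all_algebra.
From mathcomp Require Import finmap monalg.
From mathcomp Require Import mpoly.
From mathcomp Require Import boolp reals.
From Stdlib Require Import Relation_Operators.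

Set Implicit Arguments.
Unset Strict Implicit.
Unset Printing Implicit Defensive.

Import Order.TTheory GRing.Theory Num.Theory.
Local Open Scope ring_scope.
Local Open Scope quotient_scope.

(* [monalg] also declares this notation, for another type. *)
Local Notation "{ 'mpoly' T [ n ] }" := (mpoly.mpoly n T) : type_scope.

(* A [K]-linear category with a grading shift.  [sh m] is the functor [q^m];
   the [q^m] form a (weak) action of the group of integers, i.e. there are
   natural isomorphisms [shU : q^0 X -> X] and [shD : q^(a+b) X -> q^a (q^b X)]
   subject to the usual coherence laws.  The target degree of [shD] is a free
   parameter [c] with a proof of [c = a + b], which avoids all transports. *)
Record gcat (K : fieldType) := GCat {
  obj :> Type;
  hom : obj -> obj -> lmodType K;
  idm : forall X, hom X X;
  cmp : forall X Y Z, hom Y Z -> hom X Y -> hom X Z;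
  cmpA : forall X Y Z W (h : hom Z W) (g : hom Y Z) (f : hom X Y),
    cmp h (cmp g f) = cmp (cmp h g) f;
  cmp1m : forall X Y (f : hom X Y), cmp (idm Y) f = f;
  cmpm1 : forall X Y (f : hom X Y), cmp f (idm X) = f;
  cmp_linearl : forall X Y Z (f : hom X Y) (c : K) (g g' : hom Y Z),
    cmp (c *: g + g') f = c *: cmp g f + cmp g' f;
  cmp_linearr : forall X Y Z (g : hom Y Z) (c : K) (f f' : hom X Y),
    cmp g (c *: f + f') = c *: cmp g f + cmp g f';
  sh : int -> obj -> obj;
  shm : forall m X Y, hom X Y -> hom (sh m X) (sh m Y);
  shm1 : forall m X, shm m (idm X) = idm (sh m X);
  shmM : forall m X Y Z (g : hom Y Z) (f : hom X Y),
    shm m (cmp g f) = cmp (shm m g) (shm m f);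
  shm_linear : forall m X Y (c : K) (f f' : hom X Y),
    shm m (c *: f + f') = c *: shm m f + shm m f';
  shU : forall X, hom (sh 0 X) X;
  shU_iso : forall X, exists g : hom X (sh 0 X),
    cmp g (shU X) = idm _ /\ cmp (shU X) g = idm _;
  shU_nat : forall X Y (f : hom X Y), cmp f (shU X) = cmp (shU Y) (shm 0 f);
  shD : forall a b c, c = a + b -> forall X, hom (sh c X) (sh a (sh b X));
  shD_iso : forall a b c (E : c = a + b) X,
    exists g : hom (sh a (sh b X)) (sh c X),
      cmp g (shD E X) = idm _ /\ cmp (shD E X) g = idm _;
  shD_nat : forall a b c (E : c = a + b) X Y (f : hom X Y),
    cmp (shm a (shm b f)) (shD E X) = cmp (shD E Y) (shm c f);
  shDA : forall a b c ab bc abc (E1 : ab = a + b) (E2 : abc = ab + c)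
      (E3 : bc = b + c) (E4 : abc = a + bc) X,
    cmp (shD E1 (sh c X)) (shD E2 X) = cmp (shm a (shD E3 X)) (shD E4 X);
  sh0D : forall a (E : a = 0 + a) X,
    cmp (shU (sh a X)) (shD E X) = idm (sh a X);
  shD0 : forall a (E : a = a + 0) X,
    cmp (shm a (shU X)) (shD E X) = idm (sh a X)
}.

Arguments idm {K C} X : rename.
Arguments cmp {K C X Y Z} g f : rename.
Arguments sh {K C} m X : rename.
Arguments shm {K C} m {X Y} f : rename.
Arguments shU {K C} X : rename.
Arguments shD {K C} a b {c} E X : rename.

Section AbelianNotions.
Variables (K : fieldType) (C : gcat K).
Implicit Types X Y Z W : C.

Definition iso X Y (f : hom X Y) : Prop :=
  exists g : hom Y X, cmp g f = idm X /\ cmp f g = idm Y.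

Definition isomorphic X Y : Prop := exists f : hom X Y, iso f.

Definition mono X Y (f : hom X Y) : Prop :=
  forall W (g h : hom W X), cmp f g = cmp f h -> g = h.

Definition epi X Y (f : hom X Y) : Prop :=
  forall W (g h : hom Y W), cmp g f = cmp h f -> g = h.

Definition zero_object X : Prop := idm X = 0.

Definition kernel X Y (f : hom X Y) Z (i : hom Z X) : Prop :=
  cmp f i = 0 /\
  forall W (g : hom W X), cmp f g = 0 -> exists! h : hom W Z, cmp i h = g.

Definition cokernel X Y (f : hom X Y) Z (p : hom Y Z) : Prop :=
  cmp p f = 0 /\
  forall W (g : hom Y W), cmp g f = 0 -> exists! h : hom Z W, cmp h p = g.

Definition biproduct X Y Z (i1 : hom X Z) (i2 : hom Y Z)
    (p1 : hom Z X) (p2 : hom Z Y) : Prop :=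
  [/\ cmp p1 i1 = idm X, cmp p2 i2 = idm Y, cmp p1 i2 = 0, cmp p2 i1 = 0
    & cmp i1 p1 + cmp i2 p2 = idm Z].

Definition abelian : Prop :=
  [/\ exists Z : C, zero_object Z,
      forall X Y, exists Z (i1 : hom X Z) (i2 : hom Y Z)
        (p1 : hom Z X) (p2 : hom Z Y), biproduct i1 i2 p1 p2,
      forall X Y (f : hom X Y),
        (exists Z (i : hom Z X), kernel f i) /\
        (exists Z (p : hom Y Z), cokernel f p),
      forall X Y (f : hom X Y), mono f ->
        exists Z (g : hom Y Z), kernel g f
    & forall X Y (f : hom X Y), epi f ->
        exists Z (g : hom Z X), cokernel g f].

Definition simple X : Prop :=
  ~ zero_object X /\
  forall Y (i : hom Y X), mono i -> zero_object Y \/ iso i.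

(* [i] factors through [j]: for monomorphisms, inclusion of subobjects. *)
Definition factors X Y W (i : hom X W) (j : hom Y W) : Prop :=
  exists h : hom X Y, cmp j h = i.

Definition noetherian W : Prop :=
  forall (X : nat -> C) (i : forall m, hom (X m) W),
    (forall m, mono (i m)) -> (forall m, factors (i m) (i m.+1)) ->
    exists N, forall m, (N <= m)%N -> factors (i m) (i N).

Inductive finite_length : C -> Prop :=
| finite_length0 X : zero_object X -> finite_length X
| finite_lengthS X Y S (i : hom X Y) (p : hom Y S) :
    kernel p i -> cokernel i p -> finite_length X -> simple S ->
    finite_length Y.

Definition separated_filtration W (X : nat -> C) (i : forall m, hom (X m) W) :
    Prop :=
  [/\ forall m, mono (i m),
      forall m, factors (i m.+1) (i m)
    & forall Y (g : hom Y W), (forall m, factors g (i m)) -> g = 0].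

Definition projective P : Prop :=
  forall X Y (p : hom X Y) (f : hom P Y), epi p ->
    exists g : hom P X, cmp p g = f.

Definition projective_cover P L (p : hom P L) : Prop :=
  [/\ projective P, epi p
    & forall X (f : hom X P), epi (cmp p f) -> epi f].

Definition finite_dimensional (U : lmodType K) : Prop :=
  exists (r : nat) (b : 'I_r -> U), forall u, exists c : 'I_r -> K,
    u = \sum_j c j *: b j.

(* [Hom(U, W)] is the graded vector space with components [hom(q^m U, W)]. *)
Definition laurentian_Hom U W : Prop :=
  (forall m, finite_dimensional (hom (sh m U) W)) /\
  exists N : int, forall m, m < N -> forall f : hom (sh m U) W, f = 0.

Definition subquotient L W : Prop :=
  exists (X : C) (i : hom X W) (p : hom X L), mono i /\ epi p.

(* Composition of homogeneous elements of [Hom(Y, Z)] and [Hom(X, Y)]. *)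
Definition gcmp a b c (E : c = b + a) X Y Z
    (g : hom (sh b Y) Z) (f : hom (sh a X) Y) : hom (sh c X) Z :=
  cmp g (cmp (shm b f) (shD b a E X)).

End AbelianNotions.

Section PolynomialHighestWeight.
Variables (K : fieldType) (C : gcat K) (Pi : Type).

Definition complete_irredundant_simples (L : Pi -> C) : Prop :=
  [/\ forall a, simple (L a),
      forall S : C, simple S -> exists a m, isomorphic S (sh m (L a))
    & forall a b m, isomorphic (L a) (sh m (L b)) -> a = b].

Definition noetherian_laurentian (L P : Pi -> C)
    (p : forall a, hom (P a) (L a)) : Prop :=
  [/\ abelian C,
      complete_irredundant_simples L,
      forall W : C, noetherian W /\
        exists (X : nat -> C) (i : forall m, hom (X m) W),
          separated_filtration i /\
          forall m Z (c : hom W Z), cokernel (i m) c -> finite_length Z,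
      forall a, projective_cover (p a)
    & forall a b, laurentian_Hom (P a) (P b)].

Definition partial_order (le : Pi -> Pi -> Prop) : Prop :=
  [/\ forall a, le a a,
      forall a b, le a b -> le b a -> a = b
    & forall a b c, le a b -> le b c -> le a c].

Definition factors_below (L : Pi -> C) (le : Pi -> Pi -> Prop) a (W : C) :
    Prop :=
  forall b m, subquotient (sh m (L b)) W -> le b a.

Definition standard_quotient (L : Pi -> C) (le : Pi -> Pi -> Prop) a (P D : C)
    (rho : hom P D) : Prop :=
  [/\ epi rho, factors_below L le a D
    & forall Q (p : hom P Q), epi p -> factors_below L le a Q ->
        exists h : hom D Q, cmp h rho = p].

(* Zero subquotients are allowed, so that finite filtrations are included. *)
Definition Delta_filtration (D : Pi -> C) (S : Pi -> Prop) (W : C) : Prop :=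
  exists (X : nat -> C) (i : forall m, hom (X m) W),
    [/\ separated_filtration i, iso (i 0)
      & forall m (j : hom (X m.+1) (X m)) Z (c : hom (X m) Z),
          cmp (i m) j = i m.+1 -> cokernel j c ->
          zero_object Z \/ exists b d, S b /\ isomorphic Z (sh d (D b))].

Definition phw1 (le : Pi -> Pi -> Prop) (P D : Pi -> C)
    (rho : forall a, hom (P a) (D a)) a : Prop :=
  exists (Z : C) (i : hom Z (P a)), kernel (rho a) i /\
    Delta_filtration D (fun b => le a b /\ a <> b) Z.

(* [p] is homogeneous of degree [m] when the variable [z_i] has degree [w i]. *)
Definition whomog N (w : 'I_N -> nat) (m : int) (p : {mpoly K[N]}) : Prop :=
  forall u : 'X_{1..N}, u \in mpoly.msupp p -> (\sum_i w i * u i)%N%:Z = m.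

(* [phi m] is the component of degree [m] of an isomorphism of graded algebras
   from [K[z_1, ..., z_N]] to [End(D)^op]; the product of [x] and [y] in the
   opposite algebra is [y o x]. *)
Definition phw2 (D : C) : Prop :=
  exists (N : nat) (w : 'I_N -> nat)
    (phi : forall m : int, {linear {mpoly K[N]} -> hom (sh m D) D}),
  [/\ forall i, (0 < w i)%N,
      forall m (f : hom (sh m D) D),
        exists! p : {mpoly K[N]}, whomog w m p /\ phi m p = f,
      phi 0 1 = shU D
    & forall a b c (E : c = b + a) (p q : {mpoly K[N]}),
        whomog w a p -> whomog w b q ->
        phi c (p * q) = gcmp E (phi b q) (phi a p)].

(* [Hom(P, D)] has a finite homogeneous basis [e_j] over [End(D)^op]. *)
Definition phw3 (P D : C) : Prop :=
  exists (r : nat) (d : 'I_r -> int) (e : forall j, hom (sh (d j) P) D),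
  forall m (f : hom (sh m P) D),
    exists! b : (forall j, hom (sh (m - d j) D) D),
      f = \sum_j gcmp (esym (subrK (d j) m)) (b j) (e j).

(* [(C, Pi, le)] is a polynomial highest weight category with simple objects
   [L a] and with standard objects [D a]. *)
Definition polynomial_highest_weight (L : Pi -> C) (le : Pi -> Pi -> Prop)
    (D : Pi -> C) : Prop :=
  exists (P : Pi -> C) (p : forall a, hom (P a) (L a))
         (rho : forall a, hom (P a) (D a)),
  [/\ noetherian_laurentian p,
      partial_order le,
      forall a, standard_quotient L le a (rho a)
    & forall a, [/\ phw1 le rho a, phw2 (D a) & forall b, phw3 (P a) (D b)]].

End PolynomialHighestWeight.

(* A grading by the integers, given by the projections [pr d] onto the
   homogeneous components; [homogeneous G d x] says that [x] has degree [d]. *)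
Record grading (M : zmodType) := Grading {
  pr : int -> M -> M;
  prD : forall d x y, pr d (x + y) = pr d x + pr d y;
  pr_pr : forall d e x, pr d (pr e x) = if d == e then pr e x else 0;
  pr_sum : forall x, exists s : seq int, uniq s /\ x = \sum_(d <- s) pr d x
}.

Definition homogeneous (M : zmodType) (G : grading M) (d : int) (x : M) : Prop :=
  pr G d x = x.

Section GradingTheory.
Variables (M : zmodType) (G : grading M).

Lemma pr0 d : pr G d 0 = 0.
Proof. by apply: (addrI (pr G d 0)); rewrite -prD !addr0. Qed.

Lemma prN d x : pr G d (- x) = - pr G d x.
Proof. by apply: (addrI (pr G d x)); rewrite -prD !subrr pr0. Qed.

Lemma pr_bigsum d (I : Type) (r : seq I) (P : pred I) (F : I -> M) :
  pr G d (\sum_(i <- r | P i) F i) = \sum_(i <- r | P i) pr G d (F i).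
Proof. by apply: (big_morph (pr G d) (prD G d) (pr0 d)). Qed.

Lemma homog_pr d x : homogeneous G d (pr G d x).
Proof. by rewrite /homogeneous pr_pr eqxx. Qed.

Lemma homog0 d : homogeneous G d 0. Proof. exact: pr0. Qed.

Lemma homogD d x y : homogeneous G d x -> homogeneous G d y -> homogeneous G d (x + y).
Proof. by rewrite /homogeneous prD => -> ->. Qed.

Lemma homogN d x : homogeneous G d x -> homogeneous G d (- x).
Proof. by rewrite /homogeneous prN => ->. Qed.

Lemma pr_homog d e x : homogeneous G e x -> pr G d x = if d == e then x else 0.
Proof. by move=> <-; rewrite pr_pr. Qed.

End GradingTheory.

(* A graded associative unital [K]-algebra, possibly zero.  ([algType K] would
   exclude the zero algebra.) *)
Record galg (K : fieldType) := GAlg {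
  ga_car :> pzRingType;
  ga_scal : {rmorphism K -> ga_car};
  ga_scalC : forall c a, ga_scal c * a = a * ga_scal c;
  ga_gr : grading ga_car;
  ga_scal_homog : forall c, homogeneous ga_gr 0 (ga_scal c);
  ga_mul_homog : forall i j a b, homogeneous ga_gr i a -> homogeneous ga_gr j b ->
    homogeneous ga_gr (i + j) (a * b)
}.

Record gmod (K : fieldType) (A : galg K) := GMod {
  gm_car :> lmodType A;
  gm_gr : grading gm_car;
  gm_act_homog : forall i j (a : A) (x : gm_car),
    homogeneous (ga_gr A) i a -> homogeneous gm_gr j x -> homogeneous gm_gr (i + j) (a *: x)
}.

Definition finitely_generated (A : pzRingType) (M : lmodType A) : Prop :=
  exists (r : nat) (g : 'I_r -> M), forall x, exists c : 'I_r -> A,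
    x = \sum_j c j *: g j.

Record fgmod (K : fieldType) (A : galg K) := FGMod {
  fg_mod :> gmod A;
  fg_fin : finitely_generated fg_mod
}.

Section GradedHom.
Variables (K : fieldType) (A : galg K).

Record ghom (M N : gmod A) := GHom {
  gh_fun :> M -> N;
  gh_linear : forall (a : A) (x y : M), gh_fun (a *: x + y) = a *: gh_fun x + gh_fun y;
  gh_homog : forall d x, homogeneous (gm_gr M) d x -> homogeneous (gm_gr N) d (gh_fun x)
}.

Lemma ghomP (M N : gmod A) (f g : ghom M N) : (forall x, f x = g x) -> f = g.
Proof.
case: f g => [f fl fh] [g gl gh] /= /funext E; subst g.
by congr GHom; apply: Prop_irrelevance.
Qed.

HB.instance Definition _ M N := gen_eqMixin (ghom M N).
HB.instance Definition _ M N := gen_choiceMixin (ghom M N).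

Section Ops.
Variables M N : gmod A.

Fact gh0_lin (a : A) (x y : M) : (0 : N) = a *: 0 + 0.
Proof. by rewrite scaler0 addr0. Qed.
Definition gh0 := GHom gh0_lin (fun d x _ => homog0 (gm_gr N) d).

Fact ghN_lin (f : ghom M N) (a : A) (x y : M) :
  - f (a *: x + y) = a *: (- f x) + - f y.
Proof. by rewrite gh_linear opprD scalerN. Qed.
Definition ghN f := GHom (ghN_lin f)
  (fun d x h => homogN (gh_homog f h)).

Fact ghD_lin (f g : ghom M N) (a : A) (x y : M) :
  f (a *: x + y) + g (a *: x + y) = a *: (f x + g x) + (f y + g y).
Proof. by rewrite !gh_linear scalerDr addrACA. Qed.
Definition ghD f g := GHom (ghD_lin f g)
  (fun d x h => homogD (gh_homog f h) (gh_homog g h)).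

Fact ghZ_lin c (f : ghom M N) (a : A) (x y : M) :
  ga_scal A c *: f (a *: x + y) =
  a *: (ga_scal A c *: f x) + ga_scal A c *: f y.
Proof. by rewrite gh_linear scalerDr !scalerA ga_scalC. Qed.
Fact ghZ_homog c (f : ghom M N) d x :
  homogeneous (gm_gr M) d x -> homogeneous (gm_gr N) d (ga_scal A c *: f x).
Proof.
move=> h; rewrite -[d]add0r.
by apply: gm_act_homog (ga_scal_homog A c) (gh_homog f h).
Qed.
Definition ghZ c f := GHom (ghZ_lin c f) (@ghZ_homog c f).

Fact ghDA : associative ghD.
Proof. by move=> f g h; apply: ghomP => x /=; rewrite addrA. Qed.
Fact ghDC : commutative ghD.
Proof. by move=> f g; apply: ghomP => x /=; rewrite addrC. Qed.
Fact gh0D : left_id gh0 ghD.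
Proof. by move=> f; apply: ghomP => x /=; rewrite add0r. Qed.
Fact ghND : left_inverse gh0 ghN ghD.
Proof. by move=> f; apply: ghomP => x /=; rewrite addNr. Qed.
HB.instance Definition _ := GRing.isZmodule.Build (ghom M N) ghDA ghDC gh0D ghND.

Fact ghZA c d f : ghZ c (ghZ d f) = ghZ (c * d) f.
Proof. by apply: ghomP => x /=; rewrite scalerA rmorphM. Qed.
Fact gh1Z : left_id 1 ghZ.
Proof. by move=> f; apply: ghomP => x /=; rewrite rmorph1 scale1r. Qed.
Fact ghZDr : right_distributive ghZ +%R.
Proof. by move=> c f g; apply: ghomP => x /=; rewrite scalerDr. Qed.
Fact ghZDl f : {morph ghZ^~ f : c d / c + d}.
Proof. by move=> c d; apply: ghomP => x /=; rewrite rmorphD scalerDl. Qed.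
HB.instance Definition _ :=
  GRing.Zmodule_isLmodule.Build K (ghom M N) ghZA gh1Z ghZDr ghZDl.

End Ops.

Fact gid_lin (M : gmod A) (a : A) (x y : M) : a *: x + y = a *: x + y.
Proof. by []. Qed.
Definition gid (M : gmod A) : ghom M M := GHom (@gid_lin M) (fun d x h => h).

Fact gcomp_lin (M N Q : gmod A) (g : ghom N Q) (f : ghom M N) (a : A) (x y : M) :
  g (f (a *: x + y)) = a *: g (f x) + g (f y).
Proof. by rewrite !gh_linear. Qed.
Definition gcomp (M N Q : gmod A) (g : ghom N Q) (f : ghom M N) : ghom M Q :=
  GHom (gcomp_lin g f) (fun d x h => gh_homog g (gh_homog f h)).

(* The shift [q^m M], with [(q^m M)_d = M_(d - m)]. *)
Section Shift.
Variables (m : int) (M : gmod A).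

Fact shift_pr_pr d e (x : M) : pr (gm_gr M) (d - m) (pr (gm_gr M) (e - m) x) =
  if d == e then pr (gm_gr M) (e - m) x else 0.
Proof. by rewrite pr_pr (inj_eq (addIr _)). Qed.

Fact shift_pr_sum (x : M) : exists s : seq int,
  uniq s /\ x = \sum_(d <- s) pr (gm_gr M) (d - m) x.
Proof.
have [s [us xE]] := pr_sum (gm_gr M) x.
exists [seq d + m | d <- s]; split; first by rewrite map_inj_uniq //; exact: addIr.
by rewrite big_map {1}xE; apply: eq_bigr => d _; rewrite addrK.
Qed.

Definition shift_gr : grading M :=
  Grading (fun d => prD (gm_gr M) (d - m)) shift_pr_pr shift_pr_sum.

Fact shift_act i j (a : A) (x : M) :
  homogeneous (ga_gr A) i a -> homogeneous shift_gr j x -> homogeneous shift_gr (i + j) (a *: x).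
Proof. by move=> ha hx; rewrite /homogeneous /= -addrA; apply: gm_act_homog. Qed.

Definition gshift : gmod A := GMod shift_act.

End Shift.

Definition gshift_map m (M N : gmod A) (f : ghom M N) :
    ghom (gshift m M) (gshift m N) :=
  @GHom (gshift m M) (gshift m N) f (gh_linear f)
    (fun d x h => gh_homog f (h : homogeneous (gm_gr M) (d - m) x)).

Definition fgshift m (M : fgmod A) : fgmod A :=
  @FGMod K A (gshift m M) (fg_fin M).

Section ShiftIso.
Variable M : gmod A.

Fact gshift0_homog d (x : M) :
  homogeneous (gm_gr (gshift 0 M)) d x -> homogeneous (gm_gr M) d x.
Proof. by rewrite /homogeneous /= subr0. Qed.
Definition gshift0 : ghom (gshift 0 M) M :=
  @GHom (gshift 0 M) M id (@gid_lin M) gshift0_homog.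

Fact gshift0V_homog d (x : M) :
  homogeneous (gm_gr M) d x -> homogeneous (gm_gr (gshift 0 M)) d x.
Proof. by rewrite /homogeneous /= subr0. Qed.
Definition gshift0V : ghom M (gshift 0 M) :=
  @GHom M (gshift 0 M) id (@gid_lin M) gshift0V_homog.

Variables (a b c : int) (E : c = a + b).

Fact gshiftD_homog d (x : M) :
  homogeneous (gm_gr (gshift c M)) d x -> homogeneous (gm_gr (gshift a (gshift b M))) d x.
Proof. by rewrite /homogeneous /= E opprD addrA. Qed.
Definition gshiftD : ghom (gshift c M) (gshift a (gshift b M)) :=
  @GHom (gshift c M) (gshift a (gshift b M)) id (@gid_lin M) gshiftD_homog.

Fact gshiftDV_homog d (x : M) :
  homogeneous (gm_gr (gshift a (gshift b M))) d x -> homogeneous (gm_gr (gshift c M)) d x.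
Proof. by rewrite /homogeneous /= E opprD addrA. Qed.
Definition gshiftDV : ghom (gshift a (gshift b M)) (gshift c M) :=
  @GHom (gshift a (gshift b M)) (gshift c M) id (@gid_lin M) gshiftDV_homog.

End ShiftIso.

Fact gcomp_scale (M N Q : gmod A) (g : ghom N Q) c (f f' : ghom M N) :
  gcomp g (c *: f + f') = c *: gcomp g f + gcomp g f'.
Proof. by apply: ghomP => x; rewrite /= gh_linear. Qed.

Fact gshiftD_iso (a b c : int) (E : c = a + b) (M : gmod A) :
  exists g : ghom (gshift a (gshift b M)) (gshift c M),
    gcomp g (gshiftD M E) = gid _ /\ gcomp (gshiftD M E) g = gid _.
Proof. by exists (gshiftDV M E); split; apply: ghomP. Qed.

Fact gshift0_iso (M : gmod A) :
  exists g : ghom M (gshift 0 M),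
    gcomp g (gshift0 M) = gid _ /\ gcomp (gshift0 M) g = gid _.
Proof. by exists (gshift0V M); split; apply: ghomP. Qed.

Local Obligation Tactic := by intros; apply: ghomP.

Program Definition gmodcat : gcat K :=
  @GCat K (fgmod A) (fun M N => ghom M N) (fun M => gid M)
    (fun M N Q g f => gcomp g f) _ _ _ _ (fun M N Q => @gcomp_scale M N Q)
    fgshift (fun m M N f => gshift_map m f) _ _ _
    (fun M => gshift0 M) (fun M => gshift0_iso M) _
    (fun a b c E M => gshiftD M E) (fun a b c E M => gshiftD_iso E M) _ _ _ _.

End GradedHom.

Section ModuleConstructions.
Variables (K : fieldType) (A : galg K).

Definition gregular : gmod A := @GMod K A (A^o)%type (ga_gr A) (@ga_mul_homog K A).

Section GradedSubmodule.
Variable M : gmod A.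

Record gsubmod := GSubmod {
  gs_pred : {pred M};
  gs_closed : submod_closed gs_pred;
  gs_pr : forall d x, x \in gs_pred -> pr (gm_gr M) d x \in gs_pred
}.

HB.instance Definition _ (N : gsubmod) :=
  GRing.isSubmodClosed.Build A M (gs_pred N) (gs_closed N).

Section Span.
Variables (I : finType) (P : pred I) (g : I -> M) (e : I -> int).
Hypothesis gP : forall i, homogeneous (gm_gr M) (e i) (g i).

Definition span_pred : {pred M} :=
  fun x => `[< exists c : I -> A, x = \sum_(i | P i) c i *: g i >].

Fact span_closed : submod_closed span_pred.
Proof.
split=> [|a x y].
  by apply/asboolP; exists (fun=> 0); rewrite big1 // => i _; rewrite scale0r.
move=> /asboolP[c ->] /asboolP[c' ->]; apply/asboolP.
exists (fun i => a * c i + c' i); rewrite scaler_sumr -big_split /=.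
by apply: eq_bigr => i _; rewrite scalerDl scalerA.
Qed.

Lemma pr_scale_homogeneous (a : A) (x : M) d j :
  homogeneous (gm_gr M) j x ->
  pr (gm_gr M) d (a *: x) = pr (ga_gr A) (d - j) a *: x.
Proof.
move=> hx; have [s [us aE]] := pr_sum (ga_gr A) a.
rewrite {2}aE pr_bigsum scaler_suml {1}aE scaler_suml pr_bigsum.
apply: eq_bigr => i _; rewrite pr_pr.
rewrite (pr_homog d (gm_act_homog (homog_pr _ i a) hx)).
by rewrite -subr_eq; case: eqP => _ //; rewrite scale0r.
Qed.

Fact span_pr d x : x \in span_pred -> pr (gm_gr M) d x \in span_pred.
Proof.
move=> /asboolP[c ->]; apply/asboolP.
exists (fun i => pr (ga_gr A) (d - e i) (c i)); rewrite pr_bigsum.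
by apply: eq_bigr => i _; exact: pr_scale_homogeneous.
Qed.

Definition gspan : gsubmod := GSubmod span_closed span_pr.

End Span.

Section Sub.
Variable N : gsubmod.

Definition sub_car := {x : M | x \in gs_pred N}.
HB.instance Definition _ := SubChoice.on sub_car.
HB.instance Definition _ := [SubChoice_isSubZmodule of sub_car by <:].
HB.instance Definition _ := [SubZmodule_isSubLmodule of sub_car by <:].

Definition sub_pr d (x : sub_car) : sub_car :=
  Sub (pr (gm_gr M) d (val x)) (gs_pr d (valP x)).

Fact sub_prD d x y : sub_pr d (x + y) = sub_pr d x + sub_pr d y.
Proof. by apply: val_inj; rewrite /= prD. Qed.

Fact sub_pr_pr d e x : sub_pr d (sub_pr e x) = if d == e then sub_pr e x else 0.
Proof. by apply: val_inj; rewrite /= pr_pr; case: eqP. Qed.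

Fact sub_pr_sum x : exists s : seq int, uniq s /\ x = \sum_(d <- s) sub_pr d x.
Proof.
have [s [us xE]] := pr_sum (gm_gr M) (val x).
exists s; split=> //; apply: val_inj; rewrite raddf_sum /= {1}xE.
by apply: eq_bigr.
Qed.

Definition sub_gr : grading sub_car := Grading sub_prD sub_pr_pr sub_pr_sum.

Fact sub_act i j (a : A) (x : sub_car) : homogeneous (ga_gr A) i a ->
  homogeneous sub_gr j x -> homogeneous sub_gr (i + j) (a *: x).
Proof.
move=> ha /(congr1 val) /= hx; apply: val_inj => /=.
exact: gm_act_homog ha hx.
Qed.

Definition gsub : gmod A := GMod sub_act.

End Sub.

Section Quot.
Variable N : gsubmod.

Definition quot_car := Quotient.quot (gs_pred N).
HB.instance Definition _ := ZmodQuotient.on quot_car.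

Lemma quot_ind (P : quot_car -> Prop) :
  (forall x : M, P (\pi_quot_car x)) -> forall v, P v.
Proof. by move=> h v; rewrite -[v]reprK. Qed.

Lemma quot_eq (x y : M) : x - y \in gs_pred N -> \pi_quot_car x = \pi_quot_car y.
Proof. by rewrite Quotient.idealrBE => /eqP. Qed.

Lemma quot_repr (x : M) : repr (\pi_quot_car x) - x \in gs_pred N.
Proof. by rewrite Quotient.idealrBE reprK. Qed.

Lemma quot_piD (x y : M) : \pi_quot_car (x + y) = \pi_quot_car x + \pi_quot_car y.
Proof. exact: (Quotient.pi_add (gs_pred N)). Qed.

Lemma quot_pi0 : \pi_quot_car (0 : M) = 0.
Proof. by apply: (addrI (\pi_quot_car (0 : M))); rewrite -quot_piD !addr0. Qed.

Definition quot_scale (a : A) (x : quot_car) : quot_car := \pi_quot_car (a *: repr x).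

Lemma quot_scale_pi a (x : M) : quot_scale a (\pi_quot_car x) = \pi_quot_car (a *: x).
Proof. by apply: quot_eq; rewrite -scalerBr rpredZ // quot_repr. Qed.

Fact quot_scaleA a b v : quot_scale a (quot_scale b v) = quot_scale (a * b) v.
Proof. by elim/quot_ind: v => x; rewrite !quot_scale_pi scalerA. Qed.
Fact quot_scale1 : left_id 1 quot_scale.
Proof. by elim/quot_ind => x; rewrite quot_scale_pi scale1r. Qed.
Fact quot_scaleDr : right_distributive quot_scale +%R.
Proof.
move=> a; elim/quot_ind=> x; elim/quot_ind=> y.
by rewrite -quot_piD !quot_scale_pi scalerDr quot_piD.
Qed.
Fact quot_scaleDl v : {morph quot_scale^~ v : a b / a + b}.
Proof.
elim/quot_ind: v => x a b.
by rewrite !quot_scale_pi scalerDl quot_piD.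
Qed.
HB.instance Definition _ := GRing.Zmodule_isLmodule.Build A quot_car
  quot_scaleA quot_scale1 quot_scaleDr quot_scaleDl.

Definition quot_pr d (x : quot_car) : quot_car := \pi_quot_car (pr (gm_gr M) d (repr x)).

Lemma quot_pr_pi d (x : M) : quot_pr d (\pi_quot_car x) = \pi_quot_car (pr (gm_gr M) d x).
Proof.
by apply: quot_eq; rewrite -(prN (gm_gr M)) -prD gs_pr // quot_repr.
Qed.

Fact quot_prD d x y : quot_pr d (x + y) = quot_pr d x + quot_pr d y.
Proof.
elim/quot_ind: x => x; elim/quot_ind: y => y.
by rewrite -quot_piD !quot_pr_pi prD quot_piD.
Qed.

Fact quot_pr_pr d e x :
  quot_pr d (quot_pr e x) = if d == e then quot_pr e x else 0.
Proof.
elim/quot_ind: x => x; rewrite !quot_pr_pi pr_pr; case: eqP => // _.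
exact: quot_pi0.
Qed.

Fact quot_pr_sum x : exists s : seq int, uniq s /\ x = \sum_(d <- s) quot_pr d x.
Proof.
elim/quot_ind: x => x; have [s [us xE]] := pr_sum (gm_gr M) x.
exists s; split=> //; rewrite {1}xE.
rewrite (big_morph (\pi_quot_car) quot_piD quot_pi0).
by apply: eq_bigr => d _; rewrite quot_pr_pi.
Qed.

Definition quot_gr : grading quot_car := Grading quot_prD quot_pr_pr quot_pr_sum.

Fact quot_act i j (a : A) (x : quot_car) : homogeneous (ga_gr A) i a ->
  homogeneous quot_gr j x -> homogeneous quot_gr (i + j) (a *: x).
Proof.
elim/quot_ind: x => x ha hx; rewrite -hx [pr _ _ _]quot_pr_pi.
change (quot_pr (i + j) (quot_scale a (\pi_quot_car (pr (gm_gr M) j x))) =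
  quot_scale a (\pi_quot_car (pr (gm_gr M) j x))).
by rewrite quot_scale_pi quot_pr_pi (gm_act_homog ha (homog_pr _ j x)).
Qed.

Definition gquot : gmod A := GMod quot_act.

End Quot.

End GradedSubmodule.

(* For graded submodules [N' <= N] of [M], the inclusion [N' <= N] read as a
   graded submodule of [gsub N]; in general this is [N' :&: N]. *)
Section Restrict.
Variables (M : gmod A) (N N' : gsubmod M).

Definition restrict_pred : {pred gsub N} := fun x => val x \in gs_pred N'.

Fact restrict_closed : submod_closed restrict_pred.
Proof.
split=> [|a x y]; first exact: (rpred0 (gs_pred N')).
move=> hx hy; have: a *: val x + val y \in gs_pred N'; last by [].
by rewrite rpredD ?rpredZ.
Qed.

Fact restrict_pr d x : x \in restrict_pred -> pr (gm_gr (gsub N)) d x \in restrict_pred.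
Proof. by move=> hx; apply: gs_pr. Qed.

Definition grestrict : gsubmod (gsub N) := GSubmod restrict_closed restrict_pr.

End Restrict.

(* The one-dimensional module [K], in degree zero, on which [A] acts through a
   morphism of graded algebras [chi : A -> K]. *)
Section Character.
Variable chi : {rmorphism A -> K}.
Hypothesis chi_scal : forall c, chi (ga_scal A c) = c.
Hypothesis chi_homog : forall d a, homogeneous (ga_gr A) d a -> d != 0 -> chi a = 0.

Definition char_car of (forall d a, homogeneous (ga_gr A) d a -> d != 0 -> chi a = 0) :=
  (K : Type).
Local Notation L := (char_car chi_homog).
HB.instance Definition _ := GRing.Zmodule.on L.

Definition char_scale (a : A) (x : L) : L := chi a * (x : K).

Fact char_scaleA a b v : char_scale a (char_scale b v) = char_scale (a * b) v.
Proof. by rewrite /char_scale rmorphM mulrA. Qed.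
Fact char_scale1 : left_id 1 char_scale.
Proof. by move=> x; rewrite /char_scale rmorph1 mul1r. Qed.
Fact char_scaleDr : right_distributive char_scale +%R.
Proof. by move=> a x y; rewrite /char_scale mulrDr. Qed.
Fact char_scaleDl v : {morph char_scale^~ v : a b / a + b}.
Proof. by move=> a b; rewrite /char_scale rmorphD mulrDl. Qed.
HB.instance Definition _ := GRing.Zmodule_isLmodule.Build A L
  char_scaleA char_scale1 char_scaleDr char_scaleDl.

Definition char_pr (d : int) (x : L) : L := if d == 0 then x else 0.

Fact char_prD d x y : char_pr d (x + y) = char_pr d x + char_pr d y.
Proof. by rewrite /char_pr; case: eqP; rewrite ?addr0. Qed.
Fact char_pr_pr d e x :
  char_pr d (char_pr e x) = if d == e then char_pr e x else 0.
Proof.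
rewrite /char_pr; case: (eqVneq d e) => [-> |]; first by case: eqP.
by case: (eqVneq d 0) => [->|] //; case: (eqVneq e 0) => // ->; rewrite eqxx.
Qed.
Fact char_pr_sum x : exists s : seq int, uniq s /\ x = \sum_(d <- s) char_pr d x.
Proof. by exists [:: 0]; rewrite big_seq1. Qed.

Definition char_gr : grading L := Grading char_prD char_pr_pr char_pr_sum.

Fact char_act i j (a : A) (x : L) : homogeneous (ga_gr A) i a ->
  homogeneous char_gr j x -> homogeneous char_gr (i + j) (a *: x).
Proof.
rewrite /homogeneous /= /char_pr => ha.
case: (eqVneq j 0) => [-> _|_ <-]; last by rewrite scaler0; case: eqP.
rewrite addr0; case: (eqVneq i 0) => // i0.
have -> : a *: x = 0; last by [].
by rewrite [LHS]/(char_scale a x) /char_scale (chi_homog ha i0) [LHS](mul0r (x : K)).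
Qed.

Definition gchar : gmod A := GMod char_act.

Fact gchar_fg : finitely_generated gchar.
Proof.
exists 1, (fun=> 1 : K) => x; exists (fun=> ga_scal A x).
rewrite big_ord1; change ((x : K) = chi (ga_scal A x) * (1 : K)).
by rewrite chi_scal mulr1.
Qed.
End Character.

Fact gsub_span_fg (M : gmod A) (I : finType) (P : pred I) (g : I -> M)
    (e : I -> int) (gP : forall i, homogeneous (gm_gr M) (e i) (g i)) :
  finitely_generated (gsub (gspan P gP)).
Proof.
have gN i : P i -> g i \in gs_pred (gspan P gP).
  move=> Pi; apply/asboolP; exists (fun j => (j == i)%:R).
  rewrite (bigD1 i) //= eqxx scale1r big1 ?addr0 // => j /andP[_ /negPf ->].
  by rewrite scale0r.
pose h (j : 'I_#|P|) : gsub (gspan P gP) := Sub (g (enum_val j)) (gN _ (enum_valP j)).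
exists #|P|, h => -[x xN]; have /asboolP[c xE] := xN.
exists (fun j => c (enum_val j)); apply: val_inj.
rewrite (raddf_sum (val : sub_car (gspan P gP) -> M)) /= xE.
by rewrite (big_enum_val (fun i => c i *: g i)).
Qed.

Fact gquot_fg (M : gmod A) (N : gsubmod M) :
  finitely_generated M -> finitely_generated (gquot N).
Proof.
move=> [r [g gP]]; exists r, (fun j => \pi_(quot_car N) (g j)).
elim/quot_ind => x; have [c {1}->] := gP x; exists c.
rewrite (big_morph (\pi_(quot_car N)) (@quot_piD _ N) (quot_pi0 N)).
by apply: eq_bigr => j _; rewrite -quot_scale_pi.
Qed.

End ModuleConstructions.

Section QuotientAlgebra.
Variables (K : fieldType) (T : galg K) (rel : T -> Prop).

Inductive ideal_gen : T -> Prop :=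
| ideal_rel x : rel x -> ideal_gen x
| ideal0 : ideal_gen 0
| idealD x y : ideal_gen x -> ideal_gen y -> ideal_gen (x + y)
| idealMl a x : ideal_gen x -> ideal_gen (a * x)
| idealMr a x : ideal_gen x -> ideal_gen (x * a).

Definition ideal_pred : {pred T} := fun x => `[< ideal_gen x >].

Lemma idealP x : reflect (ideal_gen x) (x \in ideal_pred).
Proof. exact: asboolP. Qed.

Fact ideal_zmod_closed : zmod_closed ideal_pred.
Proof.
split=> [|x y /idealP hx /idealP hy]; apply/idealP; first exact: ideal0.
by apply: idealD => //; rewrite -mulN1r; apply: idealMl.
Qed.
HB.instance Definition _ :=
  GRing.isZmodClosed.Build T ideal_pred ideal_zmod_closed.

Definition qalg_car := Quotient.quot ideal_pred.
HB.instance Definition _ := ZmodQuotient.on qalg_car.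

Lemma qalg_ind (P : qalg_car -> Prop) :
  (forall x : T, P (\pi_qalg_car x)) -> forall v, P v.
Proof. by move=> h v; rewrite -[v]reprK. Qed.

Lemma qalg_eq (x y : T) : ideal_gen (x - y) -> \pi_qalg_car x = \pi_qalg_car y.
Proof. by move/idealP; rewrite Quotient.idealrBE => /eqP. Qed.

Lemma qalg_repr (x : T) : ideal_gen (repr (\pi_qalg_car x) - x).
Proof. by apply/idealP; rewrite Quotient.idealrBE reprK. Qed.

Lemma qalg_piD (x y : T) : \pi_qalg_car (x + y) = \pi_qalg_car x + \pi_qalg_car y.
Proof. exact: (Quotient.pi_add ideal_pred). Qed.

Lemma qalg_pi0 : \pi_qalg_car (0 : T) = 0.
Proof. by apply: (addrI (\pi_qalg_car (0 : T))); rewrite -qalg_piD !addr0. Qed.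

Definition qalg_mul (x y : qalg_car) : qalg_car := \pi_qalg_car (repr x * repr y).

Lemma qalg_mul_pi (x y : T) :
  qalg_mul (\pi_qalg_car x) (\pi_qalg_car y) = \pi_qalg_car (x * y).
Proof.
apply: qalg_eq; set x' := repr _; set y' := repr _.
have -> : x' * y' - x * y = (x' - x) * y' + x * (y' - y).
  by rewrite mulrBl mulrBr addrA subrK.
by apply: idealD; [apply: idealMr|apply: idealMl]; apply: qalg_repr.
Qed.

Fact qalg_mulA : associative qalg_mul.
Proof.
by elim/qalg_ind=> x; elim/qalg_ind=> y; elim/qalg_ind=> z; rewrite !qalg_mul_pi mulrA.
Qed.
Fact qalg_mul1r : left_id (\pi_qalg_car (1 : T)) qalg_mul.
Proof. by elim/qalg_ind=> x; rewrite qalg_mul_pi mul1r. Qed.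
Fact qalg_mulr1 : right_id (\pi_qalg_car (1 : T)) qalg_mul.
Proof. by elim/qalg_ind=> x; rewrite qalg_mul_pi mulr1. Qed.
Fact qalg_mulDl : left_distributive qalg_mul +%R.
Proof.
elim/qalg_ind=> x; elim/qalg_ind=> y; elim/qalg_ind=> z.
by rewrite -qalg_piD !qalg_mul_pi mulrDl qalg_piD.
Qed.
Fact qalg_mulDr : right_distributive qalg_mul +%R.
Proof.
elim/qalg_ind=> x; elim/qalg_ind=> y; elim/qalg_ind=> z.
by rewrite -qalg_piD !qalg_mul_pi mulrDr qalg_piD.
Qed.
HB.instance Definition _ := GRing.Zmodule_isPzRing.Build qalg_car
  qalg_mulA qalg_mul1r qalg_mulr1 qalg_mulDl qalg_mulDr.

Definition qalg_scal (c : K) : qalg_car := \pi_qalg_car (ga_scal T c).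

Fact qalg_scal_zmod : zmod_morphism qalg_scal.
Proof.
move=> c d; rewrite /qalg_scal; apply: (addIr (\pi_qalg_car (ga_scal T d))).
by rewrite subrK -qalg_piD rmorphB subrK.
Qed.
Fact qalg_scal_monoid : monoid_morphism qalg_scal.
Proof.
split; first by rewrite /qalg_scal rmorph1.
by move=> c d; rewrite /qalg_scal rmorphM -qalg_mul_pi.
Qed.
HB.instance Definition _ :=
  GRing.isZmodMorphism.Build K qalg_car qalg_scal qalg_scal_zmod.
HB.instance Definition _ :=
  GRing.isMonoidMorphism.Build K qalg_car qalg_scal qalg_scal_monoid.

Fact qalg_scalC c a : qalg_scal c * a = a * qalg_scal c.
Proof.
elim/qalg_ind: a => a.
rewrite [LHS](qalg_mul_pi (ga_scal T c) a) [RHS](qalg_mul_pi a (ga_scal T c)).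
by rewrite ga_scalC.
Qed.

Hypothesis rel_homog : forall x, rel x -> exists d, homogeneous (ga_gr T) d x.

Lemma ga_pr_mull d i (a x : T) : homogeneous (ga_gr T) i a ->
  pr (ga_gr T) d (a * x) = a * pr (ga_gr T) (d - i) x.
Proof.
move=> ha; have [s [us xE]] := pr_sum (ga_gr T) x.
rewrite {1}xE mulr_sumr pr_bigsum {2}xE pr_bigsum mulr_sumr.
apply: eq_bigr => j _; rewrite pr_pr.
rewrite (pr_homog d (ga_mul_homog ha (homog_pr _ j x))) addrC -subr_eq.
by case: eqP; rewrite ?mulr0.
Qed.

Lemma ga_pr_mulr d i (a x : T) : homogeneous (ga_gr T) i a ->
  pr (ga_gr T) d (x * a) = pr (ga_gr T) (d - i) x * a.
Proof.
move=> ha; have [s [us xE]] := pr_sum (ga_gr T) x.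
rewrite {1}xE mulr_suml pr_bigsum {2}xE pr_bigsum mulr_suml.
apply: eq_bigr => j _; rewrite pr_pr.
rewrite (pr_homog d (ga_mul_homog (homog_pr _ j x) ha)) -subr_eq.
by case: eqP; rewrite ?mul0r.
Qed.

Lemma ideal_pr d x : ideal_gen x -> ideal_gen (pr (ga_gr T) d x).
Proof.
move=> hx; elim: hx d => {x} [x rx d||x y _ hx _ hy d|a x _ hx d|a x _ hx d].
- have [e he] := rel_homog rx; rewrite (pr_homog d he).
  by case: eqP => _; [apply: ideal_rel|apply: ideal0].
- by move=> d; rewrite pr0; apply: ideal0.
- by rewrite prD; apply: idealD.
- have [s [_ ->]] := pr_sum (ga_gr T) a; rewrite mulr_suml pr_bigsum.
  elim/big_ind: _ => [||i _]; [exact: ideal0|exact: idealD|].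
  by rewrite (ga_pr_mull d x (homog_pr _ i a)); apply: idealMl.
- have [s [_ ->]] := pr_sum (ga_gr T) a; rewrite mulr_sumr pr_bigsum.
  elim/big_ind: _ => [||i _]; [exact: ideal0|exact: idealD|].
  by rewrite (ga_pr_mulr d x (homog_pr _ i a)); apply: idealMr.
Qed.

Definition qalg_pr d (x : qalg_car) : qalg_car := \pi_qalg_car (pr (ga_gr T) d (repr x)).

Lemma qalg_pr_pi d (x : T) : qalg_pr d (\pi_qalg_car x) = \pi_qalg_car (pr (ga_gr T) d x).
Proof.
apply: qalg_eq; rewrite -(prN (ga_gr T)) -prD.
by apply: ideal_pr; apply: qalg_repr.
Qed.

Fact qalg_prD d x y : qalg_pr d (x + y) = qalg_pr d x + qalg_pr d y.
Proof.
elim/qalg_ind: x => x; elim/qalg_ind: y => y.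
by rewrite -qalg_piD !qalg_pr_pi prD qalg_piD.
Qed.
Fact qalg_pr_pr d e x :
  qalg_pr d (qalg_pr e x) = if d == e then qalg_pr e x else 0.
Proof.
elim/qalg_ind: x => x; rewrite !qalg_pr_pi pr_pr; case: eqP => // _.
exact: qalg_pi0.
Qed.
Fact qalg_pr_sum x : exists s : seq int, uniq s /\ x = \sum_(d <- s) qalg_pr d x.
Proof.
elim/qalg_ind: x => x; have [s [us xE]] := pr_sum (ga_gr T) x.
exists s; split=> //; rewrite {1}xE (big_morph (\pi_qalg_car) qalg_piD qalg_pi0).
by apply: eq_bigr => d _; rewrite qalg_pr_pi.
Qed.
Definition qalg_gr : grading qalg_car := Grading qalg_prD qalg_pr_pr qalg_pr_sum.

Lemma qalg_homog d (x : T) :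
  homogeneous (ga_gr T) d x -> homogeneous qalg_gr d (\pi_qalg_car x).
Proof. by move=> h; rewrite /homogeneous /= qalg_pr_pi h. Qed.

Fact qalg_mul_homog i j (a b : qalg_car) : homogeneous qalg_gr i a ->
  homogeneous qalg_gr j b -> homogeneous qalg_gr (i + j) (a * b).
Proof.
elim/qalg_ind: a => a; elim/qalg_ind: b => b ha hb.
rewrite -ha -hb [pr qalg_gr i _]qalg_pr_pi [pr qalg_gr j _]qalg_pr_pi.
have -> (x y : T) : \pi_qalg_car x * \pi_qalg_car y = \pi_qalg_car (x * y).
  exact: qalg_mul_pi.
by apply: qalg_homog; apply: ga_mul_homog; apply: homog_pr.
Qed.

Definition qalg : galg K := @GAlg K qalg_car qalg_scal qalg_scalC qalg_gr
  (fun c => qalg_homog (ga_scal_homog T c)) qalg_mul_homog.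

Definition qproj (x : T) : qalg := \pi_qalg_car x.

Section Descend.
Variable chi : {rmorphism T -> K}.
Hypothesis chi_rel : forall x, rel x -> chi x = 0.

Lemma chi_ideal x : ideal_gen x -> chi x = 0.
Proof.
elim=> {x} [x|||a x _ hx|a x _ hx]; first exact: chi_rel.
- exact: rmorph0.
- by move=> x y _ hx _ hy; rewrite rmorphD hx hy addr0.
- by rewrite rmorphM hx mulr0.
- by rewrite rmorphM hx mul0r.
Qed.

Definition qchi of (forall x, rel x -> chi x = 0) :=
  fun x : qalg => chi (repr (x : qalg_car)).

Lemma qchi_pi (x : T) : qchi chi_rel (qproj x) = chi x.
Proof.
by apply/eqP; rewrite -subr_eq0 -rmorphB; apply/eqP/chi_ideal/qalg_repr.
Qed.

Fact qchi_zmod : zmod_morphism (qchi chi_rel).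
Proof.
elim/qalg_ind=> x; elim/qalg_ind=> y.
have -> : \pi_qalg_car x - \pi_qalg_car y = \pi_qalg_car (x - y).
  by apply: (addIr (\pi_qalg_car y)); rewrite subrK -qalg_piD subrK.
by rewrite !qchi_pi rmorphB.
Qed.
Fact qchi_monoid : monoid_morphism (qchi chi_rel).
Proof.
split; first by rewrite -[LHS]/(qchi chi_rel (qproj 1)) qchi_pi rmorph1.
elim/qalg_ind=> x; elim/qalg_ind=> y.
by rewrite [X in qchi _ X](qalg_mul_pi x y) !qchi_pi rmorphM.
Qed.
HB.instance Definition _ :=
  GRing.isZmodMorphism.Build qalg K (qchi chi_rel) qchi_zmod.
HB.instance Definition _ :=
  GRing.isMonoidMorphism.Build qalg K (qchi chi_rel) qchi_monoid.

Lemma qchi_scal : (forall c, chi (ga_scal T c) = c) ->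
  forall c, qchi chi_rel (ga_scal qalg c) = c.
Proof. by move=> h c; rewrite qchi_pi. Qed.

Lemma qchi_homog :
  (forall d a, homogeneous (ga_gr T) d a -> d != 0 -> chi a = 0) ->
  forall d a, homogeneous (ga_gr qalg) d a -> d != 0 -> qchi chi_rel a = 0.
Proof.
move=> h d; elim/qalg_ind=> a; rewrite /homogeneous /= => <- d0.
by rewrite qalg_pr_pi qchi_pi (h d) //; apply: homog_pr.
Qed.

End Descend.

End QuotientAlgebra.

Lemma malgUZ (K : fieldType) (T : choiceType) (c : K) (x : T) :
  monalg.mkmalgU x c = c *: monalg.mkmalgU x 1 :> {malg K[T]}.
Proof.
by apply/malgP => y; rewrite monalg.mcoeffZ !monalg.mcoeffU mulrnAr mulr1.
Qed.

Section BilinearExtension.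
Variables (K : fieldType) (V : lmodType K) (I : eqType) (b : I -> V).
Hypothesis ind : forall P : V -> Prop, P 0 ->
  (forall c f g, P f -> P g -> P (c *: f + g)) -> (forall x, P (b x)) ->
  forall f, P f.
Variable m : V -> V -> V.
Hypothesis mPl : forall h c f g, m (c *: f + g) h = c *: m f h + m g h.
Hypothesis mPr : forall h c f g, m h (c *: f + g) = c *: m h f + m h g.

Lemma bilin0l h : m 0 h = 0.
Proof. by apply: (addrI (m 0 h)); rewrite -{1}[m 0 h]scale1r -mPl scale1r !addr0. Qed.
Lemma bilin0r h : m h 0 = 0.
Proof. by apply: (addrI (m h 0)); rewrite -{1}[m h 0]scale1r -mPr scale1r !addr0. Qed.

Lemma bilinDl : left_distributive m +%R.
Proof. by move=> f g h; rewrite -[f]scale1r mPl !scale1r. Qed.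
Lemma bilinDr : right_distributive m +%R.
Proof. by move=> h f g; rewrite -[f]scale1r mPr !scale1r. Qed.

Lemma bilinZl c f h : m (c *: f) h = c *: m f h.
Proof. by rewrite -[c *: f]addr0 mPl bilin0l addr0. Qed.
Lemma bilinZr c f h : m h (c *: f) = c *: m h f.
Proof. by rewrite -[c *: f]addr0 mPr bilin0r addr0. Qed.

Lemma bilin_assoc :
  (forall x y z, m (b x) (m (b y) (b z)) = m (m (b x) (b y)) (b z)) ->
  associative m.
Proof.
move=> A f g h.
elim/ind: f => [|c f1 f2 h1 h2|x]; first by rewrite !bilin0l.
  by rewrite !mPl h1 h2.
elim/ind: g => [|c g1 g2 h1 h2|y]; first by rewrite !(bilin0l, bilin0r).
  by rewrite !(mPl, mPr) h1 h2.
elim/ind: h => [|c g1 g2 h1 h2|z]; first by rewrite !bilin0r.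
  by rewrite !mPr h1 h2.
exact: A.
Qed.

Variable o : I -> I -> option I.
Hypothesis mU : forall x y, m (b x) (b y) = if o x y is Some z then b z else 0.

Lemma bilin_associative :
  (forall x y z, obind (o x) (o y z) = obind (o^~ z) (o x y)) -> associative m.
Proof.
move=> oA; apply: bilin_assoc => x y z; rewrite !mU; have := oA x y z.
case: (o x y) (o y z) => [u|] [v|] /= E.
- by rewrite !mU E.
- by rewrite mU -E bilin0r.
- by rewrite mU E bilin0l.
- by rewrite bilin0r bilin0l.
Qed.

Variables (J : finType) (e : J -> I) (s t : I -> J).
Hypothesis oel : forall a x, o (e a) x = if a == s x then Some x else None.
Hypothesis oer : forall a x, o x (e a) = if a == t x then Some x else None.

Lemma bilin_left_id : left_id (\sum_a b (e a)) m.
Proof.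
move=> f; elim/ind: f => [|c f1 f2 h1 h2|x]; first by rewrite bilin0r.
  by rewrite mPr h1 h2.
rewrite (big_morph (m^~ (b x)) (fun f g => bilinDl f g _) (bilin0l _)).
rewrite (bigD1 (s x)) //= mU oel eqxx big1 ?addr0 // => a /negPf na.
by rewrite mU oel na.
Qed.

Lemma bilin_right_id : right_id (\sum_a b (e a)) m.
Proof.
move=> f; elim/ind: f => [|c f1 f2 h1 h2|x]; first by rewrite bilin0l.
  by rewrite mPl h1 h2.
rewrite (big_morph (m (b x)) (bilinDr _) (bilin0r _)).
rewrite (bigD1 (t x)) //= mU oer eqxx big1 ?addr0 // => a /negPf na.
by rewrite mU oer na.
Qed.

Variables (p : int -> V -> V) (deg : I -> nat).
Hypothesis pP : forall d c f g, p d (c *: f + g) = c *: p d f + p d g.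
Hypothesis pU : forall d x, p d (b x) = if (deg x)%:Z == d then b x else 0.
Hypothesis odeg : forall x y z, o x y = Some z -> deg z = (deg x + deg y)%N.

Lemma bilin_pr0 d : p d 0 = 0.
Proof. by apply: (addrI (p d 0)); rewrite -{1}[p d 0]scale1r -pP scale1r !addr0. Qed.

Lemma bilin_prD d f g : p d (f + g) = p d f + p d g.
Proof. by have := pP d 1 f g; rewrite !scale1r. Qed.

Lemma bilin_pr_pr d e0 f : p d (p e0 f) = if d == e0 then p e0 f else 0.
Proof.
elim/ind: f => [|c f g hf hg|x].
- by rewrite !bilin_pr0; case: ifP.
- by rewrite !pP hf hg; case: ifP => // _; rewrite scaler0 addr0.
- rewrite pU; case: eqP => [<-|_]; last by rewrite bilin_pr0; case: ifP.
  by rewrite pU eq_sym.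
Qed.

Lemma bilin_pr_sum f : exists r : seq int, uniq r /\ f = \sum_(d <- r) p d f.
Proof.
suff [N h] : exists N, forall M, (N <= M)%N ->
    f = \sum_(d <- [seq i%:Z | i <- iota 0 M]) p d f.
  exists [seq i%:Z | i <- iota 0 N]; split; last exact: h.
  by rewrite map_inj_uniq ?iota_uniq // => i j [].
elim/ind: f => [|c f g [N1 h1] [N2 h2]|x].
- by exists 0 => M _; rewrite big1 // => d _; exact: bilin_pr0.
- exists (maxn N1 N2) => M; rewrite geq_max => /andP[/h1 e1 /h2 e2].
  rewrite {1}e1 {1}e2 scaler_sumr -big_split /=.
  by apply: eq_bigr => d _; rewrite pP.
- exists (deg x).+1 => M hM; rewrite big_map (bigD1_seq (deg x)) ?iota_uniq //=.
    rewrite pU eqxx big1 ?addr0 // => i ni.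
    by rewrite pU eqz_nat eq_sym (negPf ni).
  by rewrite mem_iota.
Qed.

Lemma bilin_homog i j f g : p (i + j) (m (p i f) (p j g)) = m (p i f) (p j g).
Proof.
elim/ind: f => [|c f1 f2 h1 h2|x].
- by rewrite bilin_pr0 bilin0l bilin_pr0.
- by rewrite pP mPl pP h1 h2.
rewrite pU; case: eqP => [<-|_]; last by rewrite bilin0l bilin_pr0.
elim/ind: g => [|c g1 g2 h1 h2|y].
- by rewrite bilin_pr0 bilin0r bilin_pr0.
- by rewrite pP mPr pP h1 h2.
rewrite pU; case: eqP => [<-|_]; last by rewrite bilin0r bilin_pr0.
rewrite mU; case E: (o x y) => [z|]; last exact: bilin_pr0.
by rewrite pU (odeg E) PoszD eqxx.
Qed.

Lemma bilin_unit_homog c : (forall a, deg (e a) = 0) ->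
  p 0 (c *: \sum_a b (e a)) = c *: \sum_a b (e a).
Proof.
move=> d0; rewrite -[c *: _ in LHS]addr0 pP bilin_pr0 addr0; congr (_ *: _).
rewrite (big_morph (p 0) (bilin_prD 0) (bilin_pr0 0)); apply: eq_bigr => a _.
by rewrite pU d0 eqxx.
Qed.

Variables (ch : V -> K) (x0 : I).
Hypothesis chP : forall c f g, ch (c *: f + g) = c * ch f + ch g.
Hypothesis chU : forall x, ch (b x) = (x == x0)%:R.
Hypothesis ox0 : o x0 x0 = Some x0.
Hypothesis ox : forall x y, o x y = Some x0 -> x = x0 /\ y = x0.

Lemma bilin_ch0 : ch 0 = 0.
Proof. by apply: (addrI (ch 0)); rewrite -{1}[ch 0]mul1r -chP scale1r !addr0. Qed.

Lemma bilin_chM f g : ch (m f g) = ch f * ch g.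
Proof.
elim/ind: f => [|c f1 f2 h1 h2|x]; first by rewrite bilin0l bilin_ch0 mul0r.
  by rewrite mPl !chP h1 h2 mulrDl mulrA.
elim/ind: g => [|c g1 g2 h1 h2|y]; first by rewrite bilin0r bilin_ch0 mulr0.
  by rewrite mPr !chP h1 h2 mulrDr mulrCA.
rewrite mU !chU -natrM mulnb; case: andP => [[/eqP -> /eqP ->]|h].
  by rewrite ox0 chU eqxx.
case E: (o x y) => [z|]; last exact: bilin_ch0.
rewrite chU; case: eqP => // zE; case: h; rewrite zE in E.
by have [-> ->] := ox E.
Qed.

Lemma bilin_ch_pr d f : deg x0 = 0 -> d != 0 -> ch (p d f) = 0.
Proof.
move=> dx0 d0; elim/ind: f => [|c f1 f2 h1 h2|x].
- by rewrite bilin_pr0 bilin_ch0.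
- by rewrite pP chP h1 h2 mulr0 addr0.
rewrite pU; case: eqP => [E|_]; last exact: bilin_ch0.
rewrite chU; case: eqP => // xE; move: d0.
by rewrite -E xE dx0 eqxx.
Qed.

Lemma bilin_ch1 a0 : injective e -> e a0 = x0 -> ch (\sum_a b (e a)) = 1.
Proof.
move=> einj ea; have chD f g : ch (f + g) = ch f + ch g.
  by have := chP 1 f g; rewrite scale1r mul1r.
rewrite (big_morph ch chD bilin_ch0) (bigD1 a0) //= chU ea eqxx big1 ?addr0 // => a na.
by rewrite chU -ea (inj_eq einj) (negPf na).
Qed.

End BilinearExtension.

(* [kQ (x) K[t_1, ..., t_n]] for the quiver with vertex set [Q0] and exactly one
   arrow from [a] to [b] whenever [adj a b]. *)
Section PathAlgebra.
Variables (K : fieldType) (Q0 : finType) (adj : rel Q0) (n : nat).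

(* The path [w.1 -> w.2_0 -> w.2_1 -> ...]. *)
Definition qpath := {w : Q0 * seq Q0 | path adj w.1 w.2}.
HB.instance Definition _ := SubChoice.on qpath.

Definition qsource (w : qpath) : Q0 := (val w).1.
Definition qtarget (w : qpath) : Q0 := last (val w).1 (val w).2.
Definition qlength (w : qpath) : nat := size (val w).2.

Definition qtriv (a : Q0) : qpath := Sub (a, [::]) isT.

Definition qcat (u v : qpath) : option qpath :=
  if qtarget u == qsource v then insub ((val u).1, (val u).2 ++ (val v).2)
  else None.

Definition pbasis := (qpath * 'X_{1..n})%type.

(* [None] stands for the zero product of non-composable paths; as in [qcat],
   products of paths are read from left to right. *)
Definition bmul (x y : pbasis) : option pbasis :=
  omap (fun w => (w, (x.2 + y.2)%MM)) (qcat x.1 y.1).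

Definition bdeg (x : pbasis) : nat := (qlength x.1 + 2 * mdeg x.2)%N.

Variant qcat_spec (u v : qpath) : option qpath -> Type :=
| QcatNone of qtarget u != qsource v : qcat_spec u v None
| QcatSome w of qtarget u = qsource v & qsource w = qsource u
    & qtarget w = qtarget v & (val w).2 = (val u).2 ++ (val v).2 :
    qcat_spec u v (Some w).

Lemma qcatP u v : qcat_spec u v (qcat u v).
Proof.
rewrite /qcat; case: eqP => [E|/eqP]; last exact: QcatNone.
case: insubP => [w _ wE|/negP[]].
  apply: QcatSome => //; rewrite ?/qsource ?/qtarget ?wE //= last_cat.
  by rewrite -/(qtarget u) E.
by rewrite /= cat_path (valP u) /= -/(qtarget u) E (valP v).
Qed.

Lemma qpath_eq (u v : qpath) : qsource u = qsource v -> (val u).2 = (val v).2 -> u = v.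
Proof.
move=> h1 h2; apply: val_inj; move: h1 h2; rewrite /qsource.
by case: (val u) (val v) => [a s] [b t] /= -> ->.
Qed.

Lemma bmulA x y z : obind (bmul x) (bmul y z) = obind (bmul^~ z) (bmul x y).
Proof.
case: x y z => [u l] [v m] [w p]; rewrite /bmul /=.
case: (qcatP v w) => [vw|vw' E1 s1 t1 l1]; case: (qcatP u v) => [uv|uv' E2 s2 t2 l2] //=.
- case: (qcatP uv' w) => [//|x E _ _ _].
  by case/eqP: vw; rewrite -E t2.
- case: (qcatP u vw') => [//|x E _ _ _].
  by case/eqP: uv; rewrite E s1.
- case: (qcatP u vw') => [|x E3 s3 t3 l3]; first by rewrite s1 E2 eqxx.
  case: (qcatP uv' w) => [|y E4 s4 t4 l4]; first by rewrite t2 E1 eqxx.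
  congr Some; congr (_, _); last by rewrite addmA.
  apply: qpath_eq; first by rewrite s3 s4 s2.
  by rewrite l3 l4 l1 l2 catA.
Qed.

Definition palg_car := {malg K[pbasis]}.
HB.instance Definition _ := GRing.Lmodule.on palg_car.

Definition bvec (x : pbasis) : palg_car := monalg.mkmalgU x 1.

Definition lext (V : lmodType K) (h : pbasis -> V) (f : palg_car) : V :=
  \sum_(x <- monalg.msupp f) monalg.mcoeff x f *: h x.

Lemma lextEw (V : lmodType K) (h : pbasis -> V) (f : palg_car) (d : {fset pbasis}) :
  (monalg.msupp f `<=` d)%fset ->
  lext h f = \sum_(x <- d) monalg.mcoeff x f *: h x.
Proof.
move=> le; rewrite [LHS](big_fset_incl _ le) => //= x xd /monalg.mcoeff_outdom ->.
by rewrite scale0r.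
Qed.

Lemma lextP (V : lmodType K) (h : pbasis -> V) c f g :
  lext h (c *: f + g) = c *: lext h f + lext h g.
Proof.
pose d := (monalg.msupp (c *: f + g) `|` (monalg.msupp f `|` monalg.msupp g))%fset.
have s1 : (monalg.msupp (c *: f + g) `<=` d)%fset by exact: fsubsetUl.
have s2 : (monalg.msupp f `<=` d)%fset.
  by apply: fsubset_trans (fsubsetUr _ _); apply: fsubsetUl.
have s3 : (monalg.msupp g `<=` d)%fset.
  by apply: fsubset_trans (fsubsetUr _ _); apply: fsubsetUr.
rewrite (lextEw _ s1) (lextEw _ s2) (lextEw _ s3) scaler_sumr -big_split /=.
apply: eq_bigr => x _.
by rewrite monalg.mcoeffD monalg.mcoeffZ scalerDl scalerA.
Qed.

HB.instance Definition _ (V : lmodType K) (h : pbasis -> V) :=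
  GRing.isLinear.Build K palg_car V *:%R (lext h) (@lextP V h).

Lemma lextU (V : lmodType K) (h : pbasis -> V) x : lext h (bvec x) = h x.
Proof.
rewrite /lext (_ : monalg.msupp (bvec x) = [fset x]%fset).
  by rewrite big_seq_fset1 monalg.mcoeffUU scale1r.
by rewrite /bvec monalg.msuppU oner_eq0.
Qed.

Lemma palg_ind (P : palg_car -> Prop) : P 0 ->
  (forall c f g, P f -> P g -> P (c *: f + g)) -> (forall x, P (bvec x)) ->
  forall f, P f.
Proof.
move=> P0 PD PU f; rewrite [f]monalgE; elim/big_ind: _ => // [g h Pg Ph|x _].
  by rewrite -[g]scale1r; apply: PD.
have := PD (monalg.mcoeff x f) (bvec x) 0 (PU x) P0.
by rewrite addr0 malgUZ.
Qed.

Lemma lext_eq (V : lmodType K) (F G : {linear palg_car -> V}) :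
  (forall x, F (bvec x) = G (bvec x)) -> F =1 G.
Proof.
move=> h f; elim/palg_ind: f => [|c f g Ff Fg|//]; first by rewrite !linear0.
by rewrite !linearP Ff Fg.
Qed.

Definition ovec (o : option pbasis) : palg_car := if o is Some x then bvec x else 0.

Definition pmul (f g : palg_car) : palg_car :=
  lext (fun x => lext (fun y => ovec (bmul x y)) g) f.

Lemma pmulPl h c f g : pmul (c *: f + g) h = c *: pmul f h + pmul g h.
Proof. exact: linearP. Qed.
Lemma pmulPr h c f g : pmul h (c *: f + g) = c *: pmul h f + pmul h g.
Proof.
rewrite /pmul /lext scaler_sumr -big_split /=; apply: eq_bigr => x _.
by rewrite -!/(lext _ _) linearP scalerDr !scalerA mulrC.
Qed.
Lemma pmulUU x y : pmul (bvec x) (bvec y) = ovec (bmul x y).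
Proof. by rewrite /pmul !lextU. Qed.

Fact pmulA : associative pmul.
Proof. exact: (bilin_associative palg_ind pmulPl pmulPr pmulUU bmulA). Qed.

Definition pvert (a : Q0) : palg_car := bvec (qtriv a, 0%MM).

Definition pone : palg_car := \sum_a pvert a.

Lemma bmul_vertl a (x : pbasis) :
  bmul (qtriv a, 0%MM) x = if a == qsource x.1 then Some x else None.
Proof.
rewrite /bmul /=; case: qcatP => [/negPf|w E s1 t1 l1]; first by move=> ->.
rewrite [a == _](_ : _ = true) /=; last exact/eqP.
rewrite add0m [w](_ : _ = x.1); first by case: x {E s1 t1 l1}.
by apply: qpath_eq; rewrite ?s1.
Qed.

Lemma bmul_vertr a (x : pbasis) :
  bmul x (qtriv a, 0%MM) = if a == qtarget x.1 then Some x else None.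
Proof.
rewrite /bmul /=; case: qcatP => [/negPf|w E s1 t1 l1].
  by rewrite eq_sym => ->.
rewrite [a == _](_ : _ = true) /=; last exact/eqP/esym.
rewrite addm0 [w](_ : _ = x.1); first by case: x {E s1 t1 l1}.
by apply: qpath_eq; rewrite ?s1 // l1 cats0.
Qed.

Fact pmul1 : left_id pone pmul.
Proof. exact: (bilin_left_id palg_ind pmulPl pmulPr pmulUU bmul_vertl). Qed.
Fact pmulr1 : right_id pone pmul.
Proof. exact: (bilin_right_id palg_ind pmulPl pmulPr pmulUU bmul_vertr). Qed.

HB.instance Definition _ := GRing.Zmodule_isPzRing.Build palg_car
  pmulA pmul1 pmulr1 (bilinDl pmulPl) (bilinDr pmulPr).

Lemma palg_mulE (f g : palg_car) : f * g = pmul f g. Proof. by []. Qed.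

Definition pscal (c : K) : palg_car := c *: pone.

Lemma pscalMl c f : pscal c * f = c *: f.
Proof. 
by rewrite palg_mulE /pscal (bilinZl pmulPl) (pmul1 f). Qed.
Lemma pscalMr c f : f * pscal c = c *: f.
Proof. 
by rewrite palg_mulE /pscal (bilinZr pmulPr) (pmulr1 f). Qed.

Fact pscal_zmod : zmod_morphism pscal.
Proof. by move=> c d; exact: scalerBl. Qed.
Fact pscal_monoid : monoid_morphism pscal.
Proof.
split; first exact: scale1r.
by move=> c d; exact: etrans (esym (scalerA c d pone)) (esym (pscalMl c (pscal d))).
Qed.
HB.instance Definition _ := GRing.isZmodMorphism.Build K palg_car pscal pscal_zmod.
HB.instance Definition _ := GRing.isMonoidMorphism.Build K palg_car pscal pscal_monoid.

Fact pscalC c f : pscal c * f = f * pscal c.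
Proof. exact: etrans (pscalMl c f) (esym (pscalMr c f)). Qed.

(* The grading: arrows have degree one and the [t_i] degree two. *)
Definition ppr (d : int) : palg_car -> palg_car :=
  lext (fun x => if (bdeg x)%:Z == d then bvec x else 0).

Lemma pprU d x : ppr d (bvec x) = if (bdeg x)%:Z == d then bvec x else 0.
Proof. exact: lextU. Qed.

Lemma pprP d c f g : ppr d (c *: f + g) = c *: ppr d f + ppr d g.
Proof. exact: lextP. Qed.

Definition pgr : grading palg_car :=
  Grading (bilin_prD pprP) (bilin_pr_pr palg_ind pprP pprU)
    (bilin_pr_sum palg_ind pprP pprU).

Lemma bvec_homog x : homogeneous pgr (bdeg x)%:Z (bvec x).
Proof. by rewrite /homogeneous /= pprU eqxx. Qed.

Lemma bmul_deg x y z : bmul x y = Some z -> bdeg z = (bdeg x + bdeg y)%N.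
Proof.
case: x y => [u l] [v m]; rewrite /bmul /=; case: qcatP => //= w _ _ _ wE [<-].
by rewrite /bdeg /= /qlength wE size_cat mdegD mulnDr addnACA.
Qed.

Fact pmul_homog i j f g : homogeneous pgr i f -> homogeneous pgr j g ->
  homogeneous pgr (i + j) (f * g).
Proof.
move=> <- <-.
exact: (bilin_homog palg_ind pmulPl pmulPr pmulUU pprP pprU bmul_deg).
Qed.

Fact pscal_homog c : homogeneous pgr 0 (pscal c).
Proof.
apply: (bilin_unit_homog pprP pprU) => a.
by rewrite /bdeg /qlength /= mdeg0.
Qed.

Definition palg : galg K := @GAlg K palg_car pscal pscalC pgr pscal_homog pmul_homog.

(* The character picking the coefficient of the trivial path at [a]. *)
Section VertexCharacter.
Variable a : Q0.

Definition pchar (f : palg) : K := monalg.mcoeff (qtriv a, 0%MM) (f : palg_car).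

Lemma pcharP c (f g : palg_car) : pchar (c *: f + g) = c * pchar f + pchar g.
Proof. by rewrite /pchar monalg.mcoeffD monalg.mcoeffZ. Qed.

Lemma pcharU x : pchar (bvec x) = (x == (qtriv a, 0%MM))%:R.
Proof. by rewrite /pchar monalg.mcoeffU. Qed.

Lemma bmul_triv : bmul (qtriv a, 0%MM) (qtriv a, 0%MM) = Some (qtriv a, 0%MM).
Proof. by rewrite bmul_vertl eqxx. Qed.

Lemma bmul_eq_triv x y : bmul x y = Some (qtriv a, 0%MM) ->
  x = (qtriv a, 0%MM) /\ y = (qtriv a, 0%MM).
Proof.
case: x y => [u l] [v m]; rewrite /bmul /=; case: qcatP => //= w E s1 t1 wE h.
have {}h := congr1 (odflt (qtriv a, 0%MM)) h; rewrite /= in h.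
have wt : w = qtriv a := congr1 fst h.
have lm : (l + m)%MM = 0%MM := congr1 snd h.
have [l0 m0] : l = 0%MM /\ m = 0%MM.
  split; apply/mnmP => i; have /= := congr1 (fun k : 'X_{1..n} => k i) lm; rewrite mnmDE !mnm0E;
    by move/eqP; rewrite addn_eq0 => /andP[/eqP ? /eqP ?].
rewrite wt in s1 t1 wE; move: wE; rewrite /= => /esym/eqP.
rewrite -size_eq0 size_cat addn_eq0 !size_eq0 => /andP[/eqP u0 /eqP v0].
rewrite l0 m0; split; congr (_, _); apply: qpath_eq => //.
by rewrite -[RHS]/(qtarget (qtriv a)) t1 /qtarget v0.
Qed.

Fact pchar_zmod : zmod_morphism pchar.
Proof.
by move=> f g; rewrite /pchar monalg.mcoeffB.
Qed.
Fact pchar_monoid : monoid_morphism pchar.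
Proof.
split; last first.
  exact: (bilin_chM palg_ind pmulPl pmulPr pmulUU pcharP pcharU bmul_triv bmul_eq_triv).
by apply: (bilin_ch1 pcharP pcharU (a0 := a)) => // b c [].
Qed.
HB.instance Definition _ := GRing.isZmodMorphism.Build palg K pchar pchar_zmod.
HB.instance Definition _ := GRing.isMonoidMorphism.Build palg K pchar pchar_monoid.

Lemma pchar_scal c : pchar (ga_scal palg c) = c.
Proof.
have := pcharP c pone 0; rewrite addr0.
rewrite (bilin_ch0 pcharP) addr0 => h; rewrite -[RHS]mulr1.
by rewrite -[X in _ * X](pchar_monoid.1); exact: h.
Qed.

Lemma pchar_homog d (f : palg) : homogeneous (ga_gr palg) d f -> d != 0 -> pchar f = 0.
Proof.
move=> <- d0; apply: (bilin_ch_pr palg_ind pprP pprU pcharP pcharU) => //.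
by rewrite /bdeg /qlength /= mdeg0.
Qed.

End VertexCharacter.

(* The arrow from [a] to [b] (zero if there is none). *)
Definition parrow (a b : Q0) : palg :=
  if insub (a, [:: b]) is Some w then bvec (w, 0%MM) else 0.

Definition pvar (i : 'I_n) : palg := \sum_a bvec (qtriv a, U_(i)%MM).

Lemma pvert_homog a : homogeneous (ga_gr palg) 0 (pvert a).
Proof.
have := bvec_homog (qtriv a, 0%MM).
by rewrite /bdeg /qlength /= mdeg0.
Qed.

Lemma parrow_homog a b : homogeneous (ga_gr palg) 1 (parrow a b).
Proof.
rewrite /parrow; case: insubP => [w _ wE|_]; last exact: homog0.
have := bvec_homog (w, 0%MM).
by rewrite /bdeg /qlength /= wE mdeg0.
Qed.

Lemma pvar_homog i : homogeneous (ga_gr palg) 2 (pvar i).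
Proof.
rewrite /pvar; elim/big_ind: _ => [||a _]; [exact: homog0|exact: homogD|].
have := bvec_homog (qtriv a, U_(i)%MM).
by rewrite /bdeg /qlength /= mdeg1.
Qed.

Lemma pchar_vert a b : pchar a (pvert b) = (b == a)%:R.
Proof. by rewrite pcharU xpair_eqE eqxx andbT -val_eqE /= xpair_eqE andbT. Qed.

Lemma pchar_arrow a b c : pchar a (parrow b c) = 0.
Proof. exact: pchar_homog (parrow_homog b c) _. Qed.

Lemma pchar_var a i : pchar a (pvar i) = 0.
Proof. exact: pchar_homog (pvar_homog i) _. Qed.

End PathAlgebra.

(* The class [eta] lives in the quotient group [R^n / V]; [(R^n)^*] is
   identified with row vectors by means of the dual basis, and a lift of [xi] is
   an [y] such that [xi v = \sum_i y_i v_i] for all [v] in [V]. *)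
Record polarized (R : realType) (n k : nat) := Polarized {
  pa_V : {vspace 'rV[R]_n};
  pa_dim : \dim pa_V = k;
  pa_eta : Quotient.quot (pred_of_vspace pa_V);
  pa_xi : 'Hom(subvs_of pa_V, R^o);
  pa_eta_generic : forall y : 'rV[R]_n,
    \pi_(Quotient.quot (pred_of_vspace pa_V)) y = pa_eta ->
    (n - k <= #|[set i | y 0%R i != 0%R]|)%N;
  pa_xi_generic : forall y : 'rV[R]_n,
    (forall v : subvs_of pa_V, pa_xi v = \sum_i y 0 i * vsval v 0 i) ->
    (k <= #|[set i | y 0%R i != 0%R]|)%N
}.

(* Sign vectors; [true] stands for [+1] and [false] for [-1]. *)
Definition svec (n : nat) := {ffun 'I_n -> bool}.

Definition sgv (R : pzRingType) (b : bool) : R := if b then 1 else -1.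

Definition flip n (i : 'I_n) (a : svec n) : svec n :=
  [ffun j => if j == i then ~~ a j else a j].

Definition sadj n (a b : svec n) : bool := #|[set i | a i != b i]| == 1%N.

Section Arrangement.
Variables (R : realType) (n k : nat) (A : polarized R n k).
Local Notation V := (pa_V A).

Definition V_eta (x : 'rV[R]_n) : Prop :=
  \pi_(Quotient.quot (pred_of_vspace V)) x = pa_eta A.

(* [xi(x) - xi(y)] for two points [x], [y] of [V_eta]. *)
Definition xi_diff (x y : 'rV[R]_n) : R := pa_xi A (vsproj V (x - y)).

Definition H_ (S : {set 'I_n}) (x : 'rV[R]_n) : Prop :=
  V_eta x /\ forall i, i \in S -> x 0 i = 0.

Definition Delta_ (a : svec n) (x : 'rV[R]_n) : Prop :=
  V_eta x /\ forall i, 0 <= sgv R (a i) * x 0 i.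

Definition Sigma_ (a : svec n) (v : subvs_of V) : Prop :=
  forall i, 0 <= sgv R (a i) * vsval v 0 i.

Definition feasible (a : svec n) : Prop := exists x, Delta_ a x.

Definition bounded (a : svec n) : Prop :=
  exists M : R, forall v, Sigma_ a v -> pa_xi A v <= M.

Definition Fset : {set svec n} := [set a | `[< feasible a >]].
Definition Pset : {set svec n} := [set a in Fset | `[< bounded a >]].

Definition Bset : {set {set 'I_n}} :=
  [set x : {set 'I_n} | (#|x| == k) && `[< exists p, H_ x p >]].

Definition max_at (a : svec n) (p : 'rV[R]_n) : Prop :=
  Delta_ a p /\ forall y, Delta_ a y -> xi_diff y p <= 0.

(* The graph of the bijection [mu : B -> P]. *)
Definition mu_graph (x : {set 'I_n}) (a : svec n) : Prop :=
  [/\ x \in Bset, a \in Pset & exists p, H_ x p /\ max_at a p].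

(* The inverse of [mu]; the default value is never used for [a] in [Pset]. *)
Definition basis_of (a : svec n) : {set 'I_n} :=
  odflt finset.set0 [pick x | `[< mu_graph x a >]].

Definition Blt (x y : {set 'I_n}) : Prop :=
  [/\ x \in Bset, y \in Bset, (#|x :&: y|.+1 = k)%N
    & exists p q, [/\ H_ x p, H_ y q & 0 < xi_diff q p]].

Definition Ble : {set 'I_n} -> {set 'I_n} -> Prop :=
  clos_refl_trans {set 'I_n} Blt.

Definition Fvert := {a : svec n | a \in Fset}.
HB.instance Definition _ := Finite.on Fvert.

Definition Pvert := {a : svec n | a \in Pset}.
HB.instance Definition _ := Finite.on Pvert.

Definition Ple (a b : Pvert) : Prop := Ble (basis_of (val a)) (basis_of (val b)).

Lemma Pvert_feasible (a : Pvert) : val a \in Fset.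
Proof. by have := valP a; rewrite inE => /andP[]. Qed.

Lemma Pvert_bounded (a : Pvert) : bounded (val a).
Proof. by have := valP a; rewrite inE => /andP[_ /asboolP]. Qed.

Definition fvert (a : Pvert) : Fvert := Sub (val a) (Pvert_feasible a).

Definition fadj : rel Fvert := fun a b => sadj (val a) (val b).

Variable K : fieldType.
Local Notation T := (palg K fadj n).
Local Notation e a := (pvert K fadj n a : T).
Local Notation p a b := (parrow K fadj n a b : T).
Local Notation t i := (pvar K fadj i : T).

Variant Atilde_rel : T -> Prop :=
| relA1 a : ~ bounded (val a) -> Atilde_rel (e a)
| relA2 a b c d : uniq [:: a; b; c; d] ->
    fadj a b -> fadj b c -> fadj c d -> fadj d a ->
    Atilde_rel (p a b * p b c - p a d * p d c)
| relA3 a b (i : 'I_n) : fadj a b -> val a i != val b i ->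
    Atilde_rel (p a b * p b a - t i * e a).

Fact Atilde_rel_homog x : Atilde_rel x -> exists d, homogeneous (ga_gr T) d x.
Proof.
case=> [a _|a b c d _ _ _ _ _|a b i _ _].
- by exists 0; apply: pvert_homog.
- exists (1 + 1); apply: homogD; last apply: homogN;
    by apply: ga_mul_homog; apply: parrow_homog.
- exists (1 + 1); apply: homogD; last apply: homogN.
    by apply: ga_mul_homog; apply: parrow_homog.
  by apply: (ga_mul_homog (i := 2) (j := 0)); [apply: pvar_homog|apply: pvert_homog].
Qed.

Definition Atilde : galg K := qalg Atilde_rel_homog.

Definition Ae (a : Pvert) : Atilde := qproj Atilde_rel_homog (e (fvert a)).

(* The arrow from [b] to [a], for a sign vector [b] (zero if [b] is not
   feasible or not adjacent to [a]). *)
Definition Ap (b : svec n) (a : Pvert) : Atilde :=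
  if insub b is Some b' then qproj Atilde_rel_homog (p b' (fvert a)) else 0.

Fact Ae_homog a (_ : unit) : homogeneous (gm_gr (gregular Atilde)) 0 (Ae a).
Proof. exact: (qalg_homog Atilde_rel_homog (pvert_homog _ _ _ _)). Qed.

Fact Ap_homog a (i : 'I_n) :
  homogeneous (gm_gr (gregular Atilde)) 1 (Ap (flip i (val a)) a).
Proof.
rewrite /Ap; case: insubP => [b _ _|_]; last exact: homog0.
exact: (qalg_homog Atilde_rel_homog (parrow_homog _ _ _ _ _)).
Qed.

Definition Ptilde_sub (a : Pvert) : gsubmod (gregular Atilde) :=
  gspan predT (fun u : unit => Ae_homog a u).

(* The left ideal [\sum_(i in x_a) A p(a^i, a)], contained in [A e_a]. *)
Definition Vtilde_sub (a : Pvert) : gsubmod (gregular Atilde) :=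
  gspan (mem (basis_of (val a))) (Ap_homog a).

Definition Vtilde (a : Pvert) : fgmod Atilde :=
  FGMod (gquot_fg (grestrict (Ptilde_sub a) (Vtilde_sub a))
    (gsub_span_fg predT (fun u : unit => Ae_homog a u))).

Fact rmorph_prod_diff (B C : pzRingType) (chi : {rmorphism B -> C}) x y u v :
  chi x = 0 -> chi u = 0 -> chi (x * y - u * v) = 0.
Proof. by move=> hx hu; rewrite rmorphB !rmorphM hx hu !mul0r subrr. Qed.

Fact pchar_rel (a : Pvert) x : Atilde_rel x -> pchar (fvert a) x = 0.
Proof.
case=> [b nb|b c d f _ _ _ _ _|b c i _ _].
- rewrite pchar_vert; case: eqP => // ba; case: nb.
  by rewrite ba; exact: Pvert_bounded.
- exact: (@rmorph_prod_diff T K (pchar (fvert a)) _ _ _ _ (pchar_arrow _ _ _ _ _ _) (pchar_arrow _ _ _ _ _ _)).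
- exact: (@rmorph_prod_diff T K (pchar (fvert a)) _ _ _ _ (pchar_arrow _ _ _ _ _ _) (pchar_var _ _ _ _)).
Qed.

(* The one-dimensional module [L_a], in degree zero: [e_a] acts as the identity,
   the other [e_b], the arrows and the [t_i] act by zero. *)
Definition Lsimple (a : Pvert) : fgmod Atilde :=
  FGMod (gchar_fg (A := Atilde)
    (chi := qchi (rel_homog := Atilde_rel_homog) (@pchar_rel a))
    (qchi_scal Atilde_rel_homog (@pchar_rel a) (@pchar_scal K Fvert fadj n _))
    (qchi_homog (@pchar_rel a) (@pchar_homog K Fvert fadj n _))).

End Arrangement.

(* Main.v *)
Require Import Defs.
From mathcomp Require Import all_boot all_algebra.
From mathcomp Require Import reals.
From HB Require Import structures.
From mathcomp Require Import all_order finmap monalg mpoly boolp ssrcomplements.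
From mathcomp Require Import zify ring lra.
From Stdlib Require Import Relation_Operators.

Set Implicit Arguments.
Unset Strict Implicit.
Unset Printing Implicit Defensive.

Import Order.TTheory GRing.Theory Num.Theory.
Local Open Scope ring_scope.
Local Open Scope quotient_scope.

(** The algebra is the linearization of a category of walks.  A walk in the graph of
    feasible sign vectors has a source [g], a target [a] and an exponent [w] counting
    how often it crosses each hyperplane, where the variable [t_i] stands for two
    crossings of the [i]-th one; necessarily [w i] is odd exactly when [g] and [a] differ
    at [i].  The defining relations for squares and for steps forth and back say that a
    walk matters only through [(g, w, a)] ([pth_eqkey]): the walls of [g] separating it
    from [a] are connected through faces of codimension two ([walls_connected]), so any two
    shortest walks are related by squares, and a longer walk contains a step back, which
    turns into a variable.  As the idempotents of the unbounded chambers are killed, so are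
    the monomials [mon g a w] whose walks can be routed through an unbounded chamber; these
    are called dead.  The other monomials are linearly independent, because their
    coefficients vanish on the relations ([null_ideal]).  Thus the algebra has a basis that
    multiplies by adding exponents.  It is finite over the polynomial ring in the [t_i],
    hence Noetherian by Hilbert's basis theorem, nonnegatively graded with finite
    dimensional components, and spanned in degree zero by the idempotents [e_a]; for any
    such algebra the finitely generated graded modules form a Noetherian Laurentian
    category ([noetherian_laurentian_gmod]).

    The highest weight structure comes from linear programming.  Let [S] be the set of the
    [k] hyperplanes through the optimum of a bounded chamber [a].  Chambers with the signs
    of [a] on [S] lie in the cone at this optimum.  They are bounded, and the simplex method
    leads from their optima to that of [a] through pivots increasing [xi], so that they are
    below [a] ([agree_Pset]).  The chambers across a hyperplane of [S] are feasible by
    genericity of [eta], and either unbounded or with a higher optimum ([flip_feasible],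
    [flip_height]).  The ideal defining the standard module of [a] is therefore spanned by
    the monomials to [a] that cross a hyperplane of [S], while the monomials that cross none
    stay in the cone and are not dead ([alive]).  So the weight space of the standard module
    at a chamber is free of rank one over the polynomials in the [n - k] variables off [S]
    if the chamber lies in the cone, and zero otherwise ([V_weight], [V_inj]).  This gives
    the conditions on [End(V_a)] and [Hom(P_a, V_b)], and identifies the standard module with
    the largest quotient having factors below [a].

    For the standard filtration of [A e_a], list the bounded chambers by the height of their
    optima, and filter by the walks to [a] that visit a chamber of rank at least [r].  The
    layer of rank [r] is generated by the taut path from the chamber [b] of rank [r].  If [a]
    is outside the cone of [b], this path can be made to visit a higher chamber, and the layer
    vanishes; if [a] lies in the cone, the layer is the standard module of [b], because the
    monomials staying in the cone cannot be rewritten to pass through a higher chamber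
    ([Jlayer]). *)

(** * Morphisms of graded modules *)

Section GradedModules.
Variables (K : fieldType) (A : galg K).
Local Notation C := (gmodcat A).

Section Morphism.
Variables (M N : gmod A) (f : ghom M N).

Lemma ghomD x y : f (x + y) = f x + f y.
Proof. by rewrite -[x]scale1r gh_linear !scale1r. Qed.
Lemma ghom0 : f 0 = 0.
Proof. by apply: (addrI (f 0)); rewrite -ghomD !addr0. Qed.
Lemma ghomZ a x : f (a *: x) = a *: f x.
Proof. by rewrite -[a *: x]addr0 gh_linear ghom0 addr0. Qed.
Lemma ghomN x : f (- x) = - f x.
Proof. by rewrite -!scaleN1r ghomZ. Qed.
Lemma ghomB x y : f (x - y) = f x - f y.
Proof. by rewrite ghomD ghomN. Qed.
Lemma ghom_sum (I : Type) (r : seq I) (P : pred I) (F : I -> M) :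
  f (\sum_(i <- r | P i) F i) = \sum_(i <- r | P i) f (F i).
Proof. exact: (big_morph f ghomD ghom0). Qed.

Lemma ghom_pr d x : f (pr (gm_gr M) d x) = pr (gm_gr N) d (f x).
Proof.
have [s [_ xE]] := pr_sum (gm_gr M) x.
rewrite {2}xE ghom_sum pr_bigsum {1}xE pr_bigsum ghom_sum.
apply: eq_bigr => e _; rewrite pr_pr (pr_homog d (gh_homog f (homog_pr _ e x))).
by case: eqP => // _; rewrite ghom0.
Qed.

End Morphism.

Lemma pr_eq0 (M : zmodType) (G : grading M) (x : M) :
  (forall d, pr G d x = 0) -> x = 0.
Proof. by move=> h; have [s [_ ->]] := pr_sum G x; rewrite big1. Qed.

Section Constructions.
Variable M : gmod A.

Definition gsub_inc (N : gsubmod M) : ghom (gsub N) M.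
Proof. by exists val => // d x /(congr1 val). Defined.

Section Corestriction.
Variables (W : gmod A) (N : gsubmod M) (f : ghom W M).
Hypothesis fN : forall x, f x \in gs_pred N.

Definition gcorestrict : ghom W (gsub N).
Proof.
exists (fun x => Sub (f x) (fN x)) => [a x y|d x hx]; apply: val_inj => /=.
  exact: gh_linear.
by rewrite -ghom_pr hx.
Defined.

End Corestriction.

Definition gproj (N : gsubmod M) : ghom M (gquot N).
Proof.
exists (fun x => \pi_(quot_car N) x) => [a x y|d x hx].
  by rewrite quot_piD -quot_scale_pi.
by rewrite /homogeneous /= quot_pr_pi hx.
Defined.

Lemma gproj_eq0 (N : gsubmod M) x : gproj N x = 0 <-> x \in gs_pred N.
Proof.
rewrite /= -(@quot_pi0 _ _ _ N); split=> [/eqP|h]; last by apply: quot_eq; rewrite subr0.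
by rewrite -Quotient.idealrBE subr0.
Qed.

Lemma gproj_surj (N : gsubmod M) y : exists x, gproj N x = y.
Proof. by exists (repr y); rewrite /= reprK. Qed.

Section Descent.
Variables (W : gmod A) (N : gsubmod M) (f : ghom M W).
Hypothesis fN : forall x, x \in gs_pred N -> f x = 0.

Fact gdescend_pi x : f (repr (\pi_(quot_car N) x)) = f x.
Proof. by apply/eqP; rewrite -subr_eq0 -ghomB; apply/eqP/fN/quot_repr. Qed.

Definition gdescend : ghom (gquot N) W.
Proof.
exists (fun x : quot_car N => f (repr x)).
  move=> a; elim/quot_ind => x; elim/quot_ind => y.
  rewrite -[a *: _](quot_scale_pi N) -quot_piD !gdescend_pi.
  by rewrite gh_linear !gdescend_pi.
move=> d; elim/quot_ind => x; rewrite /homogeneous /= quot_pr_pi => h.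
by rewrite gdescend_pi -ghom_pr -(gdescend_pi (pr _ _ _)) h gdescend_pi.
Defined.

Lemma gdescendE x : gdescend (gproj N x) = f x.
Proof. exact: gdescend_pi. Qed.
End Descent.

Section Kernel.
Variables (W : gmod A) (f : ghom M W).

Definition gker : gsubmod M.
Proof.
exists (fun x => f x == 0).
  split=> [|a x y]; rewrite !unfold_in; first by rewrite ghom0.
  by move=> /eqP hx /eqP hy; rewrite gh_linear hx hy scaler0 addr0.
by move=> d x; rewrite !unfold_in ghom_pr => /eqP ->; rewrite pr0.
Defined.

Lemma mem_gker x : (x \in gs_pred gker) = (f x == 0). Proof. by []. Qed.

Definition gim : gsubmod W.
Proof.
exists (fun y => `[< exists x, f x = y >]).
  split=> [|a x y]; first by apply/asboolP; exists 0; rewrite ghom0.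
  move=> /asboolP[u <-] /asboolP[v <-]; apply/asboolP.
  by exists (a *: u + v); rewrite gh_linear.
by move=> d x /asboolP[u <-]; apply/asboolP; exists (pr (gm_gr M) d u); rewrite ghom_pr.
Defined.

Lemma mem_gim y : (y \in gs_pred gim) <-> exists x, f x = y.
Proof. by split=> /asboolP. Qed.
End Kernel.

Definition gzero : gsubmod M.
Proof.
exists (fun x => x == 0).
  split=> [|a x y]; rewrite !unfold_in //.
  by move=> /eqP -> /eqP ->; rewrite scaler0 addr0.
by move=> d x; rewrite !unfold_in => /eqP ->; rewrite pr0.
Defined.

(** Evaluation at a homogeneous element: the free module on one generator of
    degree [d] represents the functor of elements of degree [d]. *)
Definition gmulr d (x : M) (hx : homogeneous (gm_gr M) d x) :
  ghom (gshift d (gregular A)) M.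
Proof.
exists (fun a : A => a *: x) => [a b c|e a ha].
  by rewrite /= scalerDl -scalerA.
rewrite -(subrK d e); apply: gm_act_homog (hx); exact: ha.
Defined.

End Constructions.

Lemma gregular_fg : finitely_generated (gregular A).
Proof. by exists 1%N, (fun=> 1 : A) => x; exists (fun=> x); rewrite big_ord1 [RHS]mulr1. Qed.

Definition fgregular d : fgmod A := fgshift d (FGMod gregular_fg).

Lemma fg_surj (M N : gmod A) (f : ghom M N) :
  (forall y, exists x, f x = y) -> finitely_generated M -> finitely_generated N.
Proof.
move=> fs [r [g gP]]; exists r, (f \o g) => y; have [x <-] := fs y.
have [c {1}->] := gP x; exists c; rewrite ghom_sum.
by apply: eq_bigr => j _; rewrite ghomZ.
Qed.

Lemma gim_fg (M : fgmod A) (N : gmod A) (f : ghom M N) : finitely_generated (gsub (gim f)).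
Proof.
have fI x : f x \in gs_pred (gim f) by apply/mem_gim; exists x.
apply: (fg_surj (f := gcorestrict fI)) (fg_fin M) => -[y yP].
by have /mem_gim[x xy] := yP; exists x; apply: val_inj.
Qed.

Definition fgquot (M : fgmod A) (N : gsubmod M) : fgmod A := FGMod (gquot_fg N (fg_fin M)).

(** Monomorphisms are tested on shifts of the regular module, which detect the
    homogeneous elements of the kernel. *)
Lemma mono_inj (X Y : C) (f : ghom X Y) :
  @mono K C X Y f <-> forall x, f x = 0 -> x = 0.
Proof.
split=> [fm x fx0|fi W g h E]; last first.
  apply: ghomP => w; apply/eqP; rewrite -subr_eq0; apply/eqP/fi.
  by rewrite ghomB; apply/eqP; rewrite subr_eq0; apply/eqP/(congr1 (fun u : ghom W Y => u w) E).
apply: (pr_eq0 (G := gm_gr X)) => d.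
have := fm (fgregular d) (gmulr (homog_pr (gm_gr X) d x)) 0.
have {fx0}h : f (pr (gm_gr X) d x) = 0 by rewrite ghom_pr fx0 pr0.
move=> /(_ _)/(congr1 (fun u : ghom (fgregular d) X => u (1 : A)))/=.
rewrite scale1r; apply; apply: ghomP => a /=.
by rewrite ghomZ h scaler0 ghom0.
Qed.

(** An epimorphism is surjective because it equalizes zero and the projection
    onto the quotient by its image. *)
Lemma epi_surj (X Y : C) (f : ghom X Y) :
  @epi K C X Y f <-> forall y, exists x, f x = y.
Proof.
split=> [fe y|fs W g h E]; last first.
  apply: ghomP => y; have [x <-] := fs y.
  exact: (congr1 (fun u : ghom X W => u x) E).
apply/mem_gim/gproj_eq0.
have := fe (fgquot (gim f)) (gproj (gim f)) 0.
move=> /(_ _)/(congr1 (fun u : ghom Y (fgquot (gim f)) => u y))/=; apply.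
apply: ghomP => x; apply/gproj_eq0/mem_gim; by exists x.
Qed.

Lemma ghom_inj (X Y : gmod A) (f : ghom X Y) : (forall x, f x = 0 -> x = 0) -> injective f.
Proof. by move=> fi x y E; apply/eqP; rewrite -subr_eq0; apply/eqP/fi; rewrite ghomB E subrr. Qed.

(** The unique preimages under an injective morphism depend linearly on their
    images and have the same degrees. *)
Lemma ghom_lift (W X Y : gmod A) (i : ghom X Y) (g : ghom W Y) : (forall x, i x = 0 -> x = 0) ->
  (forall w, exists x, i x = g w) -> exists h : ghom W X, forall w, i (h w) = g w.
Proof.
move=> /ghom_inj iI ig; pose h w := projT1 (cid (ig w)).
have hK w : i (h w) = g w by exact: projT2 (cid (ig w)).
have hlin (a : A) x y : h (a *: x + y) = a *: h x + h y by apply: iI; rewrite gh_linear !hK gh_linear.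
have hh d x : homogeneous (gm_gr W) d x -> homogeneous (gm_gr X) d (h x).
  by move=> hx; apply: iI; rewrite ghom_pr hK -ghom_pr hx.
by exists (GHom hlin hh).
Qed.

Lemma iso_bij (X Y : C) (f : ghom X Y) :
  @iso K C X Y f <-> (forall x, f x = 0 -> x = 0) /\ forall y, exists x, f x = y.
Proof.
split=> [[g [gf fg]]|[fi fs]].
  split=> [x fx0|y].
    rewrite -[x]/(gid X x) -[gid X]gf /= fx0; exact: (ghom0 (g : ghom Y X)).
  by exists (g y); rewrite -[RHS]/(gid Y y) -[gid Y]fg.
have [g gK] := ghom_lift (g := gid Y) fi fs.
exists g; split; apply: ghomP => x /=; last exact: gK.
by apply: (ghom_inj fi); exact: gK.
Qed.

Lemma isomorphic_sym (X Y : C) : isomorphic X Y -> isomorphic Y X.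
Proof. by move=> [f [g [gf fg]]]; exists g, f. Qed.

Lemma zero_objectP (X : C) : zero_object X <-> forall x : X, x = 0.
Proof.
split=> [h x|h]; first by rewrite -[LHS]/(gid X x) -[gid X]/(idm X) h.
by apply: ghomP => x; rewrite (h (_ x)) [RHS]h.
Qed.

Lemma cokernel_quot (M : fgmod A) (N : gsubmod M) (X : C) (f : ghom X M) :
  (forall x, (x \in gs_pred N) <-> exists u, f u = x) ->
  @cokernel K C X M f (fgquot N) (gproj N).
Proof.
move=> NE; split; first by apply: ghomP => x; apply/gproj_eq0/NE; exists x.
move=> W g g0.
have gN x : x \in gs_pred N -> g x = 0.
  by move=> /NE[u <-]; exact: (congr1 (fun v : ghom X W => v u) g0).
exists (gdescend gN); split; first by apply: ghomP => x; exact: gdescendE.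
move=> h hE; apply: ghomP => y; have [x <-] := gproj_surj y.
by rewrite gdescendE -hE.
Qed.

Lemma cokernel_surj (X Y Z : C) (f : ghom X Y) (p : ghom Y Z) :
  @cokernel K C X Y f Z p -> forall z, exists y, p y = z.
Proof.
case=> pf pu; apply/epi_surj => W g h E.
have [|k [_ ku]] := pu W (cmp g p).
  by rewrite -cmpA pf; apply: ghomP => x /=; rewrite ghom0.
by rewrite -(ku g) // -(ku h).
Qed.

Lemma cokernel_ker (X Y Z : C) (f : ghom X Y) (p : ghom Y Z) :
  @cokernel K C X Y f Z p -> forall y, p y = 0 <-> exists x, f x = y.
Proof.
case=> pf pu y; split=> [py0|[x <-]]; last first.
  exact: (congr1 (fun v : ghom X Z => v x) pf).
have q0 : gcomp (gproj (gim f)) f = 0.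
  by apply: ghomP => x; apply/gproj_eq0/mem_gim; exists x.
have [k [kE _]] := pu (fgquot (gim f)) (gproj (gim f)) q0.
apply/mem_gim/gproj_eq0; rewrite -[gproj _]kE /= py0.
exact: (ghom0 (k : ghom Z (fgquot (gim f)))).
Qed.

Lemma cokernelP (X Y Z : C) (f : ghom X Y) (p : ghom Y Z) :
  (forall z, exists y, p y = z) -> (forall y, p y = 0 <-> exists x, f x = y) ->
  @cokernel K C X Y f Z p.
Proof.
move=> ps pk; split; first by apply: ghomP => x; apply/pk; exists x.
move=> W g g0.
have gk y y' : p y = p y' -> g y = g y'.
  move=> E; apply/eqP; rewrite -subr_eq0 -ghomB.
  have /pk[x <-] : p (y - y') = 0 by rewrite ghomB E subrr.
  by apply/eqP; exact: (congr1 (fun v : ghom X W => v x) g0).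
pose s z := projT1 (cid (ps z)).
have sK z : p (s z) = z by exact: projT2 (cid (ps z)).
have hlin (a : A) x y : g (s (a *: x + y)) = a *: g (s x) + g (s y).
  by rewrite -gh_linear; apply: gk; rewrite gh_linear !sK.
have hh d x : homogeneous (gm_gr Z) d x -> homogeneous (gm_gr W) d (g (s x)).
  move=> h; rewrite /homogeneous -ghom_pr; apply: gk.
  by rewrite ghom_pr sK.
exists (GHom hlin hh : ghom Z W); split.
  by apply: ghomP => y /=; apply: gk; rewrite sK.
move=> h hE; apply: ghomP => z /=; rewrite -[z in RHS]sK.
exact: (esym (congr1 (fun v : ghom Y W => v (s z)) hE)).
Qed.

Lemma kernelP (X Y Z : C) (f : ghom X Y) (i : ghom Z X) :
  (forall z, i z = 0 -> z = 0) -> (forall x, f x = 0 <-> exists z, i z = x) ->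
  @kernel K C X Y f Z i.
Proof.
move=> ii ik; split; first by apply: ghomP => z; apply/ik; exists z.
move=> W g g0; have [|h hE] := ghom_lift (g := g) ii.
  by move=> w; apply/ik; exact: (congr1 (fun v : ghom W Y => v w) g0).
exists h; split=> [|h' h'E]; apply: ghomP => w; first exact: hE.
by apply: (ghom_inj ii); rewrite hE -h'E.
Qed.

Lemma factorsP (X Y W : C) (i : ghom X W) (j : ghom Y W) :
  (forall y, j y = 0 -> y = 0) ->
  @factors K C X Y W i j <-> forall x, exists y, j y = i x.
Proof.
move=> ji; split=> [[h hE] x|h]; first by exists (h x); rewrite -[i]hE.
by have [g gE] := ghom_lift ji h; exists g; apply: ghomP.
Qed.

End GradedModules.

(** * Finitely generated graded modules over a Noetherian algebra *)

Section Noetherian.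
Variables (K : fieldType) (A : galg K).
Local Notation C := (gmodcat A).
Hypothesis noeth : forall (M : fgmod A) (N : gsubmod M), finitely_generated (gsub N).

Definition fgsub (M : fgmod A) (N : gsubmod M) : fgmod A := FGMod (noeth N).

Section DirectSum.
Variables M N : gmod A.

Definition dsum_pr d (x : M * N) : M * N := (pr (gm_gr M) d x.1, pr (gm_gr N) d x.2).

Fact dsum_prD d x y : dsum_pr d (x + y) = dsum_pr d x + dsum_pr d y.
Proof. by rewrite /dsum_pr !prD. Qed.
Fact dsum_pr_pr d e x : dsum_pr d (dsum_pr e x) = if d == e then dsum_pr e x else 0.
Proof. by rewrite /dsum_pr /= !pr_pr; case: eqP. Qed.

Lemma pr_sum_sub (U : zmodType) (G : grading U) (x : U) (s t : seq int) :
  uniq s -> uniq t -> {subset s <= t} -> x = \sum_(d <- s) pr G d x ->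
  x = \sum_(d <- t) pr G d x.
Proof.
move=> us ut st xE; rewrite {1}xE.
rewrite [RHS](bigID (mem s)) /= [X in _ = _ + X]big1 ?addr0; last first.
  move=> d ds; rewrite xE pr_bigsum big_seq big1 // => e es.
  by rewrite pr_pr; case: eqP => // de; rewrite de es in ds.
rewrite -[RHS]big_filter; apply: perm_big; apply: uniq_perm => //.
  exact: filter_uniq.
by move=> d; rewrite mem_filter; case: (boolP (d \in s)) => // /st ->.
Qed.

Fact dsum_pr_sum x : exists s : seq int, uniq s /\ x = \sum_(d <- s) dsum_pr d x.
Proof.
case: x => x y; have [s [us xE]] := pr_sum (gm_gr M) x.
have [t [ut yE]] := pr_sum (gm_gr N) y.
exists (undup (s ++ t)); split; first exact: undup_uniq.
have E (r : seq int) : \sum_(d <- r) dsum_pr d (x, y) =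
    (\sum_(d <- r) pr (gm_gr M) d x, \sum_(d <- r) pr (gm_gr N) d y).
  elim: r => [|d r IH]; first by rewrite !big_nil.
  by rewrite !big_cons IH.
rewrite E -(pr_sum_sub us _ _ xE) ?undup_uniq //; last first.
  by move=> d ds; rewrite mem_undup mem_cat ds.
rewrite -(pr_sum_sub ut _ _ yE) ?undup_uniq // => d dt.
by rewrite mem_undup mem_cat dt orbT.
Qed.

Definition dsum_gr : grading (M * N)%type := Grading dsum_prD dsum_pr_pr dsum_pr_sum.

Fact dsum_act i j (a : A) (x : M * N) :
  homogeneous (ga_gr A) i a -> homogeneous dsum_gr j x -> homogeneous dsum_gr (i + j) (a *: x).
Proof.
case: x => x y ha [hx hy]; rewrite /homogeneous /= /dsum_pr /=.
have := gm_act_homog ha (hx : homogeneous _ _ _).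
by have := gm_act_homog ha (hy : homogeneous _ _ _) => /= -> ->.
Qed.

Definition gdsum : gmod A := @GMod K A (M * N)%type dsum_gr dsum_act.

Definition gdsum_inl : ghom M gdsum.
Proof.
exists (fun x => (x, 0) : gdsum) => [a x y|d x h] /=.
  by transitivity (a *: x + y, a *: 0 + 0 : N); first by rewrite scaler0 addr0.
by rewrite /homogeneous /= /dsum_pr /= h pr0.
Defined.
Definition gdsum_inr : ghom N gdsum.
Proof.
exists (fun x => (0, x) : gdsum) => [a x y|d x h] /=.
  by transitivity (a *: 0 + 0 : M, a *: x + y); first by rewrite scaler0 addr0.
by rewrite /homogeneous /= /dsum_pr /= h pr0.
Defined.
Definition gdsum_fst : ghom gdsum M.
Proof. by exists (fun x : gdsum => x.1) => // d x /(congr1 fst). Defined.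
Definition gdsum_snd : ghom gdsum N.
Proof. by exists (fun x : gdsum => x.2) => // d x /(congr1 snd). Defined.

End DirectSum.

Fact gdsum_fg (M N : fgmod A) : finitely_generated (gdsum M N).
Proof.
have [r [g gP]] := fg_fin M; have [s [h hP]] := fg_fin N.
exists (r + s)%N, (fun j => match split j with
  | inl i => gdsum_inl M N (g i) | inr i => gdsum_inr M N (h i) end).
case=> x y; have [c xE] := gP x; have [d yE] := hP y.
exists (fun j => match split j with inl i => c i | inr i => d i end).
rewrite big_split_ord /=.
have -> : (x, y) = gdsum_inl M N x + gdsum_inr M N y :> gdsum M N.
  by congr (_, _); rewrite ?addr0 ?add0r.
congr (_ + _); rewrite ?{1}xE ?{1}yE ghom_sum; apply: eq_bigr => i _; rewrite ghomZ.
  by have := unsplitK (inl i : 'I_r + 'I_s)%type; rewrite /= => ->.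
by have := unsplitK (inr i : 'I_r + 'I_s)%type; rewrite /= => ->.
Qed.

Lemma gsub_inc_inj (M : gmod A) (N : gsubmod M) z : gsub_inc N z = 0 -> z = 0.
Proof. by move=> h; apply: val_inj. Qed.

Lemma gmod_abelian : abelian C.
Proof.
split.
- exists (fgsub (gzero (fgregular A 0))); apply/zero_objectP => x.
  by apply: val_inj; apply/eqP; exact: (valP x).
- move=> X Y; exists (FGMod (gdsum_fg X Y)), (gdsum_inl X Y), (gdsum_inr X Y),
    (gdsum_fst X Y), (gdsum_snd X Y).
  split; apply: ghomP => //= -[x y] /=.
  by congr (_, _); rewrite ?addr0 ?add0r.
- move=> X Y f; split.
    exists (fgsub (gker f)), (gsub_inc (gker f)); apply: kernelP.
      by move=> z; apply: gsub_inc_inj.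
    move=> x; split=> [fx|[z <-]]; last by apply/eqP; exact: (valP z).
    have xk : x \in gs_pred (gker f) by rewrite mem_gker fx.
    by exists (Sub x xk).
  exists (fgquot (gim f)), (gproj (gim f)); apply: cokernel_quot => x.
  exact: mem_gim.
- move=> X Y f /mono_inj fi; exists (fgquot (gim f)), (gproj (gim f)).
  apply: kernelP => // x; split=> [/gproj_eq0/mem_gim//|h].
  exact/gproj_eq0/mem_gim.
- move=> X Y f /epi_surj fs; exists (fgsub (gker f)), (gsub_inc (gker f)).
  apply: cokernelP => // x; split=> [fx|[z <-]]; last by apply/eqP; exact: (valP z).
  have xk : x \in gs_pred (gker f) by rewrite mem_gker fx.
  by exists (Sub x xk).
Qed.

(** An ascending chain of submodules stabilizes once it contains generators of
    its union. *)
Lemma gmod_noetherian (W : C) : noetherian W.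
Proof.
move=> X i im ic.
have ii m z : i m z = 0 -> z = 0 by move: z; apply/mono_inj.
have up1 m x : exists y, i m.+1 y = i m x.
  by move: x; apply/(@factorsP _ _ _ _ _ (i m) (i m.+1) (@ii _)).
have up m d x : exists y, i (m + d)%N y = i m x.
  elim: d => [|d [y <-]]; first by rewrite addn0; exists x.
  by rewrite addnS; exact: up1.
have up2 m l x : (m <= l)%N -> exists y, i l y = i m x.
  by move=> ml; rewrite -(subnKC ml); exact: up.
pose U : {pred W} := fun x => `[< exists m u, i m u = x >].
have Uc : submod_closed U.
  split; first by apply/asboolP; exists 0%N, 0; rewrite ghom0.
  move=> a x y /asboolP[m [u <-]] /asboolP[l [v <-]]; apply/asboolP.
  have [u' <-] := up2 m (maxn m l) u (leq_maxl _ _).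
  have [v' <-] := up2 l (maxn m l) v (leq_maxr _ _).
  by exists (maxn m l), (a *: u' + v'); rewrite gh_linear.
have Up d x : x \in U -> pr (gm_gr W) d x \in U.
  by move=> /asboolP[m [u <-]]; apply/asboolP; exists m, (pr (gm_gr (X m)) d u); rewrite ghom_pr.
pose N := GSubmod Uc Up.
have [r [g gP]] := noeth N.
have gU j : exists m, exists u, i m u = val (g j) by exact/asboolP/(valP (g j)).
pose m j := projT1 (cid (gU j)).
have mP j : exists u, i (m j) u = val (g j) by exact: projT2 (cid (gU j)).
exists (\max_j m j)%N => l hl; apply/(factorsP _ (@ii _)) => x.
have xU : i l x \in gs_pred N by apply/asboolP; exists l, x.
have [c cE] := gP (Sub (i l x) xU).
have -> : i l x = \sum_j c j *: val (g j).
  rewrite -[LHS]/(gsub_inc N (Sub (i l x) xU)) cE ghom_sum.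
  by apply: eq_bigr => j _; rewrite ghomZ.
set n0 := \max_j _; have mn j : (m j <= n0)%N by exact: leq_bigmax.
elim/big_ind: _ => [|y z [u <-] [v <-]|j _].
- by exists 0; rewrite ghom0.
- by exists (u + v); rewrite ghomD.
- have [u <-] := mP j.
  have [v <-] := up2 (m j) _ u (mn j).
  by exists (c j *: v); rewrite ghomZ.
Qed.

End Noetherian.

(** * Positively graded algebras with semisimple degree zero part *)

Section GradedScalars.
Variables (K : fieldType) (A : galg K).

Definition kscale (M : gmod A) (c : K) (x : M) : M := ga_scal A c *: x.
Local Notation "c *% x" := (kscale c x) (at level 40).

Section Scalars.
Variable M : gmod A.
Implicit Types (x y : M) (c : K).

Lemma kscaleA c d x : c *% (d *% x) = (c * d) *% x.
Proof. by rewrite /kscale scalerA rmorphM. Qed.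
Lemma kscale1 x : 1 *% x = x.
Proof. by rewrite /kscale rmorph1 scale1r. Qed.
Lemma kscale0 x : 0 *% x = 0.
Proof. by rewrite /kscale rmorph0 scale0r. Qed.
Lemma kscaler0 c : c *% (0 : M) = 0.
Proof. exact: scaler0. Qed.
Lemma kscaleDl c d x : (c + d) *% x = c *% x + d *% x.
Proof. by rewrite /kscale rmorphD scalerDl. Qed.
Lemma kscaleC a c x : a *: (c *% x) = c *% (a *: x).
Proof. by rewrite /kscale !scalerA ga_scalC. Qed.
Lemma kscale_sum c (I : Type) (r : seq I) (P : pred I) (F : I -> M) :
  c *% (\sum_(i <- r | P i) F i) = \sum_(i <- r | P i) c *% F i.
Proof. exact: scaler_sumr. Qed.

Lemma pr_scale d i (a : A) x : homogeneous (ga_gr A) i a ->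
  pr (gm_gr M) d (a *: x) = a *: pr (gm_gr M) (d - i) x.
Proof.
move=> ha; have [s [us xE]] := pr_sum (gm_gr M) x.
rewrite {1}xE scaler_sumr pr_bigsum {2}xE pr_bigsum scaler_sumr.
apply: eq_bigr => j _; rewrite pr_pr.
rewrite (pr_homog d (gm_act_homog ha (homog_pr _ j x))) addrC -subr_eq.
by case: eqP; rewrite ?scaler0.
Qed.

Lemma pr_kscale d c x : pr (gm_gr M) d (c *% x) = c *% pr (gm_gr M) d x.
Proof. by rewrite /kscale (pr_scale _ _ (ga_scal_homog A c)) subr0. Qed.

Lemma kscale_homog d c x : homogeneous (gm_gr M) d x -> homogeneous (gm_gr M) d (c *% x).
Proof. by rewrite /homogeneous pr_kscale => ->. Qed.

End Scalars.

Lemma ghom_kscale (M N : gmod A) (f : ghom M N) c x : f (c *% x) = c *% f x.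
Proof. exact: ghomZ. Qed.

End GradedScalars.

Notation "c *% x" := (kscale c x) (at level 40).

Section Positive.
Variables (K : fieldType) (A : galg K) (I : finType) (e : I -> A).
Local Notation C := (gmodcat A).
Hypothesis noeth : forall (M : fgmod A) (N : gsubmod M), finitely_generated (gsub N).
Hypothesis A_neg : forall d x, d < 0 -> pr (ga_gr A) d x = 0.
Hypothesis A_zero : forall x, homogeneous (ga_gr A) 0 x ->
  exists c : I -> K, x = \sum_a ga_scal A (c a) * e a.
Hypothesis A_fd : forall d, exists r (b : 'I_r -> A), forall x,
  homogeneous (ga_gr A) d x -> exists c : 'I_r -> K, x = \sum_j ga_scal A (c j) * b j.
Hypothesis e_homog : forall a (u : unit), homogeneous (gm_gr (gregular A)) 0 (e a).
Hypothesis eM : forall a b, e a * e b = if a == b then e a else 0.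
Hypothesis e_sum : \sum_a e a = 1.
Variable chi : I -> {rmorphism A -> K}.
Hypothesis chi_scal : forall a c, chi a (ga_scal A c) = c.
Hypothesis chi_homog : forall a d x, homogeneous (ga_gr A) d x -> d != 0 -> chi a x = 0.
Hypothesis chi_e : forall a b, chi a (e b) = (b == a)%:R.

Definition Lchar (a : I) : fgmod A :=
  FGMod (gchar_fg (A := A) (chi := chi a) (chi_scal a) (@chi_homog a)).

Lemma e_idem a : e a * e a = e a. Proof. by rewrite eM eqxx. Qed.

Lemma sum_e (M : lmodType A) (x : M) : x = \sum_a e a *: x.
Proof. by rewrite -scaler_suml e_sum scale1r. Qed.

Lemma chi_pr0 a x : chi a x = chi a (pr (ga_gr A) 0 x).
Proof.
have [s [us xE]] := pr_sum (ga_gr A) x; rewrite {1}xE {2}xE pr_bigsum !rmorph_sum.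
apply: eq_bigr => d _; rewrite pr_pr eq_sym.
case: eqP => [//|/eqP d0]; rewrite rmorph0.
exact: chi_homog (homog_pr _ d x) d0.
Qed.

(** In degree zero the algebra is spanned by the idempotents, and a vector of
    weight [a] is killed by all of them but [e a]. *)
Lemma act_zero a (M : gmod A) (x : M) z : homogeneous (ga_gr A) 0 z -> e a *: x = x ->
  z *: x = chi a z *% x.
Proof.
move=> /A_zero[c ->] ex; rewrite scaler_suml rmorph_sum /kscale rmorph_sum scaler_suml.
apply: eq_bigr => b _; rewrite rmorphM chi_scal chi_e -scalerA.
have -> : e b *: x = if b == a then x else 0.
  by rewrite -{1}ex scalerA eM; case: eqP => [->|_]; rewrite ?ex ?scale0r.
by case: eqP => _; rewrite ?mulr1 // mulr0 rmorph0 scale0r scaler0.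
Qed.

Lemma act_chi a (M : gmod A) (x : M) : e a *: x = x ->
  (forall d z, 0 < d -> homogeneous (ga_gr A) d z -> z *: x = 0) ->
  forall z, z *: x = chi a z *% x.
Proof.
move=> ex h z; rewrite chi_pr0 -(act_zero (homog_pr _ 0 z) ex).
have [s [us zE]] := pr_sum (ga_gr A) z; rewrite {1}zE {2}zE pr_bigsum !scaler_suml.
apply: eq_bigr => d _; rewrite pr_pr eq_sym; case: (ltgtP d 0) => [d0|d0|-> //].
  by rewrite A_neg // scale0r.
by rewrite scale0r; apply: h d0 (homog_pr _ d z).
Qed.

(** An element of positive degree would move the vector out of the only degree
    in which the module lives, so it kills the vector. *)
Lemma line_iso (M : C) (y : M) a d : y <> 0 -> homogeneous (gm_gr M) d y ->
  e a *: y = y -> (forall x, exists c, x = c *% y) ->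
  isomorphic M (@sh K C d (Lchar a)).
Proof.
move=> y0 hy ey My; apply: isomorphic_sym.
have pos i z : 0 < i -> homogeneous (ga_gr A) i z -> z *: y = 0.
  move=> i0 hz; have [c cE] := My (z *: y).
  have := gm_act_homog hz hy; rewrite cE /homogeneous pr_kscale.
  rewrite (pr_homog _ hy) -subr_eq0 addrK gt_eqF //.
  by rewrite kscaler0.
have act := act_chi ey pos.
pose f : Lchar a -> M := fun c => (c : K) *% y.
have flin (z : A) (u v : Lchar a) : f (z *: u + v) = z *: f u + f v.
  rewrite /f kscaleDl kscaleC act kscaleA; congr (_ *% _ + _).
  exact: mulrC.
have fhom i u : homogeneous (gm_gr (gshift d (Lchar a))) i u -> homogeneous (gm_gr M) i (f u).
  rewrite {1}/homogeneous /= /char_pr subr_eq0; case: eqP => [-> _|_ <-].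
    exact: kscale_homog.
  by rewrite /f kscale0; apply: homog0.
exists (@GHom _ _ (gshift d (Lchar a)) M f flin fhom).
apply/iso_bij; split=> [x|m] /=; last first.
  by have [c ->] := My m; exists c.
rewrite /f => h; apply/eqP; case: (eqVneq (x : K) 0) => // x0; case: y0.
rewrite -[y]kscale1 -(mulVf x0) -kscaleA h; exact: kscaler0.
Qed.

Lemma gsub_mono (M : gmod A) (N : gsubmod M) (hN : finitely_generated (gsub N)) (hM : finitely_generated M) :
  @mono K C (FGMod hN) (FGMod hM) (gsub_inc N).
Proof. by apply/mono_inj => z; apply: gsub_inc_inj. Qed.

(** The elements of degree at least [m]; they form a submodule because the
    algebra lives in nonnegative degrees. *)
Definition gtrunc (M : gmod A) (m : int) : gsubmod M.
Proof.
exists (fun x => `[< forall d, d < m -> pr (gm_gr M) d x = 0 >]).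
  split=> [|a x y]; first by apply/asboolP => d _; rewrite pr0.
  move=> /asboolP hx /asboolP hy; apply/asboolP => d dm; rewrite prD hy // addr0.
  have [s [us ->]] := pr_sum (ga_gr A) a; rewrite scaler_suml pr_bigsum big1 // => i _.
  rewrite (pr_scale _ _ (homog_pr _ i a)); case: (ltP i 0) => i0.
    by rewrite A_neg // scale0r.
  rewrite hx ?scaler0 //; apply: le_lt_trans dm.
  by rewrite lerBlDr lerDl.
move=> d x /asboolP hx; apply/asboolP => i im; rewrite pr_pr.
by case: eqP => // E; rewrite hx -?E.
Defined.

Lemma mem_gtrunc (M : gmod A) m (x : M) :
  x \in gs_pred (gtrunc M m) <-> forall d, d < m -> pr (gm_gr M) d x = 0.
Proof. by split=> /asboolP. Qed.

Lemma Lchar_simple a : simple (Lchar a : C).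
Proof.
split; first by move/zero_objectP=> /(_ (1 : K))/eqP; rewrite oner_eq0.
move=> Y i /mono_inj ii.
have [h|] := pselect (forall y, i y = 0).
  by left; apply/zero_objectP => y; apply: ii.
move=> /existsNP[y /eqP iy]; right; apply/iso_bij; split=> // z.
exists (((z : K) / (i y : K)) *% y); rewrite ghom_kscale.
by rewrite [LHS](_ : _ = chi a (ga_scal A (z / (i y : K))) * (i y : K)) // chi_scal divfK.
Qed.

(** A simple module is generated by a weight vector; the truncation above its
    degree is a proper submodule, hence zero. *)
Lemma simple_Lchar (S : C) : simple S -> exists a m, isomorphic S (@sh K C m (Lchar a)).
Proof.
move=> [S0 Ss].
have [x [a [d [x0 hx ex]]]] : exists x : S, exists a d,
    [/\ x <> 0, homogeneous (gm_gr S) d x & e a *: x = x].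
  apply: contrapT => H; apply: S0; apply/zero_objectP => x.
  apply: (pr_eq0 (G := gm_gr S)) => d; rewrite [LHS]sum_e big1 // => a _.
  apply: contrapT => h; apply: H; exists (e a *: pr (gm_gr S) d x), a, d; split=> //.
    have := gm_act_homog (e_homog a tt : homogeneous (ga_gr A) _ _) (homog_pr (gm_gr S) d x).
    by rewrite add0r.
  by rewrite scalerA e_idem.
pose f := gmulr hx.
have fx : x \in gs_pred (gim f) by apply/mem_gim; exists (1 : A); rewrite /= scale1r.
have [|/iso_bij[_ fs]] := Ss _ _ (@gsub_mono _ _ (gim_fg (f : ghom (fgregular A d) S)) (fg_fin S)).
  by move/zero_objectP => /(_ (Sub x fx))/(congr1 val).
have tr0 : forall y, y \in gs_pred (gtrunc S (d + 1)) -> y = 0.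
  move=> y yt; have [z|/iso_bij[_ /(_ x)[y' y'E]]] := Ss _ _ (@gsub_mono _ _ (noeth (gtrunc S (d + 1))) (fg_fin S)).
    have /zero_objectP/(_ (Sub y yt))/(congr1 val) := z; exact.
  case: x0; rewrite -hx -y'E.
  by move: (valP y') => /mem_gtrunc; apply; rewrite ltzD1.
have pos i z : 0 < i -> homogeneous (ga_gr A) i z -> z *: x = 0.
  move=> i0 hz; apply: tr0; apply/mem_gtrunc => j jd.
  rewrite (pr_homog _ (gm_act_homog hz hx)); case: eqP => // jE.
  by move: jd; rewrite jE addrC ltrD2l ltNge -gtz0_ge1 i0.
exists a, d; apply: (line_iso x0 hx ex) => y.
have [y' yE] := fs y; have /mem_gim[z zE] := valP y'; exists (chi a z).
by rewrite -(act_chi ex pos) -yE -[gsub_inc _ _]zE.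
Qed.

Lemma Lchar_irredundant a b m : isomorphic (Lchar a : C) (@sh K C m (Lchar b)) -> a = b.
Proof.
move=> [f /iso_bij[fi _]]; pose u : Lchar a := (1 : K).
have uE : e a *: u = u by rewrite [LHS](_ : _ = chi a (e a) * 1) // chi_e eqxx mulr1.
have := ghomZ (f : ghom _ _) (e a) u; rewrite uE => E.
case: (eqVneq a b) => // ab; have := fi u.
rewrite E [e a *: f u](_ : _ = chi b (e a) * (f u : K)) // chi_e (negPf ab) mul0r.
by move=> /(_ erefl)/eqP; rewrite oner_eq0.
Qed.

(** ** Finite length *)

Definition weight_spanned (M : gmod A) r (y : 'I_r -> M) : Prop :=
  exists (w : 'I_r -> I) (d : 'I_r -> int),
  [/\ forall j, e (w j) *: y j = y j, forall j, homogeneous (gm_gr M) (d j) (y j)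
    & forall x, exists c : 'I_r -> K, x = \sum_j c j *% y j].

(** Discarding a spanning weight vector of lowest degree leaves a submodule,
    because the algebra raises degrees except for the multiples of the [e a]. *)
Lemma finite_length_spanned r (M : fgmod A) (y : 'I_r -> M) :
  weight_spanned y -> finite_length (M : C).
Proof.
elim: r M y => [|r IH] M y [w [d [ey hy My]]].
  apply: finite_length0; apply/zero_objectP => x.
  by have [c ->] := My x; rewrite big_ord0.
have [j0 j0P] : exists j0, forall j, d j0 <= d j.
  by case: (arg_minP (P := predT) d (i0 := ord0)) => // j0 _ h; exists j0 => j; apply: h.
pose X : {pred M} := fun x => `[< exists c, x = \sum_j c j *% y (lift j0 j) >].
have XD x x' : x \in X -> x' \in X -> x + x' \in X.
  move=> /asboolP[c ->] /asboolP[c' ->]; apply/asboolP.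
  exists (fun j => c j + c' j); rewrite -big_split; apply: eq_bigr => j _.
  by rewrite kscaleDl.
have X0 : 0 \in X.
  by apply/asboolP; exists (fun=> 0); rewrite big1 // => j _; rewrite kscale0.
have Xsum (F : 'I_r -> M) : (forall j, F j \in X) -> \sum_j F j \in X.
  by move=> h; elim/big_ind: _.
have Xy j c : c *% y (lift j0 j) \in X.
  apply/asboolP; exists (fun i => if i == j then c else 0).
  rewrite (bigD1 j) //= eqxx big1 ?addr0 // => i /negPf ->; exact: kscale0.
have Xhi i x : d j0 < i -> homogeneous (gm_gr M) i x -> x \in X.
  move=> i0 hx; have [c xE] := My x; rewrite -hx xE pr_bigsum.
  elim/big_ind: _ => // j _; rewrite pr_kscale (pr_homog _ (hy j)).
  case: eqP => [ij|_]; last by rewrite kscaler0.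
  case: (unliftP j0 j) => [j' ->|jj0]; first exact: Xy.
  by move: i0; rewrite ij jj0 ltxx.
have XZ (a : A) x : x \in X -> a *: x \in X.
  move=> /asboolP[c ->]; rewrite scaler_sumr; elim/big_ind: _ => // j _.
  set l := lift j0 j; have [s [us ->]] := pr_sum (ga_gr A) a.
  rewrite scaler_suml; elim/big_ind: _ => // i _.
  case: (ltgtP i 0) => [i0|i0|->].
  - by rewrite A_neg // scale0r.
  - apply: (Xhi (i + d l)); last first.
      by apply: gm_act_homog (homog_pr _ i a) (kscale_homog _ (hy l)).
    by apply: le_lt_trans (j0P l) _; rewrite ltrDr.
  - rewrite kscaleC (act_zero (homog_pr _ 0 a) (ey l)) kscaleA; exact: Xy.
have Xc : submod_closed X by split=> // a u v hu hv; apply: XD => //; apply: XZ.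
have Xp i x : x \in X -> pr (gm_gr M) i x \in X.
  move=> /asboolP[c ->]; rewrite pr_bigsum; elim/big_ind: _ => // j _.
  rewrite pr_kscale (pr_homog _ (hy _)); case: eqP => // _; by rewrite kscaler0.
pose N := GSubmod Xc Xp.
have [yX|yX] := boolP (y j0 \in X).
  apply: (IH M (fun j => y (lift j0 j))).
  exists (fun j => w (lift j0 j)), (fun j => d (lift j0 j)); split=> // x.
  suff : x \in X by move/asboolP.
  have [c ->] := My x; rewrite (bigD1_ord j0) //=.
  by apply: XD; [apply: XZ|apply: Xsum].
apply: (@finite_lengthS K C (fgsub noeth N) M (fgquot N) (gsub_inc N) (gproj N)).
- apply: kernelP => [z|x]; first exact: gsub_inc_inj.
  split=> [/gproj_eq0 xN|[z <-]]; first by exists (Sub x xN).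
  apply/gproj_eq0; exact: (valP z).
- apply: cokernel_quot => x; split=> [xN|[z <-]]; last exact: (valP z).
  by exists (Sub x xN).
- pose y' j : fgsub noeth N := Sub (1 *% y (lift j0 j)) (Xy j 1).
  have y'E j : val (y' j) = y (lift j0 j) by rewrite /= kscale1.
  apply: (IH _ y'); exists (fun j => w (lift j0 j)), (fun j => d (lift j0 j)); split.
  + by move=> j; apply: val_inj; rewrite [LHS]/= y'E kscale1 ey.
  + by move=> j; apply: val_inj; rewrite [LHS]/= y'E kscale1 hy.
  + case=> x xN; have /asboolP[c xE] := xN; exists c; apply: val_inj.
    rewrite -[RHS]/(gsub_inc N (\sum_j c j *% y' j)) ghom_sum /= xE.
    by apply: eq_bigr => j _; rewrite kscale1.
- have qL : isomorphic (fgquot N : C) (@sh K C (d j0) (Lchar (w j0))).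
    apply: (@line_iso (fgquot N) (gproj N (y j0))).
    + by move/gproj_eq0 => h; rewrite h in yX.
    + by apply: gh_homog; apply: hy.
    + by rewrite -ghomZ ey.
    + move=> q; have [x <-] := gproj_surj q; have [c ->] := My x; exists (c j0).
      rewrite -ghom_kscale; apply/eqP; rewrite -subr_eq0 -ghomB; apply/eqP/gproj_eq0.
      rewrite (bigD1_ord j0) //= addrAC subrr add0r.
      by apply: Xsum.
  have [f /iso_bij[fi fs]] := qL.
  have [L0 Ls] := Lchar_simple (w j0).
  split.
    move=> /zero_objectP z; case: L0; apply/zero_objectP => x.
    by have [q <-] := fs x; rewrite (z q) ghom0.
  move=> Y i /mono_inj ii.
  have im : @mono K C (fgshift (- d j0) Y) (Lchar (w j0))
     (gcomp (gshift0 _) (gcomp (gshiftDV _ (esym (addNr (d j0)))) (gshift_map (- d j0) (gcomp f i)))).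
    by apply/mono_inj => x /= /fi/ii.
  have [/zero_objectP z|/iso_bij[_ s]] := Ls _ _ im.
    by left; apply/zero_objectP.
  right; apply/iso_bij; split=> // q; have [u uE] := s (f q); exists u.
  apply/eqP; rewrite -subr_eq0; apply/eqP/fi; rewrite ghomB; apply/eqP.
  by rewrite subr_eq0; apply/eqP.
Qed.

(** ** Truncations *)

Definition weight_vector (M : gmod A) (y : M) : Prop :=
  exists a d, e a *: y = y /\ homogeneous (gm_gr M) d y.

(** The linear span of [s], given by its induction principle. *)
Definition kspan (M : gmod A) (s : seq M) (x : M) : Prop :=
  forall S : M -> Prop, S 0 -> (forall u v, S u -> S v -> S (u + v)) ->
    (forall c y, y \in s -> S (c *% y)) -> S x.

Lemma kspan0 (M : gmod A) (s : seq M) : kspan s 0.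
Proof. by []. Qed.
Lemma kspanD (M : gmod A) (s : seq M) x y : kspan s x -> kspan s y -> kspan s (x + y).
Proof. by move=> hx hy S S0 SD Sy; exact: SD (hx _ S0 SD Sy) (hy _ S0 SD Sy). Qed.
Lemma kspan_mem (M : gmod A) (s : seq M) c x : x \in s -> kspan s (c *% x).
Proof. by move=> xs S S0 SD Sy; apply: Sy. Qed.
Lemma kspan_sub (M : gmod A) (s t : seq M) x : {subset s <= t} -> kspan s x -> kspan t x.
Proof. by move=> st h S S0 SD Sy; apply: h => // c y /st; apply: Sy. Qed.

Definition finitely_weighted (M : gmod A) (S : M -> Prop) : Prop :=
  exists s : seq M, (forall y, y \in s -> weight_vector y) /\ forall x, S x -> kspan s x.

Lemma finitely_weighted_bigcup (M : gmod A) (J : eqType) (r : seq J) (F : J -> M -> Prop) :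
  (forall j, j \in r -> finitely_weighted (F j)) ->
  finitely_weighted (fun x => exists j, j \in r /\ F j x).
Proof.
elim: r => [|j r IH] h; first by exists [::]; split=> // x [j []].
have [|s [sw sP]] := IH; first by move=> i ir; apply: h; rewrite inE ir orbT.
have [t [tw tP]] := h j (mem_head _ _).
exists (t ++ s); split=> [y|x [i]].
  by rewrite mem_cat => /orP[/tw|/sw].
rewrite inE => -[/orP[/eqP->|ir] Fx].
  by apply: kspan_sub (tP _ Fx) => y yt; rewrite mem_cat yt.
apply: kspan_sub (sP _ _); first by move=> y ys; rewrite mem_cat ys orbT.
by exists i.
Qed.

Lemma finite_length_weighted (M : fgmod A) :
  finitely_weighted (fun _ : M => True) -> finite_length (M : C).
Proof.
move=> [s [sw sP]]; have wv j : weight_vector (tnth (in_tuple s) j) by apply/sw/mem_tnth.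
have [w wP] := choice wv; have [d dP] := choice wP.
apply: (@finite_length_spanned (size s) M (tnth (in_tuple s))).
exists w, d; split=> [j|j|x]; [by case: (dP j)|by case: (dP j)|].
apply: (sP x Logic.I (fun x => exists c : 'I_(size s) -> K, x = \sum_j c j *% tnth (in_tuple s) j))
  => [|u v [c ->] [c' ->]|c y ys].
- by exists (fun=> 0); rewrite big1 // => j _; rewrite kscale0.
- by exists (fun j => c j + c' j); rewrite -big_split; apply: eq_bigr => j _; rewrite kscaleDl.
- have /tnthP[j ->] : y \in in_tuple s by [].
  exists (fun i => if i == j then c else 0).
  rewrite (bigD1 j) //= eqxx big1 ?addr0 // => i /negPf ->; exact: kscale0.
Qed.

(** Below degree [m] a finitely generated module is spanned by finitely many
    weight vectors, because each component of the algebra is finite dimensional. *)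
Lemma finite_length_trunc (W : fgmod A) (Z : C) m (i : C) (j : ghom i W) (c : ghom W Z) :
  (forall x, x \in gs_pred (gtrunc W m) -> exists y, j y = x) ->
  @cokernel K C i W j Z c -> finite_length Z.
Proof.
move=> jt cc; have cs := cokernel_surj cc; have ck := cokernel_ker cc.
have c0 x : (forall d, d < m -> pr (gm_gr W) d x = 0) -> c x = 0.
  by move=> h; apply/ck/jt/mem_gtrunc.
have [r [g gP]] := fg_fin W.
have one d (x : W) k : homogeneous (gm_gr W) d x -> finitely_weighted (fun z =>
    exists a, homogeneous (ga_gr A) k a /\ z = c (a *: x)).
  move=> hx; have [l [b bP]] := A_fd k.
  exists [seq e p.1 *: c (pr (ga_gr A) k (b p.2) *: x) | p : I * 'I_l].
  split=> [y /mapP[[p q] _ ->]|z [a [ha ->]]].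
    exists p, (k + d); split=> /=; first by rewrite scalerA e_idem.
    rewrite -[k + d]add0r; apply: gm_act_homog (e_homog p tt) _.
    by apply: gh_homog; apply: gm_act_homog (homog_pr _ _ _) hx.
  have [f fE] := bP a ha; rewrite -ha fE pr_bigsum scaler_suml ghom_sum.
  elim/big_ind: _ => [|u v|q _]; [exact: kspan0|exact: kspanD|].
  rewrite (pr_scale (M := gregular A) k (b q) (ga_scal_homog A (f q))) subr0 -scalerA.
  rewrite -[_ *: (_ *: x)]/(f q *% _) ghom_kscale [X in _ *% X]sum_e kscale_sum.
  elim/big_ind: _ => [|u v|p _]; [exact: kspan0|exact: kspanD|].
  apply: kspan_mem; apply/mapP; exists (p, q) => //; exact: mem_enum.
have gs j0 : exists s : seq int, uniq s /\ g j0 = \sum_(d <- s) pr (gm_gr W) d (g j0).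
  exact: pr_sum.
have [s sP] := choice gs.
pose F (p : 'I_r * int * nat) z := exists a,
  homogeneous (ga_gr A) p.2%:Z a /\ z = c (a *: pr (gm_gr W) p.1.2 (g p.1.1)).
pose J := [seq (p, k) | p <- [seq (j0, d) | j0 <- enum 'I_r, d <- s j0],
  k <- iota 0 `|m - p.2|%N].
have [|t [tw tP]] := @finitely_weighted_bigcup Z _ J F.
  by move=> [[j0 d] k] _; apply: one; apply: homog_pr.
apply: finite_length_weighted; exists t; split=> // z _.
have [w <-] := cs z; have [a ->] := gP w; rewrite ghom_sum.
elim/big_ind: _ => [|u v|j0 _]; [exact: kspan0|exact: kspanD|].
have [us ->] := sP j0; rewrite scaler_sumr ghom_sum big_seq.
elim/big_ind: _ => [|u v|d ds]; [exact: kspan0|exact: kspanD|].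
have [s' [_ ->]] := pr_sum (ga_gr A) (a j0); rewrite scaler_suml ghom_sum.
elim/big_ind: _ => [|u v|k _]; [exact: kspan0|exact: kspanD|].
have hk := homog_pr (ga_gr A) k (a j0); have hd := homog_pr (gm_gr W) d (g j0).
case: (ltP k 0) => k0; first by rewrite A_neg // scale0r ghom0; exact: kspan0.
case: (ltP (k + d) m) => kd; last first.
  rewrite c0; first exact: kspan0.
  move=> d' d'm; rewrite (pr_homog _ (gm_act_homog hk hd)) lt_eqF //.
  exact: lt_le_trans d'm kd.
apply: tP; exists (j0, d, `|k|%N); split; last first.
  by exists (pr (ga_gr A) k (a j0)); rewrite /= gez0_abs.
apply/allpairsPdep; exists (j0, d), `|k|%N; split=> //.
  by apply/allpairsPdep; exists j0, d; rewrite mem_enum.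
rewrite mem_iota /= add0n -ltz_nat gez0_abs //.
by rewrite gez0_abs ?subr_ge0 ?ltrBrDr //; apply: le_trans (ltW kd); rewrite lerDr.
Qed.

Lemma gtrunc_filtration (W : C) : exists (X : nat -> C) (i : forall m, ghom (X m) W),
  @separated_filtration K C W X i /\
  forall m (Z : C) (c : ghom W Z), @cokernel K C (X m) W (i m) Z c -> finite_length Z.
Proof.
exists (fun m => fgsub noeth (gtrunc W m%:Z)), (fun m => gsub_inc (gtrunc W m%:Z)).
split; last first.
  move=> m Z c; apply: finite_length_trunc => x xt.
  by exists (Sub x xt).
split=> [m|m|Y g h].
- by apply/mono_inj => z; apply: gsub_inc_inj.
- apply/factorsP => [y|x]; first exact: gsub_inc_inj.
  have xt : val x \in gs_pred (gtrunc W m%:Z).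
    have /mem_gtrunc hx := valP x; apply/mem_gtrunc => d dm; apply: hx.
    by apply: lt_trans dm _; rewrite ltz_nat.
  by exists (Sub (val x) xt).
- apply: ghomP => y; apply: (pr_eq0 (G := gm_gr W)) => d.
  have [k E] := h (`|d|%N.+1); rewrite -E /=.
  move: (valP (k y)) => /mem_gtrunc; apply.
  by rewrite -addn1 PoszD ltzD1 abszE ler_norm.
Qed.

(** ** Projective covers *)

Definition Pmod (a : I) : fgmod A := FGMod (gsub_span_fg predT (e_homog a)).

Lemma mem_Pmod a (x : gregular A) : (x \in gs_pred (gspan predT (e_homog a))) <-> x * e a = x :> A.
Proof.
split=> [/asboolP[c ->]|xe]; last first.
  apply/asboolP; exists (fun=> x); rewrite (big_pred1 tt); first exact: (esym xe).
  by case.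
rewrite (big_pred1 tt); last by case.
exact: etrans (esym (mulrA (c tt) (e a) (e a))) (congr1 ( *%R (c tt)) (e_idem a)).
Qed.

Lemma Pmod_e a (x : Pmod a) : val x * e a = val x :> A.
Proof. by apply/mem_Pmod; exact: (valP x). Qed.

Definition Pgen a : Pmod a := Sub (e a : gregular A) (iffRL (mem_Pmod a (e a)) (e_idem a)).

Lemma Pgen_gen a (x : Pmod a) : x = (val x : A) *: Pgen a.
Proof. by apply: val_inj; rewrite /= -[RHS]/(val x * e a) Pmod_e. Qed.

Lemma Pgen_homog a : homogeneous (gm_gr (Pmod a)) 0 (Pgen a).
Proof. by apply: val_inj; exact: (e_homog a tt). Qed.

Lemma Pgen_e a : e a *: Pgen a = Pgen a.
Proof. by apply: val_inj; exact: e_idem. Qed.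

Lemma Phom_ext a m (M : gmod A) (f g : ghom (gshift m (Pmod a)) M) :
  f (Pgen a) = g (Pgen a) -> f = g.
Proof.
by move=> E; apply: ghomP => x; rewrite [x]Pgen_gen (ghomZ f) (ghomZ g) E.
Qed.

(** [q^m (A e_a)] represents the functor of elements of weight [a] and degree [m]. *)
Definition Phom a m (M : gmod A) (y : M) (hy : homogeneous (gm_gr M) m y) :
  ghom (gshift m (Pmod a)) M.
Proof.
refine (@GHom K A (gshift m (Pmod a)) M (fun x : Pmod a => (val x : A) *: y) _ _) => [b x x'|d x hx].
  by rewrite /= scalerDl -scalerA.
by rewrite -(subrK m d); apply: gm_act_homog (hy); exact: (congr1 val hx).
Defined.

Lemma PhomE a m (M : gmod A) (y : M) (hy : homogeneous (gm_gr M) m y) :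
  e a *: y = y -> Phom a hy (Pgen a) = y.
Proof. by []. Qed.

Definition Ptop (a : I) : ghom (Pmod a) (Lchar a).
Proof.
refine (@GHom K A (Pmod a) (Lchar a) (fun x : Pmod a => chi a (val x : A)) _ _)
  => [b x y|d x /(congr1 val)/= hx].
  by rewrite /= rmorphD rmorphM.
rewrite /homogeneous /= /char_pr; case: eqP => // /eqP d0.
by rewrite (chi_homog _ hx d0).
Defined.

(** The weight [a] component of degree zero of [A e_a] is the line of [e a]; hence
    a submodule of [A e_a] that maps onto the top contains [e a]. *)
Lemma Ptop_cover a : @projective_cover K C (Pmod a) (Lchar a) (Ptop a).
Proof.
have e0 := e_homog a tt : homogeneous (ga_gr A) 0 (e a).
have zc (M : gmod A) (x : M) : homogeneous (gm_gr M) 0 (e a *: pr (gm_gr M) 0 x).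
  by have := gm_act_homog e0 (homog_pr (gm_gr M) 0 x); rewrite addr0.
split.
- move=> X Y p f /epi_surj ps; have [x xE] := ps (f (Pgen a)).
  exists (gcomp (Phom a (zc X x)) (gshift0V _)); apply: ghomP => y /=.
  rewrite !ghomZ ghom_pr xE -ghom_pr Pgen_homog -(ghomZ f) Pgen_e -(ghomZ f).
  by rewrite -Pgen_gen.
- apply/epi_surj => c; exists (c *% Pgen a).
  rewrite ghom_kscale /= chi_e eqxx.
  by rewrite [LHS](_ : _ = chi a (ga_scal A c) * 1) // chi_scal mulr1.
- move=> X f /epi_surj ps; apply/epi_surj => y; have [x xE] := ps (1 : K).
  pose u := val (f (e a *: pr (gm_gr X) 0 x)) : A.
  have uE : u = e a * pr (ga_gr A) 0 (val (f x) : A) by rewrite /u ghomZ ghom_pr.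
  have h1 : chi a (val (f x) : A) = 1 by exact: xE.
  have u1 : u = e a.
    have ue : u * e a = u by rewrite /u Pmod_e.
    have h0 : homogeneous (ga_gr A) 0 u.
      by have := ga_mul_homog e0 (homog_pr (ga_gr A) 0 (val (f x) : A)); rewrite uE addr0.
    rewrite -ue; have := act_zero (M := gregular A) h0 (e_idem a).
    rewrite -[u *: _]/(u * e a) => ->.
    rewrite uE rmorphM -chi_pr0 h1 chi_e eqxx mul1r.
    exact: (kscale1 (e a : gregular A)).
  exists ((val y : A) *: (e a *: pr (gm_gr X) 0 x)).
  rewrite ghomZ [RHS]Pgen_gen; congr (_ *: _); apply: val_inj; exact: u1.
Qed.

(** Morphisms between shifts of [A e_a] and [A e_b] are elements of one component
    of [e_a A e_b]. *)
Lemma Pmod_laurentian a b : @laurentian_Hom K C (Pmod a) (Pmod b).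
Proof.
have hv m (f : ghom (gshift m (Pmod a)) (Pmod b)) : homogeneous (ga_gr A) m (val (f (Pgen a)) : A).
  have : homogeneous (gm_gr (Pmod b)) m (f (Pgen a)).
    by apply: gh_homog; rewrite /homogeneous [LHS]/= subrr; exact: Pgen_homog.
  by move/(congr1 val).
split=> [m|]; last first.
  exists 0 => m m0 f; apply: Phom_ext; apply: val_inj.
  by rewrite /= -(hv m f) A_neg.
have [r [y yP]] := A_fd m.
pose z j : A := e a * pr (ga_gr A) m (y j) * e b.
have zP j : (z j : gregular A) \in gs_pred (gspan predT (e_homog b)).
  by apply/mem_Pmod; rewrite /z -!mulrA e_idem.
have zh j : homogeneous (gm_gr (Pmod b)) m (Sub (z j) (zP j) : Pmod b).
  apply: val_inj => /=.
  have := ga_mul_homog (ga_mul_homog (e_homog a tt : homogeneous (ga_gr A) _ _)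
    (homog_pr (ga_gr A) m (y j))) (e_homog b tt : homogeneous (ga_gr A) _ _).
  by rewrite add0r addr0.
exists r, (fun j => Phom a (zh j)) => f.
have [c cE] := yP _ (hv m f); exists c; apply: Phom_ext.
have -> : (\sum_j c j *: Phom a (zh j) : ghom _ _) (Pgen a) =
    \sum_j c j *% (Phom a (zh j) (Pgen a)).
  by elim/big_ind2: _ => // u v u' v' <- <-.
apply: val_inj.
rewrite -[RHS]/(gsub_inc _ (\sum_j c j *% (Phom a (zh j) (Pgen a)))) ghom_sum.
have fE : val (f (Pgen a)) = e a * val (f (Pgen a)) * e b :> A.
  by rewrite -mulrA Pmod_e; have := ghomZ f (e a) (Pgen a); rewrite Pgen_e => /(congr1 val).
rewrite fE -(hv m f) cE pr_bigsum mulr_sumr mulr_suml; apply: eq_bigr => j _.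
rewrite ghom_kscale -[RHS]/(ga_scal A (c j) * (e a * z j)).
have := pr_scale (M := gregular A) m (y j) (ga_scal_homog A (c j)).
rewrite subr0 -[_ *: _]/(ga_scal A (c j) * y j) => ->.
rewrite -[_ *: _]/(ga_scal A (c j) * pr (ga_gr A) m (y j)) /z [in RHS](mulrA (e a)) (mulrA (e a) (e a)) e_idem.
by rewrite !mulrA ga_scalC.
Qed.

Lemma noetherian_laurentian_gmod : @noetherian_laurentian K C I Lchar Pmod Ptop.
Proof.
split; first exact: gmod_abelian.
- split; [exact: Lchar_simple|exact: simple_Lchar|exact: Lchar_irredundant].
- by move=> W; split; [apply: gmod_noetherian|apply: gtrunc_filtration].
- exact: Ptop_cover.
- exact: Pmod_laurentian.
Qed.

(** The submodule generated by [y] is a line modulo its elements of degree greater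
    than [d], because the algebra acts on [y] in degree zero by scalars. *)
Lemma weight_subquotient (M : C) (y : M) a d : y <> 0 -> homogeneous (gm_gr M) d y ->
  e a *: y = y -> subquotient (@sh K C d (Lchar a)) M.
Proof.
move=> y0 hy ey; pose f := gmulr hy.
pose X : fgmod A := FGMod (gim_fg (f : ghom (fgregular A d) M)).
have fy : y \in gs_pred (gim f) by apply/mem_gim; exists (1 : A); rewrite /= scale1r.
pose yX : X := Sub y fy.
have hyX : homogeneous (gm_gr X) d yX by apply: val_inj.
have eyX : e a *: yX = yX by apply: val_inj.
have [|||x|g /iso_bij[gi gs]] := @line_iso (fgquot (gtrunc X (d + 1))) (gproj _ yX) a d.
- move/gproj_eq0/mem_gtrunc/(_ d); rewrite hyX ltrDl ltr01 => /(_ isT)/(congr1 val).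
  exact: y0.
- exact: gh_homog.
- by rewrite -ghomZ; congr (gproj _ _); apply: val_inj.
- have [u <-] := gproj_surj x; have /mem_gim[z zE] := valP u; exists (chi a z).
  have uE : u = z *: yX by apply: val_inj.
  rewrite uE -ghom_kscale; apply/eqP; rewrite -subr_eq0 -ghomB; apply/eqP/gproj_eq0/mem_gtrunc.
  move=> j; rewrite ltzD1 => jd.
  have -> : pr (gm_gr X) j (z *: yX - chi a z *% yX) =
      pr (ga_gr A) (j - d) z *: yX - chi a z *% pr (gm_gr X) j yX.
    by rewrite prD prN pr_kscale (pr_scale_homogeneous _ _ hyX).
  rewrite (pr_homog _ hyX); case: (eqVneq j d) => [->|jd'].
    by rewrite subrr chi_pr0 (act_zero (homog_pr _ 0 z) eyX) subrr.
  by rewrite A_neg ?scale0r ?kscaler0 ?subrr // subr_lt0 lt_neqAle jd' jd.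
exists X, (gsub_inc _ : ghom X M), (gcomp g (gproj (gtrunc X (d + 1))) : ghom X (@sh K C d (Lchar a))).
split; first by apply/mono_inj => z; apply: gsub_inc_inj.
apply/epi_surj => c; have [u uE] := gs c; have [v vE] := gproj_surj u.
by exists v; rewrite /= -uE -vE.
Qed.

End Positive.

(** * Hilbert's basis theorem for modules *)

Section HilbertBasis.
Variables (A : pzRingType) (M : lmodType A).
Implicit Types (Z : A -> Prop) (N : M -> Prop).

(** Submodules for a set [Z] of operators: in the induction on the number of
    central variables, [Z] contains the scalars and the first few of them. *)
Definition stable_sub Z N : Prop :=
  [/\ N 0, forall x y, N x -> N y -> N (x + y) & forall z x, Z z -> N x -> N (z *: x)].

Definition noetherian_sub Z N0 : Prop :=
  forall N, stable_sub Z N -> (forall x, N x -> N0 x) ->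
  exists s : seq M, (forall x, x \in s -> N x) /\
    forall N', stable_sub Z N' -> (forall x, x \in s -> N' x) -> forall x, N x -> N' x.

Section Step.
Variables (Z : A -> Prop) (t : A) (N0 : M -> Prop).
Hypothesis Zopp : Z (-1).
Hypothesis tZ : forall z, Z z -> z * t = t * z.
Hypothesis N0s : stable_sub Z N0.
Hypothesis N0n : noetherian_sub Z N0.

(** Polynomials in [t] of degree less than [j] with coefficients in [N0]. *)
Definition poly_lt j x : Prop :=
  exists m : nat -> M, (forall i, N0 (m i)) /\ x = \sum_(i < j) t ^+ i *: m i.

Definition adjoin_op (z : A) : Prop := Z z \/ z = t.

Lemma poly_lt_stable j : stable_sub Z (poly_lt j).
Proof.
have [Z0 ZD ZZ] := N0s; split.
- by exists (fun=> 0); split=> //; rewrite big1 // => i _; rewrite scaler0.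
- move=> x y [m [hm ->]] [l [hl ->]]; exists (fun i => m i + l i).
  split=> [i|]; first exact: ZD.
  by rewrite -big_split; apply: eq_bigr => i _; rewrite scalerDr.
- move=> z x zZ [m [hm ->]]; exists (fun i => z *: m i); split=> [i|]; first exact: ZZ.
  rewrite scaler_sumr; apply: eq_bigr => i _; rewrite !scalerA; congr (_ *: _).
  have : GRing.comm z t by exact: tZ.
  by move/(commrX i).
Qed.

Lemma poly_ltS j x : poly_lt j.+1 x <-> exists m y, [/\ N0 m, poly_lt j y & x = t ^+ j *: m + y].
Proof.
split=> [[m [hm ->]]|[m [y [hm [l [hl ->]] ->]]]].
  exists (m j), (\sum_(i < j) t ^+ i *: m i); split=> //; first by exists m.
  by rewrite big_ord_recr addrC.
exists (fun i => if i == j then m else l i); split=> [i|]; first by case: eqP.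
rewrite big_ord_recr /= eqxx addrC; congr (_ + _); apply: eq_bigr => i _.
by rewrite ltn_eqF.
Qed.

Lemma poly_lt_mono j x : poly_lt j x -> poly_lt j.+1 x.
Proof.
move=> h; apply/poly_ltS; exists 0, x; split=> //; last by rewrite scaler0 add0r.
by case: N0s.
Qed.

Lemma poly_lt_leq i j x : (i <= j)%N -> poly_lt i x -> poly_lt j x.
Proof.
move=> /subnKC <-; elim: (j - i)%N => [|d IH] h; first by rewrite addn0.
by rewrite addnS; apply/poly_lt_mono/IH.
Qed.

Lemma poly_lt_shift j x : poly_lt j x -> poly_lt j.+1 (t *: x).
Proof.
move=> [m [hm ->]]; exists (fun i => if i is i'.+1 then m i' else 0).
split=> [[|i] //|]; first by case: N0s.
rewrite big_ord_recl scaler0 add0r scaler_sumr; apply: eq_bigr => i _.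
by rewrite scalerA -exprS.
Qed.

Definition poly_sub x : Prop := exists j, poly_lt j x.

Lemma poly_sub_stable : stable_sub adjoin_op poly_sub.
Proof.
split.
- by exists 0%N; case: (poly_lt_stable 0).
- move=> x y [i hx] [j hy]; exists (maxn i j).
  have [_ D _] := poly_lt_stable (maxn i j).
  by apply: D; [apply: poly_lt_leq hx; apply: leq_maxl|apply: poly_lt_leq hy; apply: leq_maxr].
- move=> z x [zZ|->] [j hx]; last by exists j.+1; apply: poly_lt_shift.
  by exists j; have [_ _ h] := poly_lt_stable j; apply: h.
Qed.

Lemma poly_sub_incl x : N0 x -> poly_sub x.
Proof.
move=> h; exists 1%N; apply/poly_ltS; exists x, 0; split=> //; last by rewrite expr0 scale1r addr0.
by have [] := poly_lt_stable 0.
Qed.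

(** Leading coefficients of the elements of [N] of degree at most [j]. *)
Definition leading N j m : Prop := N0 m /\ exists y, poly_lt j y /\ N (t ^+ j *: m + y).

Lemma leading_stable N j : stable_sub adjoin_op N -> stable_sub Z (leading N j).
Proof.
move=> [n0 nD nZ]; have [z0 zD zZ] := N0s; have [p0 pD pZ] := poly_lt_stable j.
split.
- by split=> //; exists 0; split=> //; rewrite scaler0 addr0.
- move=> x y [hx [u [hu xu]]] [hy [v [hv yv]]]; split; first exact: zD.
  by exists (u + v); split; [exact: pD|rewrite scalerDr addrACA; apply: nD].
- move=> z x hz [hx [u [hu xu]]]; split; first exact: zZ.
  exists (z *: u); split; first exact: pZ.
  have -> : t ^+ j *: (z *: x) + z *: u = z *: (t ^+ j *: x + u).
    rewrite scalerDr !scalerA; congr (_ *: _ + _).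
    have : GRing.comm z t by exact: tZ.
    by move/(commrX j).
  by apply: nZ => //; left.
Qed.

Lemma leading_mono N i j m : stable_sub adjoin_op N -> (i <= j)%N -> leading N i m -> leading N j m.
Proof.
move=> ns /subnKC <-; elim: (j - i)%N => [|d IH] h; first by rewrite addn0.
rewrite addnS; have [hm [y [hy my]]] := IH h; split=> //.
exists (t *: y); split; first exact: poly_lt_shift.
rewrite exprS -scalerA -scalerDr; have [_ _ nZ] := ns; apply: nZ my.
by right.
Qed.

(** Hilbert's basis theorem: a submodule is determined, inside any larger one,
    by its leading coefficients in each degree, and these stabilize. *)
Lemma noetherian_adjoin : noetherian_sub adjoin_op poly_sub.
Proof.
move=> N ns Nsub; have [n0 nD nZ] := ns.
pose detects (S : seq M) j := forall N', stable_sub adjoin_op N' ->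
  (forall x, x \in S -> N' x) -> forall m, leading N j m -> leading N' j m.
have one j : exists S, (forall x, x \in S -> N x) /\ detects S j.
  have [s [sN sP]] := N0n (leading_stable j ns) (fun x h => h.1).
  have ex : forall m, exists y, m \in s -> poly_lt j y /\ N (t ^+ j *: m + y).
    move=> m; case: (boolP (m \in s)) => [/sN[_ [y h]]|_]; first by exists y.
    by exists 0.
  have [f fP] := choice ex.
  exists [seq t ^+ j *: m + f m | m <- s]; split.
    by move=> _ /mapP[m ms ->]; have [] := fP m ms.
  move=> N' n's hS; apply: sP; first exact: leading_stable.
  move=> m ms; have [fm _] := fP m ms; have [m0 _] := sN m ms.
  by split=> //; exists (f m); split=> //; apply: hS; apply: map_f.
have many J : exists S, (forall x, x \in S -> N x) /\ forall j, (j < J)%N -> detects S j.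
  elim: J => [|J [S [SN hS]]]; first by exists [::].
  have [T [TN hT]] := one J; exists (S ++ T); split=> [x|j].
    by rewrite mem_cat => /orP[/SN|/TN].
  rewrite ltnS leq_eqVlt => /orP[/eqP ->|jJ] N' n's h.
    by apply: hT => // x xT; apply: h; rewrite mem_cat xT orbT.
  by apply: (hS j) => // x xS; apply: h; rewrite mem_cat xS.
(* [J] bounds the degrees in which generators of the union of the modules of
   leading coefficients occur. *)
have [J JP] : exists J, forall N', stable_sub adjoin_op N' ->
    (forall m, leading N J m -> leading N' J m) ->
    forall j m, (J <= j)%N -> leading N j m -> leading N' j m.
  have us : stable_sub Z (fun m => exists j, leading N j m).
    split.
    - by exists 0%N; case: (leading_stable 0 ns).
    - move=> x y [i hx] [j hy]; exists (maxn i j).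
      have [_ D _] := leading_stable (maxn i j) ns.
      by apply: D; [apply: leading_mono hx; rewrite ?leq_maxl|apply: leading_mono hy; rewrite ?leq_maxr].
    - by move=> z x hz [j hx]; exists j; have [_ _ h] := leading_stable j ns; apply: h.
  have [|s [sN sP]] := N0n us; first by move=> x [j []].
  have [J hJ] : exists J, forall m, m \in s -> leading N J m.
    elim: s sN {sP} => [|m s IH] sN; first by exists 0%N.
    have [|J hJ] := IH; first by move=> x xs; apply: sN; rewrite inE xs orbT.
    have [j hj] := sN m (mem_head _ _); exists (maxn j J) => x.
    rewrite inE => /orP[/eqP ->|/hJ h]; first by apply: leading_mono hj; rewrite ?leq_maxl.
    by apply: leading_mono h; rewrite ?leq_maxr.
  exists J => N' n's h j m Jj mj; apply: (leading_mono n's Jj).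
  apply: (sP _ (leading_stable J n's)); last by exists j.
  by move=> x /hJ/h.
have [S [SN hS]] := many J.+1; exists S; split=> // N' n's SN' x Nx.
(* Intersecting with [N], the submodule [N'] may be assumed to lie in [N]. *)
pose N'' y := N' y /\ N y.
have n''s : stable_sub adjoin_op N''.
  have [a b c] := n's; split=> //.
  - by move=> u v [u1 u2] [v1 v2]; split; [apply: b|apply: nD].
  - by move=> z u hz [u1 u2]; split; [apply: c|apply: nZ].
have lead j m : leading N j m -> leading N'' j m.
  have low i : (i <= J)%N -> forall m, leading N i m -> leading N'' i m.
    by move=> iJ; apply: (hS i iJ N'' n''s) => y yS; split; [apply: SN'|apply: SN].
  case: (leqP j J) => [/low h|/ltnW]; first exact: h.
  by apply: JP => //; apply: low.
have [j xj] := Nsub x Nx; suff [] : N'' x by [].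
elim: j x xj Nx => [|j IH] x.
  by move=> [m [_ ->]]; rewrite big_ord0 => _; have [] := n''s.
move=> /poly_ltS[m [y [hm hy xE]]] Nx.
have [|_ [u [hu [N'u Nu]]]] := @lead j m; first by split=> //; exists y; rewrite -xE.
have [p0 pD pZ] := poly_lt_stable j; have [_ D _] := n''s.
have opp v : N v -> N (- v) by move=> h; rewrite -scaleN1r; apply: nZ => //; left.
have -> : x = (t ^+ j *: m + u) + (y - u) by rewrite xE addrA [_ + u + y]addrAC addrK.
apply: D; first by [].
apply: IH; first by apply: pD => //; rewrite -scaleN1r; apply: pZ.
have -> : y - u = x - (t ^+ j *: m + u) by rewrite xE opprD addrACA subrr add0r.
by apply: nD => //; apply: opp.
Qed.
End Step.
End HilbertBasis.

Section FiniteGeneration.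
Variables (K : fieldType) (A : galg K).

Definition kscalar (z : A) : Prop := exists c, z = ga_scal A c.

Fixpoint kscalar_or (ts : seq A) (z : A) : Prop :=
  if ts is t :: ts' then adjoin_op (kscalar_or ts') t z else kscalar z.

Lemma kscalarN1 : kscalar (-1).
Proof. by exists (-1); rewrite rmorphN1. Qed.

(** The induction step for finite dimensional spaces: one more vector. *)
Lemma noetherian_line (M : lmodType A) (N0 : M -> Prop) y : stable_sub kscalar N0 ->
  noetherian_sub kscalar N0 ->
  noetherian_sub kscalar (fun x => exists m c, N0 m /\ x = m + ga_scal A c *: y).
Proof.
move=> [z0 zD zZ] N0n N Ns Nsub; have [n0 nD nZ] := Ns.
have [||s [sN sP]] := N0n (fun x => N x /\ N0 x); last 1 first.
- have sN1 x : x \in s -> N x by move=> /sN[].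
  have [low|] := pselect (forall x, N x -> N0 x).
    by exists s; split=> // N' n's h x Nx; apply: sP => //; split=> //; apply: low.
  move=> /existsNP[x0 /not_implyP[Nx0 N0x0]].
  exists (x0 :: s); split=> [x|N' n's h x Nx].
    by rewrite inE => /orP[/eqP ->|/sN1].
  have [m0 [c0 [hm0 x0E]]] := Nsub _ Nx0; have [m [c [hm xE]]] := Nsub _ Nx.
  have c00 : c0 != 0.
    by apply: contra_notN N0x0 => /eqP c0E; rewrite x0E c0E rmorph0 scale0r addr0.
  have [a b d] := n's.
  have Zk z : kscalar (ga_scal A z) by exists z.
  have opp z v : ga_scal A (- z) *: v = - (ga_scal A z *: v) :> M by rewrite rmorphN scaleNr.
  pose w := x + ga_scal A (- (c / c0)) *: x0.
  have wE : w = m + ga_scal A (- (c / c0)) *: m0.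
    rewrite /w xE x0E scalerDr scalerA -rmorphM mulNr divfK // opp.
    by rewrite -addrA; congr (_ + _); rewrite addrCA opp subrr addr0.
  have N'w : N' w.
    apply: sP; [by []|by move=> v vs; apply: h; rewrite inE vs orbT|split].
      by apply: nD => //; apply: nZ.
    by rewrite wE; apply: zD => //; apply: zZ.
  have -> : x = w + ga_scal A (c / c0) *: x0 by rewrite /w opp subrK.
  by apply: b => //; apply: d => //; apply: h; rewrite mem_head.
- split=> [//|u v [u1 u2] [v1 v2]|z u hz [u1 u2]]; split; by [apply: nD|apply: zD|apply: nZ|apply: zZ].
- by move=> x [].
Qed.

Lemma noetherian_kspan (M : lmodType A) (g : seq M) : exists N0 : M -> Prop,
  [/\ stable_sub kscalar N0, noetherian_sub kscalar N0 & forall x, x \in g -> N0 x].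
Proof.
elim: g => [|y g [N0 [s0 n0 gN]]].
  exists (fun x => x = 0); split=> //.
    split=> // [x y -> ->|z x _ ->]; [exact: addr0|exact: scaler0].
  by move=> N _ N0; exists [::]; split=> // N' [n0 _ _] _ x /N0 ->.
exists (fun x => exists m c, N0 m /\ x = m + ga_scal A c *: y); split.
- have [a b d] := s0; split.
  + by exists 0, 0; split=> //; rewrite rmorph0 scale0r addr0.
  + move=> _ _ [m [c [hm ->]]] [l [e [hl ->]]]; exists (m + l), (c + e).
    by split; [apply: b|rewrite rmorphD scalerDl addrACA].
  + move=> _ _ [e ->] [m [c [hm ->]]]; exists (ga_scal A e *: m), (e * c).
    by split; [apply: d => //; exists e|rewrite scalerDr scalerA rmorphM].
- exact: noetherian_line.
- move=> x; rewrite inE => /orP[/eqP ->|/gN hx].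
    by exists 0, 1; have [a _ _] := s0; rewrite add0r rmorph1 scale1r.
  by exists x, 0; rewrite rmorph0 scale0r addr0.
Qed.

Lemma kscalar_or_sub ts z : kscalar z -> kscalar_or ts z.
Proof. by elim: ts => [//|t ts IH] /= h; left; apply: IH. Qed.

Lemma kscalar_or_comm ts a :
  (forall t, t \in ts -> t * a = a * t) -> forall z, kscalar_or ts z -> z * a = a * z.
Proof.
elim: ts => [_ z [c ->]|t ts IH h z [/IH zh|->]] /=; first exact: ga_scalC.
  by apply: zh => u us; apply: h; rewrite inE us orbT.
by apply: h; rewrite mem_head.
Qed.

Lemma noetherian_tower (M : lmodType A) (ts : seq A) (g : seq M) :
  (forall t a, t \in ts -> t * a = a * t) -> exists N0 : M -> Prop,
  [/\ stable_sub (kscalar_or ts) N0, noetherian_sub (kscalar_or ts) N0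
    & forall x, x \in g -> N0 x].
Proof.
elim: ts => [|t ts IH] tc; first exact: noetherian_kspan.
have [|N0 [s0 n0 gN]] := IH; first by move=> u a us; apply: tc; rewrite inE us orbT.
have comm z : kscalar_or ts z -> z * t = t * z.
  by apply: kscalar_or_comm => u us; apply: tc; rewrite inE us orbT.
exists (poly_sub t N0); split.
- exact: poly_sub_stable.
- by apply: noetherian_adjoin => //; apply/kscalar_or_sub/kscalarN1.
- by move=> x /gN; apply: (poly_sub_incl comm s0).
Qed.

(** A finitely generated module is generated by the products of the [bs] with its
    generators over the scalars and the [ts] only, so Hilbert's theorem applies
    one variable [t] after the other. *)
Theorem noetherian_finite_over_central (ts bs : seq A) :
  (forall t a, t \in ts -> t * a = a * t) ->
  (forall S : gregular A -> Prop, stable_sub (kscalar_or ts) S ->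
     (forall b, b \in bs -> S b) -> forall a, S a) ->
  forall (M : fgmod A) (N : gsubmod M), finitely_generated (gsub N).
Proof.
move=> tc bsA M N; have [r [g gP]] := fg_fin M.
have [N0 [s0 n0 gN]] := noetherian_tower [seq b *: g j | b <- bs, j <- enum 'I_r] tc.
have N0M x : N0 x.
  have [c ->] := gP x; have [z zD zZ] := s0; elim/big_ind: _ => // j _.
  apply: (bsA (fun a : gregular A => N0 ((a : A) *: g j)) _ _ (c j)).
    split=> [|a b ha hb|a b ha hb]; first by rewrite scale0r.
      by rewrite scalerDl; apply: zD.
    by rewrite -scalerA; apply: zZ.
  by move=> b hb; apply: gN; apply/allpairsP; exists (b, j); rewrite mem_enum.
have [||s [sN sP]] := n0 (fun x => x \in gs_pred N); last 1 first.
- have tN j : tnth (in_tuple s) j \in gs_pred N by apply: sN; apply: mem_tnth.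
  exists (size s), (fun j => Sub (tnth (in_tuple s) j) (tN j)) => -[x xN].
  have [c cE] : exists c, x = \sum_j c j *: tnth (in_tuple s) j.
    apply: (sP (fun x => exists c, x = \sum_j c j *: tnth (in_tuple s) j)) => //.
      split.
      + by exists (fun=> 0); rewrite big1 // => j _; rewrite scale0r.
      + move=> _ _ [c ->] [d ->]; exists (fun j => c j + d j).
        by rewrite -big_split; apply: eq_bigr => j _; rewrite scalerDl.
      + move=> z _ _ [c ->]; exists (fun j => z * c j).
        by rewrite scaler_sumr; apply: eq_bigr => j _; rewrite scalerA.
    move=> y ys; have /tnthP[j ->] : y \in in_tuple s by [].
    exists (fun i => (i == j)%:R).
    rewrite (bigD1 j) //= eqxx scale1r big1 ?addr0 // => i /negPf ->; exact: scale0r.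
  exists c; apply: val_inj; rewrite -[val (\sum_j _)]/(gsub_inc N (\sum_j _)) ghom_sum /=; exact: cE.
- split=> [|x y|z x _]; [exact: rpred0|exact: rpredD|exact: rpredZ].
- by move=> x _; apply: N0M.
Qed.

End FiniteGeneration.

(** * Genericity of the arrangement and linear programming *)

Section Genericity.
Variables (R : realType) (n k : nat) (A : polarized R n k).
Local Notation V := (pa_V A).

Definition xi (v : 'rV[R]_n) : R := pa_xi A (vsproj V v).

Lemma xiD u v : xi (u + v) = xi u + xi v. Proof. by rewrite /xi !linearD. Qed.
Lemma xiZ c v : xi (c *: v) = c * xi v. Proof. by rewrite /xi !linearZ. Qed.
Lemma xiN v : xi (- v) = - xi v. Proof. by rewrite /xi !linearN. Qed.
Lemma xiB u v : xi (u - v) = xi u - xi v. Proof. by rewrite xiD xiN. Qed.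

Lemma xi_sub (v : subvs_of V) : pa_xi A v = xi (vsval v).
Proof. by rewrite /xi vsvalK. Qed.

Lemma V_etaB x y : V_eta A x -> V_eta A y <-> y - x \in V.
Proof.
rewrite /V_eta => <-; split=> [E|h].
  by have /eqP := E; rewrite -Quotient.idealrBE.
by apply/eqP; rewrite -Quotient.idealrBE.
Qed.

Lemma V_etaD x v : V_eta A x -> v \in V -> V_eta A (x + v).
Proof. by move=> hx hv; apply/(V_etaB _ hx); rewrite addrC addKr. Qed.

Definition zeros (x : 'rV[R]_n) : {set 'I_n} := [set i | x 0 i == 0].

Lemma k_le_n : (k <= n)%N.
Proof.
rewrite -(pa_dim A); apply: leq_trans (dimvS (subvf V)) _.
by rewrite dimvf /dim /= mul1n.
Qed.

Lemma zeros_le x : V_eta A x -> (#|zeros x| <= k)%N.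
Proof.
move=> hx; have := pa_eta_generic hx.
have -> : [set i | x 0 i != 0] = ~: zeros x by apply/setP => i; rewrite !inE.
have := cardsC (zeros x); rewrite card_ord; have := k_le_n.
set a := #|_|; set b := #|_|; lia.
Qed.

(** The projection onto the coordinates in [S]. *)
Definition keep (S : {set 'I_n}) : 'End('rV[R]_n) :=
  linfun (mulmxr (diag_mx (\row_i (i \in S)%:R))).

Lemma keepE S v i : keep S v 0 i = if i \in S then v 0 i else 0.
Proof.
rewrite /keep lfunE /= mul_mx_diag !mxE.
by case: ifP; rewrite ?mulr1 ?mulr0.
Qed.

Lemma lker_keep S v : (v \in lker (keep S)) <-> forall i, i \in S -> v 0 i = 0.
Proof.
rewrite memv_ker; split=> [/eqP h i iS|h].
  by have := keepE S v i; rewrite iS h mxE.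
by apply/eqP/rowP => i; rewrite keepE mxE; case: ifP => // /h.
Qed.

Definition coord_space (S : {set 'I_n}) : {vspace 'rV[R]_n} :=
  <<[seq delta_mx 0%R i | i <- enum S]>>%VS.

Lemma mem_coord_space (S : {set 'I_n}) (w : 'rV[R]_n) : (forall i, i \notin S -> w 0 i = 0) ->
  w \in coord_space S.
Proof.
move=> h; rewrite [w]row_sum_delta rpred_sum // => i _.
case: (boolP (i \in S)) => [iS|/h ->]; last by rewrite scale0r rpred0.
by rewrite rpredZ // memv_span // map_f // mem_enum.
Qed.

Lemma dim_coord_space S : (\dim (coord_space S) <= #|S|)%N.
Proof. by apply: leq_trans (dim_span _) _; rewrite size_map cardE. Qed.

Lemma keep_img_sub S U : (keep S @: U <= coord_space S)%VS.
Proof.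
apply/subvP => _ /memv_imgP[u _ ->]; apply: mem_coord_space => i iS.
by rewrite keepE (negPf iS).
Qed.

(** Genericity of [eta]: a point of the arrangement lying on a set [Z] of
    hyperplanes can be moved along any subspace [U] of directions inside them
    until it meets [\dim U] further ones. *)
Lemma zeros_dim_le (U : {vspace 'rV[R]_n}) (Z : {set 'I_n}) x : V_eta A x -> (U <= V)%VS ->
  (forall i, i \in Z -> x 0 i = 0) ->
  (forall u i, u \in U -> i \in Z -> u 0 i = 0) -> (#|Z| + \dim U <= k)%N.
Proof.
have [m le_m] := ubnP (\dim U); elim: m => // m IH in U Z x le_m *.
move=> hx UV xZ UZ; case: (posnP (\dim U)) => [->|U0].
  rewrite addn0; apply: leq_trans (zeros_le hx); apply: subset_leq_card.
  by apply/subsetP => i iZ; rewrite inE xZ.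
pose u := vpick U; have uU : u \in U by apply: memv_pick.
have u0 : u != 0 by rewrite vpick0 -dimv_eq0 -lt0n.
have /rV0Pn[j uj] := u0.
have jZ : j \notin Z by apply: contra uj => jZ; rewrite (UZ u j).
pose U' := (U :&: lker (keep [set j]))%VS.
have dimU : (\dim U <= (\dim U').+1)%N.
  rewrite -(limg_ker_dim (keep [set j]) U) -/U' -[leqRHS]addn1 leq_add2l.
  apply: leq_trans (dimvS (keep_img_sub _ _)) _.
  by apply: leq_trans (dim_coord_space _) _; rewrite cards1.
have U'j v : v \in U' -> v 0 j = 0.
  by rewrite memv_cap => /andP[_ /lker_keep]; apply; rewrite set11.
have dimU' : (\dim U' < \dim U)%N.
  rewrite ltn_neqAle dimvS ?capvSl // andbT; apply: contra uj => /eqP E.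
  have : (U' == U)%VS by rewrite eqEdim capvSl E leqnn.
  by move/eqP => UE; apply/eqP/U'j; rewrite UE.
pose y := x - (x 0 j / u 0 j) *: u.
have hy : V_eta A y.
  by apply: V_etaD hx _; rewrite rpredN rpredZ // (subvP UV).
have := IH U' (j |: Z) y (leq_trans dimU' le_m) hy (subv_trans (capvSl _ _) UV).
rewrite cardsU1 jZ => /(_ _ _)H; apply: leq_trans (H _ _).
- by rewrite /= -addnA addnCA leq_add2l add1n.
- move=> i; rewrite in_setU1 => /orP[/eqP->|iZ].
    by rewrite !mxE divfK // subrr.
  by rewrite !mxE (UZ u i uU iZ) (xZ i iZ) mulr0 subr0.
- move=> v i hv; rewrite in_setU1 => /orP[/eqP->|iZ]; first exact: U'j.
  by apply: UZ iZ; move: hv; rewrite memv_cap => /andP[].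
Qed.

Lemma vanish_eq0 (Z : {set 'I_n}) x v : V_eta A x -> (forall i, i \in Z -> x 0 i = 0) ->
  #|Z| = k -> v \in V -> (forall i, i \in Z -> v 0 i = 0) -> v = 0.
Proof.
move=> hx xZ Zk vV vZ; have := @zeros_dim_le <[v]>%VS Z x hx _ xZ _.
rewrite Zk dim_vline; case: eqP => // _ /= H.
have /negP[] : ~~ (k + 1 <= k)%N by rewrite addn1 ltnn.
apply: H; first by apply/subvP => _ /vlineP[c ->]; rewrite rpredZ.
by move=> _ i /vlineP[c ->] iZ; rewrite mxE vZ ?mulr0.
Qed.

(** The hyperplanes through a point are independent: by [zeros_dim_le] the
    directions inside all of them form a space of the expected dimension, so [V]
    surjects onto the coordinates vanishing at the point. *)
Lemma zeros_indep x (s : 'I_n -> R) : V_eta A x ->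
  exists v, v \in V /\ forall i, i \in zeros x -> v 0 i = s i.
Proof.
move=> hx; set Z := zeros x.
have xZ i : i \in Z -> x 0 i = 0 by rewrite inE => /eqP.
have imE : (keep Z @: V = coord_space Z)%VS.
  apply/eqP; rewrite eqEdim keep_img_sub /=; apply: leq_trans (dim_coord_space Z) _.
  rewrite -(leq_add2r (\dim (V :&: lker (keep Z)))) [leqRHS]addnC limg_ker_dim pa_dim.
  apply: (zeros_dim_le hx) => //; first exact: capvSl.
  by move=> u i; rewrite memv_cap => /andP[_ /lker_keep]; apply.
have : (\row_i (if i \in Z then s i else 0) : 'rV[R]_n) \in coord_space Z.
  by apply: mem_coord_space => i /negPf iZ; rewrite mxE iZ.
rewrite -imE => /memv_imgP[v vV E]; exists v; split=> // i iZ.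
by have := congr1 (fun w : 'rV[R]_n => w 0 i) E; rewrite keepE mxE iZ.
Qed.

(** If [xi] vanished on the directions inside the hyperplanes of [S], it would
    factor through the coordinates in [S] and have a lift supported on [S]. *)
Lemma xi_generic (S : {set 'I_n}) : (#|S| < k)%N ->
  exists v, [/\ v \in V, forall i, i \in S -> v 0 i = 0 & xi v != 0].
Proof.
move=> Sk; apply: contrapT => H.
have {}H v : v \in V -> (forall i, i \in S -> v 0 i = 0) -> xi v = 0.
  by move=> vV vS; apply: contrapT => /eqP h; apply: H; exists v.
pose F : 'Hom(subvs_of V, 'rV[R]_n) := linfun (keep S \o vsval).
have FE v : F v = keep S (vsval v) by rewrite lfunE.
pose h := (pa_xi A \o F^-1)%VF.
have hF v : pa_xi A v = h (F v).
  rewrite comp_lfunE; apply/eqP; rewrite -subr_eq0; set w := (_ (F v)).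
  have -> : pa_xi A v - pa_xi A w = xi (vsval (v - w)) by rewrite -xi_sub linearB.
  apply/eqP/H.
    exact: subvsP.
  apply/lker_keep; rewrite memv_ker -FE linearB /= limg_lfunVK ?subrr //.
  by rewrite memv_img // memvf.
pose y : 'rV[R]_n := \row_i (if i \in S then h (delta_mx 0 i) else 0).
have /(pa_xi_generic (y := y)) : forall v : subvs_of V, pa_xi A v = \sum_i y 0 i * vsval v 0 i.
  move=> v; rewrite hF {1}[F v]row_sum_delta linear_sum; apply: eq_bigr => i _.
  rewrite linearZ /= FE keepE mxE; case: ifP => _; last by rewrite scale0r mul0r.
  exact: mulrC.
rewrite leqNgt => /negP; apply; apply: leq_ltn_trans Sk; apply: subset_leq_card.
by apply/subsetP => i; rewrite inE mxE; case: ifP; rewrite ?eqxx.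
Qed.

End Genericity.

Lemma eventually_all (R : realType) (T : finType) (P : T -> R -> Prop) :
  (forall t, exists2 e, 0 < e & forall d, 0 < d <= e -> P t d) ->
  exists2 e, 0 < e & forall t d, 0 < d <= e -> P t d.
Proof.
move=> h; have {h}h t : exists e, 0 < e /\ forall d, 0 < d <= e -> P t d.
  by have [e e0 eP] := h t; exists e.
have [f fP] := choice h; exists (\big[Num.min/1]_t f t).
  by apply/bigmin_gtP; split=> // t _; have [] := fP t.
move=> t d /andP[d0 dle]; have [_] := fP t; apply; rewrite d0 /=.
by apply: le_trans dle _; apply: bigmin_le.
Qed.

Lemma small_perturbation (R : realType) (c d : R) : 0 < c ->
  exists2 e, 0 < e & forall t, 0 < t <= e -> 0 < c + t * d.
Proof.
move=> c0; have h0 : 0 < 1 + `|d| by rewrite ltr_pwDl.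
exists (c / (1 + `|d|)); first by rewrite divr_gt0.
move=> t /andP[t0]; rewrite ler_pdivlMr // => h.
have : - (t * `|d|) <= t * d by rewrite -mulrN ler_wpM2l ?(ltW t0) // lerNl ler_normr lexx orbT.
by move=> h1; nra.
Qed.

Section LinearProgramming.
Variables (R : realType) (n k : nat) (A : polarized R n k).
Local Notation V := (pa_V A).
Local Notation xi := (xi A).
Implicit Types (a b : svec n) (p q x y z u v : 'rV[R]_n).

Lemma sgv_neq0 (b : bool) : sgv R b != 0 :> R.
Proof. by case: b; rewrite ?oppr_eq0 oner_eq0. Qed.

Lemma sgvM (b : bool) : sgv R b * sgv R b = 1.
Proof. by case: b; rewrite /= ?mulrNN mulr1. Qed.

Lemma sgvN (b : bool) : sgv R (~~ b) = - sgv R b.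
Proof. by case: b; rewrite /= ?opprK. Qed.

Lemma sgv_eq0 (b : bool) (c : R) : (sgv R b * c == 0) = (c == 0).
Proof. by rewrite mulf_eq0 (negPf (sgv_neq0 b)). Qed.

Definition interior a y : Prop := V_eta A y /\ forall i, 0 < sgv R (a i) * y 0 i.

Lemma interior_feasible a y : interior a y -> a \in Fset A.
Proof.
move=> [hy h]; rewrite inE; apply/asboolP; exists y; split=> // i.
exact: ltW.
Qed.

(** The hyperplanes through [z] being independent, a small displacement gives the
    coordinates vanishing at [z] any prescribed signs and keeps the other signs. *)
Lemma interior_near a z : V_eta A z -> (forall i, z 0 i != 0 -> 0 < sgv R (a i) * z 0 i) ->
  exists y, interior a y.
Proof.
move=> hz h; have [v [vV vE]] := zeros_indep (fun i => sgv R (a i)) hz.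
have [|e e0 eP] := @eventually_all R 'I_n (fun i t => 0 < sgv R (a i) * (z 0 i + t * v 0 i)).
  move=> i; case: (eqVneq (z 0 i) 0) => [zi|zi].
    exists 1 => // t /andP[t0 _]; rewrite zi add0r vE ?inE ?zi //.
    by rewrite mulrCA sgvM mulr1.
  have [e e0 eP] := small_perturbation (sgv R (a i) * v 0 i) (h i zi).
  by exists e => // t /eP; rewrite mulrDr mulrCA.
exists (z + e *: v); split; first by apply: V_etaD => //; rewrite rpredZ.
by move=> i; rewrite !mxE; apply: eP; rewrite e0 lexx.
Qed.

Lemma feasible_interior a : a \in Fset A -> exists y, interior a y.
Proof.
rewrite inE => /asboolP[z [hz h]]; apply: (interior_near hz) => i zi.
by rewrite lt_neqAle h andbT eq_sym sgv_eq0.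
Qed.

(** The ratio test of the simplex method. *)
Lemma ratio_test a x v (T : {set 'I_n}) : (forall i, i \in T -> 0 <= sgv R (a i) * x 0 i) ->
  (exists2 i, i \in T & sgv R (a i) * v 0 i < 0) ->
  exists i t, [/\ i \in T, 0 <= t, sgv R (a i) * v 0 i < 0, x 0 i + t * v 0 i = 0
    & forall j, j \in T -> 0 <= sgv R (a j) * (x 0 j + t * v 0 j)].
Proof.
move=> xT [i0 i0T i0v].
pose Q j := (j \in T) && (sgv R (a j) * v 0 j < 0).
have Qi0 : Q i0 by rewrite /Q i0T.
pose r j := (sgv R (a j) * x 0 j) / - (sgv R (a j) * v 0 j).
case: (arg_minP (P := Q) r Qi0) => i /andP[iT iv] imin.
have dpos j : Q j -> 0 < - (sgv R (a j) * v 0 j) by move=> /andP[_]; rewrite oppr_gt0.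
have r0 : 0 <= r i by rewrite divr_ge0 ?xT // ltW // dpos // /Q iT.
exists i, (r i); split=> //.
  apply: (mulfI (sgv_neq0 (a i))); rewrite mulr0 mulrDr mulrCA /r.
  have : sgv R (a i) * v 0 i != 0 by rewrite lt_eqF.
  by move=> d0; rewrite invrN mulrN mulNr divfK // subrr.
move=> j jT; rewrite mulrDr mulrCA; have xj := xT j jT.
case: (ltP (sgv R (a j) * v 0 j) 0) => jv; last by rewrite addr_ge0 // mulr_ge0.
have Qj : Q j by rewrite /Q jT.
have := imin j Qj; rewrite {2}/r ler_pdivlMr ?dpos // mulrN => h.
by rewrite -lerBlDr sub0r.
Qed.

Lemma H_zeros (S : {set 'I_n}) p : S \in Bset A -> H_ A S p -> zeros p = S.
Proof.
rewrite inE => /andP[/eqP Sk _] [hp pS]; apply/esym/eqP; rewrite eqEcard Sk (zeros_le hp) andbT.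
by apply/subsetP => i iS; rewrite inE pS.
Qed.

Lemma zeros_Bset p : V_eta A p -> #|zeros p| = k -> zeros p \in Bset A.
Proof.
move=> hp pk; rewrite inE pk eqxx; apply/asboolP; exists p; split=> // i.
by rewrite inE => /eqP.
Qed.

Lemma H_unique (S : {set 'I_n}) p q : S \in Bset A -> H_ A S p -> H_ A S q -> p = q.
Proof.
rewrite inE => /andP[/eqP Sk _] [hp pS] [hq qS]; apply/eqP; rewrite -subr_eq0; apply/eqP.
apply: (vanish_eq0 hp pS) => //; first by apply/(V_etaB _ hq).
by move=> i iS; rewrite !mxE pS // qS // subrr.
Qed.

Lemma xi_diffE p q : xi_diff A p q = xi (p - q). Proof. by []. Qed.

Lemma Delta_step a p v : Delta_ A a p -> v \in V ->
  (forall i, i \in zeros p -> 0 <= sgv R (a i) * v 0 i) ->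
  exists2 t, 0 < t & Delta_ A a (p + t *: v).
Proof.
move=> [hp pa] vV vs.
have [|e e0 eP] := @eventually_all R 'I_n (fun i t => 0 <= sgv R (a i) * (p 0 i + t * v 0 i)).
  move=> i; case: (boolP (i \in zeros p)) => [iz|].
    exists 1 => // t /andP[t0 _]; have /eqP -> : p 0 i == 0 by rewrite inE in iz.
    by rewrite add0r mulrCA mulr_ge0 ?vs // ltW.
  rewrite inE => pi; have c0 : 0 < sgv R (a i) * p 0 i by rewrite lt_neqAle pa andbT eq_sym sgv_eq0.
  have [e e0 eP] := small_perturbation (sgv R (a i) * v 0 i) c0.
  by exists e => // t /eP/ltW; rewrite mulrDr mulrCA.
exists e => //; split; first by apply: V_etaD => //; rewrite rpredZ.
by move=> i; rewrite !mxE; apply: eP; rewrite e0 lexx.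
Qed.

(** While fewer than [k] coordinates vanish, [xi] can be increased inside a
    bounded chamber until a further coordinate vanishes. *)
Lemma climb_to_vertex a x : bounded A a -> Delta_ A a x ->
  exists y, [/\ Delta_ A a y, #|zeros y| = k & xi x <= xi y].
Proof.
move=> [M hM]; have [m le_m] := ubnP (k - #|zeros x|); elim: m => // m IH in x le_m *.
move=> xa; have [hx xs] := xa.
case: (ltnP #|zeros x| k) => [zk|zk]; last first.
  by exists x; split=> //; apply/eqP; rewrite eqn_leq zk (zeros_le hx).
have [v [vV vz xv]] : exists v, [/\ v \in V, forall i, i \in zeros x -> v 0 i = 0 & 0 < xi v].
  have [v [vV vz xv]] := xi_generic A zk.
  case: (ltgtP (xi v) 0) => h; [|by exists v|by rewrite h eqxx in xv].
  exists (- v); split; rewrite ?rpredN ?xiN ?oppr_gt0 // => i /vz.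
  by rewrite mxE => ->; rewrite oppr0.
have [|i [t [_ t0 iv it tP]]] := @ratio_test a x v setT (fun i _ => xs i).
  apply: contrapT => H.
  have vs i : 0 <= sgv R (a i) * v 0 i.
    by rewrite leNgt; apply/negP => h; apply: H; exists i; rewrite ?inE.
  have M0 : 0 <= M.
    have := hM 0; rewrite linear0; apply=> i.
    by rewrite linear0 mxE mulr0.
  pose w := vsproj V v; have wE : vsval w = v by rewrite vsprojK.
  have := hM (((M + 1) / xi v) *: w); rewrite linearZ /= xi_sub wE.
  have : ((M + 1) / xi v : R^o) *: (xi v : R^o) = M + 1 by rewrite [LHS]divfK // gt_eqF.
  move=> -> /(_ _)H'; have : M + 1 <= M.
    apply: H' => j; rewrite linearZ /= wE mxE mulrCA mulr_ge0 // divr_ge0 ?ltW //.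
    by rewrite ltr_wpDl.
  by rewrite gerDl ler10.
pose y := x + t *: v.
have ya : Delta_ A a y.
  by split; [apply: V_etaD => //; rewrite rpredZ|move=> j; rewrite !mxE tP ?inE].
have zxy : zeros x \proper zeros y.
  apply/properP; split.
    apply/subsetP => j jz; rewrite inE !mxE vz // mulr0 addr0.
    by rewrite inE in jz.
  exists i; first by rewrite inE !mxE it.
  by apply/negP => /vz vi; move: iv; rewrite vi mulr0 ltxx.
have [|z [za zk' xz]] := IH y _ ya.
  have := proper_card zxy; have := zeros_le hx; move: le_m zk; clear.
  by set c := #|_|; set d := #|_|; lia.
exists z; split=> //; apply: le_trans xz.
by rewrite /y xiD xiZ lerDl mulr_ge0 // ltW.
Qed.

Definition is_vertex a (S : {set 'I_n}) p : Prop :=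
  [/\ S \in Bset A, H_ A S p, zeros p = S, Delta_ A a p & forall y, Delta_ A a y -> xi y <= xi p].

(** Climbing reduces the maximization of [xi] to the finitely many vertices of
    the chamber. *)
Lemma vertex_exists a : a \in Pset A -> exists S p, is_vertex a S p.
Proof.
rewrite inE => /andP[aF /asboolP ab].
have [x xa] : feasible A a by move: aF; rewrite inE => /asboolP.
pose Q (S : {set 'I_n}) := `[< exists p, Delta_ A a p /\ zeros p = S >] && (#|S| == k).
pose f S := if pselect (exists p, Delta_ A a p /\ zeros p = S) is left h
  then projT1 (cid h) else 0.
have fP S : Q S -> Delta_ A a (f S) /\ zeros (f S) = S.
  move=> /andP[/asboolP h _]; rewrite /f; case: pselect => // h'.
  exact: projT2 (cid h').
have [y [ya yk _]] := climb_to_vertex ab xa.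
have Q0 : Q (zeros y) by rewrite /Q yk eqxx andbT; apply/asboolP; exists y.
case: (arg_maxP (P := Q) (xi \o f) Q0) => S QS Smax.
have [pa pS] := fP S QS; have Sk : #|zeros (f S)| = k.
  by rewrite pS; move/andP: QS => [_ /eqP].
have SB : S \in Bset A by rewrite -pS zeros_Bset //; case: pa.
exists S, (f S); split=> //.
  by split; [case: pa|move=> i; rewrite -{1}pS inE => /eqP].
move=> z za; have [w [wa wk zw]] := climb_to_vertex ab za.
have Qw : Q (zeros w) by rewrite /Q wk eqxx andbT; apply/asboolP; exists w.
apply: le_trans zw _; apply: le_trans (Smax _ Qw).
have [fa fz] := fP _ Qw; have wB := zeros_Bset (proj1 wa) wk.
suff E : w = f (zeros w) by rewrite /= -E.
apply: (H_unique wB).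
  by split; [case: wa|move=> i; rewrite inE => /eqP].
by split; [case: fa|move=> i; rewrite -{1}fz inE => /eqP].
Qed.

Lemma basis_of_vertex a : a \in Pset A -> exists p, is_vertex a (Defs.basis_of A a) p.
Proof.
move=> aP; rewrite /Defs.basis_of; case: pickP => [S /asboolP[SB _ [p [Hp [pa pmax]]]]|h].
  exists p; split=> //=; first exact: H_zeros.
  by move=> y /pmax; rewrite xi_diffE xiB subr_le0.
have [S [p [SB Hp zp pa pmax]]] := vertex_exists aP.
have /negP[] := negbT (h S); apply/asboolP; split=> //; exists p; split=> //.
by split=> // y /pmax; rewrite xi_diffE xiB subr_le0.
Qed.

(** Optimality is local: [xi] does not increase along the cone at the vertex. *)
Lemma vertex_cone a S p v : is_vertex a S p -> v \in V ->
  (forall i, i \in S -> 0 <= sgv R (a i) * v 0 i) -> xi v <= 0.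
Proof.
move=> [SB Hp zp pa pmax] vV vs.
have [|t t0 ta] := Delta_step pa vV; first by rewrite zp.
by have := pmax _ ta; rewrite xiD xiZ gerDl pmulr_rle0.
Qed.

(** The edge at a vertex along which the [i]-th hyperplane is left.  A direction is
    determined by its coordinates in [S], so this edge is, up to a factor, the
    direction on which [xi] is nonzero by genericity. *)
Lemma edge_direction S p i (s : R) : S \in Bset A -> H_ A S p -> i \in S -> s != 0 ->
  exists v, [/\ v \in V, v 0 i = s, forall j, j \in S -> j != i -> v 0 j = 0 & xi v != 0].
Proof.
move=> SB Hp iS s0; have zp := H_zeros SB Hp; have [hp pS] := Hp.
have Sk : #|S| = k by move: SB; rewrite inE => /andP[/eqP].
have [v [vV vE]] := zeros_indep (fun j => if j == i then s else 0) hp.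
rewrite zp in vE; exists v; split=> //; [by rewrite vE ?eqxx|by move=> j jS /negPf ji; rewrite vE ?ji|].
have [|w [wV wS xw]] := @xi_generic R n k A (S :\ i).
  by rewrite -Sk [ltnRHS](cardsD1 i) iS.
have wv : w - (w 0 i / s) *: v = 0.
  apply: (vanish_eq0 hp pS Sk); first by rewrite rpredB // rpredZ.
  move=> j jS; rewrite !mxE vE //; case: (eqVneq j i) => [->|ji]; first by rewrite divfK ?subrr.
  by rewrite mulr0 subr0 wS // !inE ji.
apply: contra_neq xw => xv.
by rewrite -[w](subrK ((w 0 i / s) *: v)) wv add0r xiZ xv mulr0.
Qed.

Definition agree (S : {set 'I_n}) a b : Prop := forall i, i \in S -> a i = b i.

Section Chamber.
Variables (a : svec n) (S : {set 'I_n}) (p : 'rV[R]_n).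
Hypothesis vp : is_vertex a S p.

Lemma agree_bounded b : agree S b a -> bounded A b.
Proof.
move=> h; exists 0 => v vs; rewrite xi_sub; apply: (vertex_cone vp (subvsP v)) => i iS.
by rewrite -h.
Qed.

(** The simplex method: from a vertex in the cone with apex [p], pivots that
    increase [xi] bring in one hyperplane through [p] after the other. *)
Lemma pivot_chain T q : T \in Bset A -> H_ A T q ->
  (forall i, i \in S -> 0 <= sgv R (a i) * q 0 i) -> Ble A T S.
Proof.
have [m le_m] := ubnP #|T :\: S|; elim: m => // m IH in T q le_m *.
have [SB Hp zp pa pmax] := vp.
have Sk : #|S| = k by move: (SB); rewrite inE => /andP[/eqP].
move=> TB Hq qS; have zq := H_zeros TB Hq.
have Tk : #|T| = k by move: (TB); rewrite inE => /andP[/eqP].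
case: (set_0Vmem (T :\: S)) => [TS|[j]].
  have -> : T = S; last exact: rt_refl.
  by apply/eqP; rewrite eqEcard Sk Tk leqnn andbT -setD_eq0 TS.
rewrite inE => /andP[jS jT].
have [v [vV vj vT xv]] : exists v, [/\ v \in V, v 0 j != 0,
    forall i, i \in T -> i != j -> v 0 i = 0 & 0 < xi v].
  have [v [vV vj vT xv]] := edge_direction TB Hq jT (oner_neq0 R).
  case: (ltgtP (xi v) 0) => h; [|by exists v; rewrite vj oner_eq0|by rewrite h eqxx in xv].
  exists (- v); split; rewrite ?rpredN ?xiN ?oppr_gt0 //; first by rewrite mxE vj oppr_eq0 oner_eq0.
  by move=> i iT ij; rewrite mxE vT ?oppr0.
have [|i [t [iS t0 iv it tP]]] := ratio_test qS (v := v).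
  apply: contrapT => H; move: xv; rewrite ltNge => /negP; apply.
  apply: (vertex_cone vp vV) => i iS; rewrite leNgt; apply/negP => h.
  by apply: H; exists i.
have vi : v 0 i != 0 by apply: contraTneq iv => ->; rewrite mulr0 ltxx.
have iT : i \notin T.
  by apply: contra vi => iT; rewrite vT //; apply: contraNneq jS => <-.
have tpos : 0 < t.
  rewrite lt_neqAle t0 andbT; apply: contra iT => /eqP tE.
  by rewrite -zq inE; move: it; rewrite -tE mul0r addr0 => ->.
pose T' := i |: (T :\ j); pose q' := q + t *: v.
have T'k : #|T'| = k.
  by rewrite cardsU1 !inE (negPf iT) andbF -Tk [RHS](cardsD1 j) jT.
have hq' : V_eta A q' by apply: V_etaD; rewrite ?rpredZ //; case: Hq.
have Hq' : H_ A T' q'.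
  split=> // l; rewrite !inE => /orP[/eqP ->|/andP[lj lT]]; rewrite !mxE //.
  by rewrite vT // mulr0 addr0; case: Hq => _; apply.
have T'B : T' \in Bset A by rewrite inE T'k eqxx; apply/asboolP; exists q'.
apply: (rt_trans _ _ _ T'); last first.
  apply: (IH T' q') => //; last by move=> l lS; rewrite !mxE tP.
  rewrite -ltnS; apply: leq_trans le_m; rewrite ltnS [leqRHS](cardsD1 j) !inE jS jT add1n.
  rewrite ltnS; apply: subset_leq_card; apply/subsetP => l; rewrite !inE => /andP[lS].
  by case/orP=> [/eqP li|/andP[-> ->]]; [rewrite li iS in lS|rewrite lS].
apply: rt_step; split=> //.
  have -> : T :&: T' = T :\ j.
    apply/setP => l; rewrite !inE; case: (eqVneq l i) => [->|_] /=.
      by rewrite (negPf iT) andbF.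
    by rewrite andbCA andbb.
  by rewrite -Tk [RHS](cardsD1 j) jT.
by exists q, q'; split=> //; rewrite xi_diffE /q' addrC addKr xiZ mulr_gt0.
Qed.

End Chamber.

(** The chambers in the cone at the optimum of [a] are bounded and below [a]: their
    own optima lie in that cone, from where pivoting leads back to its apex. *)
Lemma agree_Pset a b : a \in Pset A -> b \in Fset A -> agree (Defs.basis_of A a) b a ->
  b \in Pset A /\ Ble A (Defs.basis_of A b) (Defs.basis_of A a).
Proof.
move=> aP bF h; have [p vp] := basis_of_vertex aP.
have bP : b \in Pset A by rewrite inE bF; apply/asboolP; exact: (agree_bounded vp h).
split=> //; have [q [TB Hq zq qb qmax]] := basis_of_vertex bP.
apply: (pivot_chain vp TB Hq) => i iS; rewrite -h //.
by have [_] := qb; apply.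
Qed.

Lemma flip_same a i : flip i a i = ~~ a i. Proof. by rewrite ffunE eqxx. Qed.
Lemma flip_other a i j : j != i -> flip i a j = a j. Proof. by rewrite ffunE => /negPf ->. Qed.

Lemma flip_feasible a i : a \in Pset A -> i \in Defs.basis_of A a -> flip i a \in Fset A.
Proof.
move=> aP iS; have [p [SB Hp zp pa pmax]] := basis_of_vertex aP.
have [hp ps] := pa.
have [|y /interior_feasible//] := @interior_near (flip i a) p hp.
move=> j pj; rewrite flip_other; first by rewrite lt_neqAle ps andbT eq_sym sgv_eq0.
by apply: contra_neq pj => ->; case: Hp => _; apply.
Qed.

(** The value of [xi] at [H_S], up to a constant depending on the arrangement only. *)
Definition height (S : {set 'I_n}) : R :=
  if pselect (exists p, H_ A S p) is left h then xi (projT1 (cid h)) else 0.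

Lemma heightE S p : S \in Bset A -> H_ A S p -> height S = xi p.
Proof.
move=> SB Hp; rewrite /height; case: pselect => [h|[]]; last by exists p.
by congr xi; apply: H_unique SB _ Hp; exact: projT2 (cid h).
Qed.

(** The edge that leaves the [i]-th hyperplane into the new chamber increases [xi],
    since the opposite edge lies in the cone of [a]. *)
Lemma flip_height a i : a \in Pset A -> i \in Defs.basis_of A a -> flip i a \in Pset A ->
  height (Defs.basis_of A a) < height (Defs.basis_of A (flip i a)).
Proof.
move=> aP iS a'P; have [p vp] := basis_of_vertex aP; have [SB Hp zp pa pmax] := vp.
have [p' [SB' Hp' zp' pa' pmax']] := basis_of_vertex a'P.
rewrite (heightE SB Hp) (heightE SB' Hp').
have s0 : sgv R (~~ a i) != 0 by apply: sgv_neq0.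
have [v [vV vi vS xv]] := edge_direction SB Hp iS s0.
have xvpos : 0 < xi v.
  rewrite lt_neqAle eq_sym xv /= -oppr_le0 -xiN; apply: (vertex_cone vp); first by rewrite rpredN.
  move=> j jS; rewrite mxE; case: (eqVneq j i) => [->|ji].
    by rewrite vi sgvN opprK sgvM ler01.
  by rewrite vS // oppr0 mulr0.
have [hp ps] := pa.
have p'a : Delta_ A (flip i a) p.
  split=> // j; case: (eqVneq j i) => [->|ji]; last by rewrite flip_other.
  by case: Hp => _ -> //; rewrite mulr0.
have [|t t0 ta] := Delta_step p'a vV.
  move=> j; rewrite zp => jS; case: (eqVneq j i) => [->|ji].
    by rewrite vi flip_same sgvM ler01.
  by rewrite vS // mulr0.
by apply: lt_le_trans (pmax' _ ta); rewrite xiD xiZ ltrDl mulr_gt0.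
Qed.

Lemma Ble_height S T : Ble A S T -> S = T \/ height S < height T.
Proof.
elim=> [X Y [XB YB _ [p [q [Hp Hq]]]]|X|X Y Z _ [->|h1] _ [<-|h2]]; try by [left|right].
  by rewrite xi_diffE xiB subr_gt0 -(heightE XB Hp) -(heightE YB Hq); right.
by right; apply: lt_trans h2.
Qed.

(** Two chambers with the same optimum that differ at a hyperplane through it
    contain opposite edges there, and [xi] would decrease along both. *)
Lemma basis_of_inj a b : a \in Pset A -> b \in Pset A -> Defs.basis_of A a = Defs.basis_of A b -> a = b.
Proof.
move=> aP bP E; have [p vp] := basis_of_vertex aP; have [q vq] := basis_of_vertex bP.
have [SB Hp zp [hp ps] _] := vp; have [_ Hq _ [hq qs] _] := vq; rewrite -E in Hq vq.
have pq : p = q by apply: H_unique Hp Hq.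
apply/ffunP => i; apply/eqP/negPn/negP => ab.
have bE : sgv R (b i) = - sgv R (a i) by move: ab; case: (a i) (b i) => [] [] //=; rewrite opprK.
case: (boolP (i \in Defs.basis_of A a)) => [iS|iS]; last first.
  have := qs i; rewrite bE -pq mulNr oppr_ge0 leNgt lt_neqAle ps andbT eq_sym sgv_eq0.
  by move: iS; rewrite -zp inE => ->.
have [v [vV vi vS xv]] := edge_direction SB Hp iS (sgv_neq0 (a i)).
have h1 : xi v <= 0.
  apply: (vertex_cone vp vV) => j jS; case: (eqVneq j i) => [->|ji].
    by rewrite vi sgvM ler01.
  by rewrite vS // mulr0.
have h2 : xi (- v) <= 0.
  apply: (vertex_cone vq); first by rewrite rpredN.
  move=> j jS; rewrite mxE; case: (eqVneq j i) => [->|ji].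
    by rewrite vi bE mulrNN sgvM ler01.
  by rewrite vS // oppr0 mulr0.
by move: xv; rewrite eq_le h1 -oppr_le0 -xiN h2.
Qed.

End LinearProgramming.

(** * Walls separating two chambers *)

Section LowerEnvelope.
Variables (R : realFieldType) (T : finType) (D : {set T}) (v : T -> R) (U : Type) (X : T -> U).

Definition minimizes (w : T -> R) i : Prop := i \in D /\ forall j, j \in D -> w i <= w j.
Definition mix (s : R) (u : T -> R) l := (1 - s) * u l + s * v l.

(** Moving along a segment, the lower envelope of finitely many affine functions
    passes from one of them to the next at a point where both attain the minimum. *)
Lemma envelope_connected (u : T -> R) i j :
  (forall s, 0 <= s <= 1 -> forall i j, minimizes (mix s u) i -> minimizes (mix s u) j -> X i = X j) ->
  minimizes u i -> minimizes v j -> X i = X j.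
Proof.
have [m le_m] := ubnP #|[set l in D | v l < v i]|; elim: m => // m IH in u i le_m *.
move=> H [iD imin] [jD jmin].
pose Q l := (l \in D) && (v l < v i).
case: (pickP Q) => [l0 Ql0|noQ]; last first.
  have imin1 l : l \in D -> v i <= v l by move=> lD; rewrite leNgt; have := noQ l; rewrite /Q lD /= => ->.
  by apply: (H 1); rewrite ?ler01 ?lexx //; split=> // l lD; rewrite /mix subrr !mul0r !add0r !mul1r;
    [apply: imin1|apply: jmin].
pose den l := (u l - u i) + (v i - v l).
have den0 l : Q l -> 0 < den l.
  by move=> /andP[lD vl]; rewrite ltr_wpDl ?subr_ge0 ?subr_gt0 // imin.
pose r l := (u l - u i) / den l.
case: (arg_minP (P := Q) r Ql0) => l Ql lmin; have /andP[lD vl] := Ql.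
set s := r l in lmin.
have s0 : 0 <= s by rewrite divr_ge0 ?subr_ge0 ?imin // ltW // den0.
have s1 : s <= 1 by rewrite ler_pdivrMr ?den0 // mul1r lerDl subr_ge0 ltW.
have sE : s * den l = u l - u i by rewrite divfK // gt_eqF // den0.
have il : mix s u i = mix s u l by move: sE; rewrite /den /mix; lra.
have i_min : minimizes (mix s u) i.
  split=> // l' l'D; rewrite /mix; case: (leP (v i) (v l')) => h.
    have := imin l' l'D; nra.
  have Ql' : Q l' by rewrite /Q l'D.
  have : s * den l' <= u l' - u i by rewrite -ler_pdivlMr ?den0 //; apply: lmin.
  rewrite /den; lra.
have l_min : minimizes (mix s u) l.
  by split=> // l' l'D; rewrite -il; case: i_min => _; apply.
rewrite (H s _ i l) ?s0 ?s1 //; apply: (IH (mix s u)) => //; last first.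
  move=> s' /andP[s'0 s'1] i' j'.
  have E t : mix s' (mix s u) t = mix (1 - (1 - s') * (1 - s)) u t by rewrite /mix; ring.
  have tr t : minimizes (mix s' (mix s u)) t -> minimizes (mix (1 - (1 - s') * (1 - s)) u) t.
    by move=> [tD tm]; split=> // t' /tm; rewrite !E.
  by move=> /tr h1 /tr h2; apply: H h1 h2; apply/andP; split; nra.
rewrite -ltnS; apply: leq_trans le_m; rewrite ltnS; apply: proper_card; apply/properP; split.
  by apply/subsetP => t; rewrite !inE => /andP[-> /lt_trans]; apply.
by exists l; rewrite !inE ?lD ?ltxx ?andbF.
Qed.
End LowerEnvelope.

Section Walls.
Variables (R : realType) (n k : nat) (A : polarized R n k).
Local Notation F := (Fset A).
Implicit Types (g a : svec n) (x y z : 'rV[R]_n).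

Section Visible.
Variables (g a : svec n) (x : 'rV[R]_n).
Hypothesis xa : interior A a x.

Let D := [set i | g i != a i].
Let s i := sgv R (g i).

Let xD i : i \in D -> 0 < - (s i * x 0 i).
Proof.
rewrite inE => ga; have [_ /(_ i)] := xa; rewrite -mulNr /s.
by move: ga; case: (g i) (a i) => [] [] //=; rewrite ?opprK.
Qed.

Let xN i : i \notin D -> 0 < s i * x 0 i.
Proof. by rewrite inE negbK /s => /eqP ->; have [] := xa. Qed.

(** The ratio in which the [i]-th hyperplane divides the segment from [y] to [x]; unlike
    the parameter of the crossing point, it is affine in [y]. *)
Definition crossing y i : R := (s i * y 0 i) / - (s i * x 0 i).

(** The last point of the chamber [g] on the segment from [y] to [x]: all the
    hyperplanes that are crossed first pass through it. *)
Lemma crossing_point y i : interior A g y -> minimizes D (crossing y) i ->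
  exists z, [/\ V_eta A z, forall l, 0 <= s l * z 0 l
    & forall l, l \in D -> crossing y l = crossing y i -> z 0 l = 0].
Proof.
move=> [hy yg] [iD imin]; set c := crossing y i in imin *.
have c0 : 0 <= c by apply: divr_ge0; [apply/ltW/yg|apply/ltW/xD].
have c1 : 0 < 1 + c by rewrite ltr_pwDl.
pose z := y + (c / (1 + c)) *: (x - y).
have zE l : z 0 l = (y 0 l + c * x 0 l) / (1 + c).
  by rewrite !mxE; field; rewrite gt_eqF.
have zD l : l \in D -> s l * z 0 l = - (s l * x 0 l) * (crossing y l - c) / (1 + c).
  move=> lD; rewrite zE mulrBr [_ * crossing y l]mulrC divfK ?gt_eqF ?xD //.
  by rewrite mulrA; congr (_ / _); ring.
exists z; split.
- by apply: V_etaD => //; rewrite rpredZ //; apply/(V_etaB _ hy); case: xa.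
- move=> l; case: (boolP (l \in D)) => lD.
    rewrite zD // divr_ge0 ?(ltW c1) // mulr_ge0 ?(ltW (xD lD)) // subr_ge0; exact: imin.
  rewrite zE mulrA divr_ge0 ?(ltW c1) // mulrDr addr_ge0 ?(ltW (yg l)) //.
  by rewrite mulrCA mulr_ge0 // ltW // xN.
- move=> l lD lE; apply/eqP; rewrite -(sgv_eq0 (g l)) -/(s l) zD // lE subrr.
  by rewrite mulr0 mul0r.
Qed.

Lemma first_wall y i : interior A g y -> minimizes D (crossing y) i -> flip i g \in F.
Proof.
move=> yg im; have [z [hz zg zD]] := crossing_point yg im; have [iD _] := im.
have [|w /interior_feasible//] := @interior_near R n k A (flip i g) z hz.
move=> l zl; rewrite flip_other; last by apply: contra_neq zl => ->; apply: zD.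
by rewrite lt_neqAle zg andbT eq_sym sgv_eq0.
Qed.

Lemma first_walls y i j : interior A g y -> minimizes D (crossing y) i ->
  minimizes D (crossing y) j -> flip j (flip i g) \in F.
Proof.
move=> yg im jm; have [z [hz zg zD]] := crossing_point yg im.
have [iD imin] := im; have [jD jmin] := jm.
have ij : crossing y j = crossing y i by apply/eqP; rewrite eq_le jmin ?imin.
have [|w /interior_feasible//] := @interior_near R n k A (flip j (flip i g)) z hz.
move=> l zl; rewrite !flip_other; first by rewrite lt_neqAle zg andbT eq_sym sgv_eq0.
  by apply: contra_neq zl => ->; apply: zD.
by apply: contra_neq zl => ->; apply: zD.
Qed.

(** A wall of the chamber [g] that separates it from [x] is the first one on the
    way from some point of [g] to [x]: step back from a point of the wall, away
    from [x]. *)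
Lemma wall_visible i : g \in F -> g i != a i -> flip i g \in F ->
  exists2 y, interior A g y & minimizes D (crossing y) i.
Proof.
move=> gF gai fF; have [y1 [h1 g1]] := feasible_interior gF.
have [y2 [h2 g2]] := feasible_interior fF.
have iD : i \in D by rewrite inE.
have y1i := g1 i; have := g2 i; rewrite flip_same sgvN mulNr oppr_gt0 -/(s i) => y2i.
(* The segment between the chambers on both sides of the wall meets it at [z]. *)
pose t := (s i * y1 0 i) / (s i * y1 0 i - s i * y2 0 i).
have d0 : 0 < s i * y1 0 i - s i * y2 0 i by rewrite subr_gt0; exact: lt_trans y1i.
have t0 : 0 < t by rewrite divr_gt0.
have t1 : t < 1 by rewrite ltr_pdivrMr // mul1r ltrBrDl gtrDr.
pose z := y1 + t *: (y2 - y1).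
have hz : V_eta A z by apply: V_etaD => //; rewrite rpredZ //; apply/(V_etaB _ h1).
have zE l : s l * z 0 l = (1 - t) * (s l * y1 0 l) + t * (s l * y2 0 l) by rewrite !mxE; ring.
have zi : z 0 i = 0.
  apply/eqP; rewrite -(sgv_eq0 (g i)) -/(s i) zE; apply/eqP.
  by rewrite /t; field; rewrite gt_eqF.
have zl l : l != i -> 0 < s l * z 0 l.
  move=> li; rewrite zE; have := g2 l; rewrite flip_other // -/(s l) => y2l.
  by have := g1 l; rewrite -/(s l) => y1l; nra.
have [|e e0 eP] := @eventually_all R 'I_n (fun l e => l \notin D -> 0 < s l * z 0 l + e * (s l * z 0 l - s l * x 0 l)).
  move=> l; case: (boolP (l \in D)) => lD; first by exists 1.
  have li : l != i by apply: contraNneq lD => ->.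
  have [e e0 eP] := small_perturbation (s l * z 0 l - s l * x 0 l) (zl l li).
  by exists e => // e' /eP.
pose y := z + e *: (z - x).
have yE l : s l * y 0 l = s l * z 0 l + e * (s l * z 0 l - s l * x 0 l) by rewrite !mxE; ring.
have z0 l : 0 <= s l * z 0 l.
  by case: (eqVneq l i) => [->|/zl/ltW//]; rewrite zi mulr0.
have yg : interior A g y.
  split.
    apply: V_etaD => //; rewrite rpredZ //; apply/(V_etaB _ _); last exact: hz.
    by case: xa.
  move=> l; rewrite -/(s l) yE; case: (boolP (l \in D)) => lD.
    by have := xD lD; have := z0 l; nra.
  by apply: eP => //; rewrite e0 lexx.
exists y => //; split=> // l lD.
have cE t' : t' \in D -> crossing y t' = (1 + e) * (s t' * z 0 t') / - (s t' * x 0 t') + e.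
  move=> tD; rewrite /crossing yE; have := xD tD; set b := s t' * x 0 t' => b0.
  by field; rewrite -oppr_eq0 gt_eqF.
rewrite !cE // zi !mulr0 mul0r add0r lerDr divr_ge0 ?(ltW (xD lD)) //.
by rewrite mulr_ge0 // addr_ge0 // ltW.
Qed.

Lemma interior_convex y1 y2 t : interior A g y1 -> interior A g y2 -> 0 <= t <= 1 ->
  interior A g (y1 + t *: (y2 - y1)).
Proof.
move=> [h1 g1] [h2 g2] /andP[t0 t1]; split.
  by apply: V_etaD => //; rewrite rpredZ //; apply/(V_etaB _ h1).
move=> l; have := g1 l; have := g2 l; rewrite !mxE.
set c := sgv R (g l); set u := y1 0 l; set w := y2 0 l => h3 h4.
have -> : c * (u + t * (w - u)) = (1 - t) * (c * u) + t * (c * w) by ring.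
case: (eqVneq t 0) => [->|tn]; first by rewrite mul0r addr0 subr0 mul1r.
by apply: ltr_wpDl; [rewrite mulr_ge0 ?subr_ge0 // ltW|rewrite mulr_gt0 // lt_neqAle eq_sym tn].
Qed.

Lemma crossing_mix y1 y2 t l : crossing (y1 + t *: (y2 - y1)) l = mix (crossing y2) t (crossing y1) l.
Proof. by rewrite /crossing /mix !mxE; ring. Qed.

End Visible.

(** The walls of [g] that separate it from [a] are connected through codimension
    two faces of [g].  Each wall is the first one on the way from some point of [g]
    to a fixed point of [a]; as the starting point moves along a segment, the ratios
    [crossing] are affine, so the first wall changes only where two of them are met
    simultaneously. *)
Theorem walls_connected (U : Type) (X : 'I_n -> U) g a i j : g \in F -> a \in F ->
  (forall i j, g i != a i -> flip i g \in F -> g j != a j -> flip j g \in F ->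
     i != j -> flip j (flip i g) \in F -> X i = X j) ->
  g i != a i -> flip i g \in F -> g j != a j -> flip j g \in F -> X i = X j.
Proof.
move=> gF aF HX gi fi gj fj; have [x xa] := feasible_interior aF.
have [y1 y1g im] := wall_visible xa gF gi fi.
have [y2 y2g jm] := wall_visible xa gF gj fj.
apply: (envelope_connected _ im jm) => t t01 i' j' im' jm'.
have yg := interior_convex y1g y2g t01.
have tr l : minimizes [set i0 | g i0 != a i0] (mix (crossing g x y2) t (crossing g x y1)) l ->
    minimizes [set i0 | g i0 != a i0] (crossing g x (y1 + t *: (y2 - y1))) l.
  by move=> [lD lm]; split=> // l' l'D; rewrite !crossing_mix; apply: lm.
move: im' jm' => /tr im' /tr jm'; case: (eqVneq i' j') => [-> //|ij].
have [] := im'; have [] := jm'; rewrite !inE => gj' _ gi' _.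
apply: HX => //; [exact: first_wall im'|exact: first_wall jm'|exact: first_walls jm'].
Qed.

Lemma wall_exists g a : g \in F -> a \in F -> g != a -> exists2 i, g i != a i & flip i g \in F.
Proof.
move=> gF aF ga; have [x xa] := feasible_interior aF.
have [y yg] := feasible_interior gF.
have [i0 gi0] : exists i, g i != a i.
  apply/existsP; apply: contraNT ga; rewrite negb_exists => /forallP h.
  by apply/eqP/ffunP => i; apply/eqP; rewrite -[_ == _]negbK.
case: (arg_minP (P := fun i => g i != a i) (crossing g x y) gi0) => i gi imin.
exists i => //; apply: (first_wall xa yg); split; first by rewrite inE.
by move=> j; rewrite inE => /imin.
Qed.

End Walls.

(** * Crossings of walks and coefficients of paths *)

Section Walks.
Variable n : nat.
Implicit Types (g b a : svec n) (w u : 'X_{1..n}).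

Definition dvec g a : 'X_{1..n} := [multinom (g i != a i : nat) | i < n].

Lemma dvecE g a i : dvec g a i = (g i != a i) :> nat. Proof. exact: mnmE. Qed.

Lemma dvecxx g : dvec g g = 0%MM.
Proof. by apply/mnmP => i; rewrite dvecE mnm0E eqxx. Qed.

Lemma dvecC g a : dvec g a = dvec a g.
Proof. by apply/mnmP => i; rewrite !dvecE eq_sym. Qed.

Lemma dvec_tri g b a i : (dvec g a i <= dvec g b i + dvec b a i)%N.
Proof. by rewrite !dvecE; case: (g i) (b i) (a i) => [] [] []. Qed.

(** The exponents [w] that can count the crossings of a walk from [g] to [a]. *)
Definition parity g a w : bool := [forall i, odd (w i) == (g i != a i)].

Lemma parityP g a w : reflect (forall i, odd (w i) = (g i != a i)) (parity g a w).
Proof. by apply: (iffP forallP) => h i; apply/eqP; exact: h. Qed.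

Lemma parity_dvec g a : parity g a (dvec g a).
Proof. by apply/parityP => i; rewrite dvecE; case: (g i != a i). Qed.

Lemma parity_ge g a w : parity g a w -> (dvec g a <= w)%MM.
Proof.
move/parityP => h; apply/mnm_lepP => i; rewrite dvecE -h.
by case: (w i) => //= m; case: (~~ _).
Qed.

Lemma parityD g b a w u : parity g b w -> parity b a u -> parity g a (w + u)%MM.
Proof.
move=> /parityP h1 /parityP h2; apply/parityP => i; rewrite mnmDE oddD h1 h2.
by case: (g i) (b i) (a i) => [] [] [].
Qed.

Lemma parity2 g u : parity g g (u + u)%MM.
Proof. by apply/parityP => i; rewrite mnmDE addnn odd_double eqxx. Qed.

Lemma parity_half g a w : parity g a w -> exists u, w = (dvec g a + (u + u))%MM.
Proof.
move/parityP=> h; exists [multinom (w i)./2 | i < n]; apply/mnmP => i.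
by rewrite !mnmDE mnmE dvecE -h addnn odd_double_half.
Qed.

Lemma parity0 g a : parity g a 0%MM -> g = a.
Proof.
move/parityP=> h; apply/ffunP => i; have := h i; rewrite mnm0E.
by case: eqP.
Qed.

Lemma parity_sub g b a w u : parity g a (w + u)%MM -> parity g b w -> parity b a u.
Proof.
move=> /parityP h1 /parityP h2; apply/parityP => i; have := h1 i.
rewrite mnmDE oddD h2; by case: (g i) (b i) (a i) (odd (u i)) => [] [] [] [].
Qed.

Lemma sadjP g a : reflect (exists i, a = flip i g) (sadj g a).
Proof.
apply: (iffP idP) => [/cards1P[i iE]|[i ->]].
  exists i; apply/ffunP => j; rewrite ffunE.
  have : (j \in [set i0 | g i0 != a i0]) = (j == i) by rewrite iE inE.
  by rewrite inE; case: (j == i); case: (g j) (a j) => [] [].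
by rewrite /sadj; apply/cards1P; exists i; apply/setP => j; rewrite !inE ffunE; case: (j == i); case: (g j).
Qed.

Lemma dvec_flip g i : dvec g (flip i g) = U_(i)%MM.
Proof.
apply/mnmP => j; rewrite dvecE mnm1E ffunE [i == j]eq_sym.
by case: (j == i); case: (g j).
Qed.

Lemma flipK i g : flip i (flip i g) = g.
Proof. by apply/ffunP => j; rewrite !ffunE; case: (j == i); rewrite ?negbK. Qed.

Lemma flipC i j g : flip i (flip j g) = flip j (flip i g).
Proof. by apply/ffunP => l; rewrite !ffunE; case: (l == i); case: (l == j). Qed.

Lemma sadj_sym g a : sadj g a = sadj a g.
Proof.
rewrite /sadj (_ : [set i | g i != a i] = [set i | a i != g i]) //.
by apply/setP => i; rewrite !inE eq_sym.
Qed.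

(** Two steps to a different vertex cross two distinct hyperplanes once each. *)
Lemma dvec_two_steps g b a : sadj g b -> sadj b a -> g != a ->
  (dvec g b + dvec b a)%MM = dvec g a.
Proof.
move=> /sadjP[i ->] /sadjP[j ->] ga.
have ij : i != j by apply: contraNneq ga => <-; rewrite flipK.
apply/mnmP => l; rewrite !dvec_flip mnmDE !mnm1E dvecE !ffunE.
rewrite [i == l]eq_sym [j == l]eq_sym; case: (eqVneq l i) => [->|_].
  by rewrite (negPf ij); case: (g i).
by case: (l == j); case: (g l).
Qed.

End Walks.

Section PathWeight.
Variables (R : realType) (n k : nat) (A : polarized R n k) (K : fieldType).
Local Notation F := (Fvert A).
Local Notation T := (palg K (fadj (A := A)) n).
Local Notation PC := (palg_car K (fadj (A := A)) n).
Local Notation B := (pbasis (fadj (A := A)) n).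
Local Notation d g a := (dvec (val (g : F)) (val (a : F))).

Fixpoint walk_weight (g : F) (s : seq F) : 'X_{1..n} :=
  if s is b :: s' then (d g b + walk_weight b s')%MM else 0%MM.

Definition bsrc (x : B) : F := qsource x.1.
Definition btgt (x : B) : F := qtarget x.1.
(** A variable [t_i] stands for crossing the [i]-th hyperplane and coming back, so
    it counts for two crossings. *)
Definition bweight (x : B) : 'X_{1..n} :=
  (walk_weight (val x.1).1 (val x.1).2 + (x.2 + x.2))%MM.

Lemma walk_weight_cat g s t :
  walk_weight g (s ++ t) = (walk_weight g s + walk_weight (last g s) t)%MM.
Proof. by elim: s g => [|b s IH] g /=; rewrite ?add0m // IH addmA. Qed.

Lemma walk_weight_parity g s : parity (val g) (val (last g s)) (walk_weight g s).
Proof.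
elim: s g => [|b s IH] g /=; last exact: parityD (parity_dvec _ _) (IH b).
by rewrite -(dvecxx (val g)) parity_dvec.
Qed.

Lemma bweight_parity x : parity (val (bsrc x)) (val (btgt x)) (bweight x).
Proof. exact: parityD (walk_weight_parity _ _) (parity2 _ _). Qed.

Variant bmul_spec (x y : B) : option B -> Prop :=
| BmulNone of btgt x != bsrc y : bmul_spec x y None
| BmulSome z of btgt x = bsrc y & bsrc z = bsrc x & btgt z = btgt y
    & bweight z = (bweight x + bweight y)%MM : bmul_spec x y (Some z).

Lemma bmulP x y : bmul_spec x y (bmul x y).
Proof.
case: x y => [u l] [v m]; rewrite /bmul /=.
case: qcatP => [h|w E s1 t1 wE] /=; first exact: BmulNone.
apply: BmulSome => //; rewrite /bweight /= wE walk_weight_cat.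
have -> : (val w).1 = (val u).1 := s1.
have -> : last (val u).1 (val u).2 = (val v).1 := E.
have AC (p q r s : 'X_{1..n}) : (p + q + (r + s + (r + s)) = p + (r + r) + (q + (s + s)))%MM.
  by apply/mnmP => i; rewrite !mnmDE; lia.
exact: AC.
Qed.

Lemma walk_weight_deg g s : path (fadj (A := A)) g s -> mdeg (walk_weight g s) = size s.
Proof.
elim: s g => [|b s IH] g /=; first by rewrite mdeg0.
move=> /andP[/sadjP[i bE] /IH bs]; rewrite mdegD bs bE dvec_flip.
by rewrite mdeg1.
Qed.

Lemma bdegE x : bdeg x = mdeg (bweight x).
Proof.
rewrite /bdeg /qlength /bweight !mdegD walk_weight_deg; last exact: (valP x.1).
by rewrite addnn mul2n.
Qed.

(** ** Coefficients *)

(** The vectors [bvec], the product and the coefficients are kept abstract, because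
    comparing their normal forms is not feasible. *)
Fact abstract_bvec : {f : B -> PC | f = (fun x => bvec K x)}. Proof. by eexists. Qed.
Definition bv : B -> PC := sval abstract_bvec.
Lemma bvE x : bv x = bvec K x. Proof. by rewrite /bv (svalP abstract_bvec). Qed.

Fact abstract_pmul : {m : PC -> PC -> PC | m = @pmul K F (fadj (A := A)) n}.
Proof. by eexists. Qed.
Definition pm : PC -> PC -> PC := sval abstract_pmul.
Lemma pmE f h : pm f h = pmul f h. Proof. by rewrite /pm (svalP abstract_pmul). Qed.

Lemma pmPl h c f g : pm (c *: f + g) h = c *: pm f h + pm g h.
Proof. rewrite /pm (svalP abstract_pmul); exact: pmulPl. Qed.
Lemma pmPr h c f g : pm h (c *: f + g) = c *: pm h f + pm h g.
Proof. rewrite /pm (svalP abstract_pmul); exact: pmulPr. Qed.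
Lemma pm0l h : pm 0 h = 0.
Proof. exact: (bilin0l pmPl). Qed.
Lemma pm0r h : pm h 0 = 0.
Proof. exact: (bilin0r pmPr). Qed.
Lemma pmU x y : pm (bv x) (bv y) = if bmul x y is Some z then bv z else 0.
Proof. rewrite pmE (bvE x) (bvE y) pmulUU; case: (bmul x y) => //= z; exact: (esym (bvE z)). Qed.

Lemma pc_ind (P : PC -> Prop) : P 0 ->
  (forall c f g, P f -> P g -> P (c *: f + g)) -> (forall x, P (bv x)) -> forall f, P f.
Proof. by move=> P0 PD PU; apply: palg_ind => // x; rewrite -bvE. Qed.

(** The sum of the coefficients of all paths with given ends and crossings. *)
Fact kcoef_exists : {f : F -> F -> 'X_{1..n} -> PC -> K |
  (forall g a w x, f g a w (bv x) = ((bsrc x == g) && (btgt x == a) && (bweight x == w))%:R) /\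
  (forall g a w c u v, f g a w (c *: u + v) = c * f g a w u + f g a w v)}.
Proof.
exists (fun g a w => lext (V := K^o)
  (fun x : B => ((bsrc x == g) && (btgt x == a) && (bweight x == w))%:R)); split.
  move=> g a w x; rewrite bvE; exact: (@lextU K _ (fadj (A := A)) n K^o).
by move=> g a w c u v; rewrite lextP.
Qed.

Definition kcoef : F -> F -> 'X_{1..n} -> PC -> K := sval kcoef_exists.

Lemma kcoefU g a w x : kcoef g a w (bv x) = ((bsrc x == g) && (btgt x == a) && (bweight x == w))%:R.
Proof. exact: (svalP kcoef_exists).1. Qed.
Lemma kcoefP g a w c u v : kcoef g a w (c *: u + v) = c * kcoef g a w u + kcoef g a w v.
Proof. exact: (svalP kcoef_exists).2. Qed.
Lemma kcoefD g a w u v : kcoef g a w (u + v) = kcoef g a w u + kcoef g a w v.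
Proof. by have := kcoefP g a w 1 u v; rewrite scale1r mul1r. Qed.
Lemma kcoef0 g a w : kcoef g a w 0 = 0.
Proof. by apply: (addrI (kcoef g a w 0)); rewrite -kcoefD !addr0. Qed.

(** Extending the paths by [x] on the left shifts their source and crossings. *)
Lemma kcoef_mull g a w x f : kcoef g a w (pm (bv x) f) =
  if (bsrc x == g) && (bweight x <= w)%MM then kcoef (btgt x) a (w - bweight x)%MM f else 0.
Proof.
elim/pc_ind: f => [|c f h Hf Hh|y].
- by rewrite pm0r !kcoef0; case: ifP.
- rewrite (pmPr (bv x) c f h) (kcoefP g a w c).
  apply: etrans (congr2 (fun s t => c * s + t) Hf Hh) _.
  by case: ifP => _; rewrite ?kcoefP // mulr0 addr0.
- rewrite pmU; case: bmulP => [/negPf E|z E s1 t1 wE].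
    rewrite kcoef0 kcoefU [bsrc y == _]eq_sym E; by case: ifP.
  rewrite !kcoefU s1 t1 wE -E eqxx; case: eqP => //= _.
  case: (boolP (bweight x <= w)%MM) => [le|le].
    congr (_ && _)%:R; apply/eqP/eqP => [<-|->]; first by rewrite addmC addmK.
    by rewrite addmC submK.
  rewrite (_ : _ == w = false) ?andbF //; apply: contraNF le => /eqP <-.
  by apply/mnm_lepP => i; rewrite mnmDE leq_addr.
Qed.

Lemma kcoef_mulr g a w x f : kcoef g a w (pm f (bv x)) =
  if (btgt x == a) && (bweight x <= w)%MM then kcoef g (bsrc x) (w - bweight x)%MM f else 0.
Proof.
elim/pc_ind: f => [|c f h Hf Hh|y].
- by rewrite pm0l !kcoef0; case: ifP.
- rewrite (pmPl (bv x) c f h) (kcoefP g a w c).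
  apply: etrans (congr2 (fun s t => c * s + t) Hf Hh) _.
  by case: ifP => _; rewrite ?kcoefP // mulr0 addr0.
- rewrite pmU; case: bmulP => [/negPf E|z E s1 t1 wE].
    by rewrite kcoef0 kcoefU E andbF; case: ifP.
  rewrite !kcoefU s1 t1 wE -E eqxx andbT; case: (btgt x == a) => /=; last by rewrite andbF.
  rewrite andbT; case: (boolP (bweight x <= w)%MM) => [le|le].
    congr (_ && _)%:R; apply/eqP/eqP => [<-|->]; first by rewrite addmK.
    by rewrite submK.
  rewrite (_ : _ == w = false) ?andbF //; apply: contraNF le => /eqP <-.
  by apply/mnm_lepP => i; rewrite mnmDE leq_addl.
Qed.

(** A walk from [g] to [a] with crossings [w] can be routed through an unbounded
    chamber, so that its class vanishes in the quotient. *)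
Definition dead (g a : F) (w : 'X_{1..n}) : Prop :=
  exists b : F, ~ bounded A (val b) /\ (d g b + d b a <= w)%MM.

Let leq_detour (p q r s t u : nat) :
  (p <= q + r -> q <= s -> s <= t -> r + u <= t - s -> p + u <= t)%N.
Proof. lia. Qed.

(** The kernel of the coefficients which survive in the quotient.  It is a two-sided
    ideal, since a walk through a dead walk is dead. *)
Definition null (f : PC) : Prop := forall g a w, ~ dead g a w -> kcoef g a w f = 0.

Lemma walk_ge x : (d (bsrc x) (btgt x) <= bweight x)%MM.
Proof. exact: parity_ge (bweight_parity x). Qed.

Lemma null0 : null 0. Proof. by move=> g a w _; exact: kcoef0. Qed.

Lemma nullP c f h : null f -> null h -> null (c *: f + h).
Proof. by move=> hf hh g a w nd; rewrite kcoefP hf // hh // mulr0 addr0. Qed.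

Lemma nullMl f h : null h -> null (pm f h).
Proof.
move=> hh; elim/pc_ind: f => [|c f1 f2 h1 h2|x].
- by rewrite pm0l; exact: null0.
- by rewrite (pmPl h c f1 f2); apply: nullP.
move=> g a w nd; rewrite kcoef_mull; case: ifP => // /andP[/eqP sx le].
apply: hh => -[b [ub bw]]; apply: nd; exists b; split=> //.
apply/mnm_lepP => i; move: (walk_ge x) le bw; rewrite sx; move: (bweight x) => wx.
move=> /mnm_lepP/(_ i) h2 /mnm_lepP/(_ i) h3 /mnm_lepP/(_ i); rewrite mnmBE !mnmDE => h4.
exact: leq_detour (dvec_tri _ _ _ i) h2 h3 h4.
Qed.

Lemma nullMr f h : null f -> null (pm f h).
Proof.
move=> hh; elim/pc_ind: h => [|c f1 f2 h1 h2|x].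
- by rewrite pm0r; exact: null0.
- by rewrite (pmPr f c f1 f2); apply: nullP.
move=> g a w nd; rewrite kcoef_mulr; case: ifP => // /andP[/eqP sx le].
apply: hh => -[b [ub bw]]; apply: nd; exists b; split=> //.
apply/mnm_lepP => i; move: (walk_ge x) le bw; rewrite sx; move: (bweight x) => wx.
move=> /mnm_lepP/(_ i) h2 /mnm_lepP/(_ i) h3 /mnm_lepP/(_ i); rewrite mnmBE !mnmDE addnC => h4.
rewrite addnC; apply: leq_detour h2 h3 h4; rewrite addnC; exact: dvec_tri.
Qed.

Lemma null_eqkey x y : bsrc x = bsrc y -> btgt x = btgt y -> bweight x = bweight y ->
  null (bv x - bv y).
Proof.
move=> s t e g a w _; have := kcoefP g a w (-1) (bv y) (bv x).
rewrite scaleN1r addrC => E; apply: (etrans E).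
by rewrite !kcoefU s t e mulN1r addNr.
Qed.

Lemma bvecM x y : btgt x = bsrc y -> exists z, [/\ pm (bv x) (bv y) = bv z, bsrc z = bsrc x,
  btgt z = btgt y & bweight z = (bweight x + bweight y)%MM].
Proof.
move=> E; rewrite pmU; case: bmulP => [|z _ s1 t1 wE]; first by rewrite E eqxx.
by exists z.
Qed.

Lemma parrow_bvec (a b : F) : fadj a b -> exists x, [/\ parrow K (fadj (A := A)) n a b = bv x,
  bsrc x = a, btgt x = b, bweight x = d a b & x.2 = 0%MM].
Proof.
move=> ab; rewrite /parrow; case: insubP => [w _ wE|]; last by rewrite /= ab.
exists (w, 0%MM); rewrite bvE; split=> //; rewrite /bsrc /btgt /qsource /qtarget /bweight ?wE //=.
by rewrite !addm0.
Qed.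

Definition btriv (a : F) (u : 'X_{1..n}) : B := (qtriv (fadj (A := A)) a, u).

Definition tvec (u : 'X_{1..n}) : PC := \sum_a bv (btriv a u).

Lemma btrivM u (x : B) : bmul (btriv (bsrc x) u) x = Some (x.1, (u + x.2)%MM).
Proof.
rewrite /bmul /=; case: qcatP => [|w E s1 t1 wE]; first by rewrite eqxx.
by congr (Some (_, _)); apply: qpath_eq.
Qed.

Lemma btrivMr u (x : B) : bmul x (btriv (btgt x) u) = Some (x.1, (u + x.2)%MM).
Proof.
rewrite /bmul /=; case: qcatP => [|w E s1 t1 wE]; first by rewrite eqxx.
rewrite addmC; congr (Some (_, _)); apply: qpath_eq => //.
by rewrite wE cats0.
Qed.

Lemma pm_suml (f : F -> PC) h : pm (\sum_a f a) h = \sum_a pm (f a) h.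
Proof.
apply: (big_morph (pm^~ h)); last exact: pm0l.
by move=> f1 f2; have := pmPl h 1 f1 f2; rewrite !scale1r.
Qed.

Lemma tvecM u (x : B) : pm (tvec u) (bv x) = bv (x.1, (u + x.2)%MM).
Proof.
rewrite /tvec pm_suml (bigD1 (bsrc x)) //= big1 => [|a /negPf ax]; first by rewrite addr0 pmU btrivM.
by rewrite pmU; case: bmulP => // z E; move: ax; rewrite -E eqxx.
Qed.

Lemma tvec_var i : pvar K (fadj (A := A)) i = tvec U_(i)%MM.
Proof. by apply: eq_bigr => a _; rewrite bvE. Qed.

Lemma pvert_bv a : pvert K (fadj (A := A)) n a = bv (btriv a 0%MM).
Proof. by rewrite bvE. Qed.

Lemma bweight_shift (x : B) u : bweight (x.1, (u + x.2)%MM) = (u + u + bweight x)%MM.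
Proof. by apply/mnmP => i; rewrite /bweight /= !mnmDE; lia. Qed.

Lemma bweight_triv a u : bweight (btriv a u) = (u + u)%MM.
Proof. by rewrite /bweight /= add0m. Qed.

(** The defining relations identify paths with the same crossings, except for
    the idempotents of unbounded chambers, whose coefficients are dead. *)
Lemma null_rel x : @Atilde_rel R n k A K x -> null x.
Proof.
case=> [a ub|a b c e u ab bc ce ea|a b i ab iab].
- move=> g a' w nd.
  apply: (etrans (congr1 _ (pvert_bv a))); rewrite kcoefU.
  case: eqP => //= ga; case: eqP => //= aa; case: eqP => //= ww.
  case: nd; exists a; split=> //; rewrite -ga -aa dvecxx addm0.
  by apply/mnm_lepP => l; rewrite mnm0E.
- have [x1 [e1 s1 t1 w1 _]] := parrow_bvec ab; have [x2 [e2 s2 t2 w2 _]] := parrow_bvec bc.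
  have ae : fadj a e by rewrite /fadj sadj_sym. have ec : fadj e c by rewrite /fadj sadj_sym.
  have [x3 [e3 s3 t3 w3 _]] := parrow_bvec ae; have [x4 [e4 s4 t4 w4 _]] := parrow_bvec ec.
  rewrite e1 e2 e3 e4.
  have [|z1 [E1 S1 T1 W1]] := @bvecM x1 x2; first by rewrite t1 s2.
  have [|z2 [E2 S2 T2 W2]] := @bvecM x3 x4; first by rewrite t3 s4.
  have -> : (bv x1 : T) * bv x2 - (bv x3 : T) * bv x4 = bv z1 - bv z2.
    by rewrite -E1 -E2 !pmE.
  apply: null_eqkey; rewrite ?S1 ?S2 ?T1 ?T2 ?W1 ?W2 ?s1 ?s3 ?t2 ?t4 // w1 w2 w3 w4.
  have ac : val a != val c.
    by move: u => /= /andP[]; rewrite !inE !negb_or => /and3P[_ + _] _.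
  by rewrite !dvec_two_steps.
- have [x1 [e1 s1 t1 w1 _]] := parrow_bvec ab.
  have ba : fadj b a by rewrite /fadj sadj_sym.
  have [x2 [e2 s2 t2 w2 _]] := parrow_bvec ba.
  have [|z1 [E1 S1 T1 W1]] := @bvecM x1 x2; first by rewrite t1 s2.
  rewrite e1 e2 tvec_var pvert_bv.
  have -> : (bv x1 : T) * bv x2 - (tvec U_(i)%MM : T) * bv (btriv a 0%MM) =
      bv z1 - bv (qtriv (fadj (A := A)) a, (U_(i) + 0)%MM).
    by rewrite -E1 -[bv (_, (_ + _)%MM)](tvecM U_(i)%MM (btriv a 0%MM)) !pmE.
  apply: null_eqkey; rewrite ?S1 ?T1 ?W1 ?s1 ?t2 //.
  rewrite w1 w2 bweight_triv addm0 [X in (_ + X)%MM]dvecC.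
  have /sadjP[j bE] := ab; rewrite bE dvec_flip.
  by move: iab; rewrite bE ffunE; case: (eqVneq i j) => [->|_]; rewrite ?eqxx.
Qed.

(** Hence the surviving coefficients descend to the convolution algebra. *)
Lemma null_ideal x : ideal_gen (@Atilde_rel R n k A K) x -> null x.
Proof.
elim=> {x} [x||x y _ hx _ hy|a x _ hx|x b _ hx]; [exact: null_rel|exact: null0| | |].
- by have := nullP 1 hx hy; rewrite scale1r.
- have := @nullMl a x hx; rewrite pmE; exact.
- have := @nullMr b x hx; rewrite pmE; exact.
Qed.

End PathWeight.

(** * Paths with the same crossings are equal *)

Section TautPaths.
Variables (R : realType) (n k : nat) (A : polarized R n k).
Local Notation F := (Fvert A).
Local Notation adj := (fadj (A := A)).
Local Notation B := (pbasis adj n).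
Local Notation d g a := (dvec (val (g : F)) (val (a : F))).

Variables (Q : pzRingType) (pth : B -> Q).
Hypothesis pthM : forall x y z, bmul x y = Some z -> pth x * pth y = pth z.

Definition arr (a b : F) : Q :=
  if insub (a, [:: b]) is Some w then pth (w, 0%MM) else 0.

Hypothesis arr_square : forall a b c e : F, uniq [:: a; b; c; e] ->
  adj a b -> adj b c -> adj c e -> adj e a -> arr a b * arr b c = arr a e * arr e c.
Hypothesis arr_back : forall (a b : F) i, adj a b -> val a i != val b i ->
  arr a b * arr b a = pth (btriv a U_(i)%MM).

Local Notation tr a u := (pth (btriv a u)).

Lemma arr_pth (a b : F) : adj a b -> exists x, [/\ arr a b = pth x,
  bsrc x = a, btgt x = b & bweight x = d a b].
Proof.
move=> ab; rewrite /arr; case: insubP => [w _ wE|]; last by rewrite /= ab.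
exists (w, 0%MM); split=> //; rewrite /bsrc /btgt /qsource /qtarget /bweight ?wE //=.
by rewrite !addm0.
Qed.

Lemma pth_mul x y : btgt x = bsrc y -> exists z, [/\ pth x * pth y = pth z, bsrc z = bsrc x,
  btgt z = btgt y & bweight z = (bweight x + bweight y)%MM].
Proof.
move=> E; have := bmulP x y; case Eb: (bmul x y) => [z|] h; inversion h; last by rewrite E eqxx in H.
by exists z; rewrite (pthM Eb).
Qed.

Lemma arr_mul (a b : F) y : adj a b -> bsrc y = b -> exists z, [/\ arr a b * pth y = pth z,
  bsrc z = a, btgt z = btgt y & bweight z = (d a b + bweight y)%MM].
Proof.
move=> ab yb; have [x [-> s1 t1 w1]] := arr_pth ab.
have [|z [-> s2 t2 w2]] := @pth_mul x y; first by rewrite t1 yb.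
by exists z; rewrite s2 w2 s1 w1.
Qed.

Lemma trM x u : tr (bsrc x) u * pth x = pth x * tr (btgt x) u.
Proof. by rewrite (pthM (btrivM u x)) (pthM (btrivMr u x)). Qed.

Lemma tr_add a u v : tr a u * tr a v = tr a (u + v)%MM.
Proof. exact: (pthM (btrivM u (btriv a v))). Qed.

Lemma pth_cases x : (exists u, x = btriv (bsrc x) u) \/
  exists b x', [/\ adj (bsrc x) b, pth x = arr (bsrc x) b * pth x', bsrc x' = b,
    btgt x' = btgt x & bweight x = (d (bsrc x) b + bweight x')%MM /\
    (qlength x'.1 < qlength x.1)%N].
Proof.
case: x => w l; case E: (val w).2 => [|b s].
  by left; exists l; congr (_, _); apply: qpath_eq => //; rewrite E.
right; exists b; have := valP w; rewrite [path _ _ _]/= E /= => /andP[gb bs].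
pose w' : qpath adj := Sub (b, s) bs.
exists (w', l); split=> //.
- rewrite /arr; case: insubP => [v _ vE|]; last by rewrite /= gb.
  apply/esym/pthM; rewrite /bmul /=; case: qcatP => [|z Ez s1 t1 zE].
    by rewrite /qtarget vE /qsource /= eqxx.
  rewrite add0m; congr (Some (_, _)); apply: qpath_eq; first by rewrite s1 /qsource vE.
  by rewrite zE vE E.
- by rewrite /btgt /qtarget /= E.
- split; last by rewrite /qlength /= E.
  have -> : bweight (w, l) = (walk_weight (val w).1 (val w).2 + (l + l))%MM by [].
  by rewrite E; exact: (esym (addmA _ _ _)).
Qed.

(** ** Taut paths *)

(** The paths without variables that cross each hyperplane at most once. *)
Definition taut (g a : F) x : Prop := [/\ bsrc x = g, btgt x = a & bweight x = d g a].

Lemma taut_triv a : taut a a (btriv a 0%MM).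
Proof. by split=> //; rewrite bweight_triv addm0 dvecxx. Qed.

Lemma closer_dvec (g b a : F) i : val b = flip i (val g) -> val g i != val a i ->
  (d g b + d b a)%MM = d g a.
Proof.
move=> bE ia; apply/mnmP => l; rewrite mnmDE bE !dvecE ffunE.
case: (eqVneq l i) => [->|_]; last by rewrite eqxx.
by move: ia; case: (val g i); case: (val a i).
Qed.

Lemma closer_mdeg (g b a : F) i : val b = flip i (val g) -> val g i != val a i ->
  mdeg (d g a) = (mdeg (d b a)).+1.
Proof.
move=> bE ia; rewrite -(closer_dvec bE ia) mdegD bE dvec_flip mdeg1.
by rewrite add1n.
Qed.

Lemma arr_taut (g b a : F) i x : val b = flip i (val g) -> val g i != val a i ->
  taut b a x -> exists2 z, arr g b * pth x = pth z & taut g a z.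
Proof.
move=> bE ia [sx tx wx]; have gb : adj g b by apply/sadjP; exists i.
have [z [-> sz tz wz]] := arr_mul gb sx; exists z => //.
by split=> //; rewrite ?tz // wz wx (closer_dvec bE ia).
Qed.

Lemma taut_exists g a : exists x, taut g a x.
Proof.
have [m le_m] := ubnP (mdeg (d g a)); elim: m => // m IH in g le_m *.
case: (eqVneq (val g) (val a)) => [/val_inj ->|ga]; first by exists (btriv a 0%MM); apply: taut_triv.
have [i ia fF] := wall_exists (valP g) (valP a) ga.
pose b : F := Sub (flip i (val g)) fF; have bE : val b = flip i (val g) by [].
have [|x xt] := IH b; first by move: le_m; rewrite (closer_mdeg bE ia) ltnS.
by have [z _ zt] := arr_taut bE ia xt; exists z.
Qed.

Definition tautp g a : Q := pth (projT1 (cid (taut_exists g a))).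

Lemma tautpE g a : exists2 x, tautp g a = pth x & taut g a x.
Proof. by exists (projT1 (cid (taut_exists g a))) => //; exact: projT2 (cid _). Qed.

Lemma taut_cases g a x : taut g a x -> (g = a /\ x = btriv g 0%MM) \/
  exists b i x', [/\ val b = flip i (val g), val g i != val a i, taut b a x'
    & pth x = arr g b * pth x'].
Proof.
move=> [sx tx wx]; case: (pth_cases x) => [[u xE]|[b [x' [gb xE sx' tx' [wE _]]]]].
  left; move: wx; rewrite xE bweight_triv sx -tx xE sx -[btgt _]/g dvecxx => u0.
  split=> //; congr btriv; apply/mnmP => i; have := congr1 (fun m : 'X_{1..n} => m i) u0.
  by rewrite mnmDE mnm0E; lia.
right; rewrite sx in gb xE wE; have /sadjP[i bE] := gb.
have w'E l : ((i == l) + bweight x' l)%N = (val g l != val a l).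
  by rewrite -mnm1E -mnmDE -(dvec_flip (val g)) -bE -wE wx dvecE.
have ia : val g i != val a i.
  by have := w'E i; rewrite eqxx; case: (val g i != val a i).
exists b, i, x'; split=> //; split=> //; first by rewrite tx'.
apply/mnmP => l; have := w'E l; have := congr1 (fun m : 'X_{1..n} => m l) (closer_dvec bE ia).
rewrite mnmDE bE dvec_flip mnm1E [d g a l]dvecE => <-; lia.
Qed.

(** Any two taut paths with the same ends agree: two first steps are joined by
    walls of the chamber, across codimension two faces, where the square
    relation applies. *)
Lemma taut_unique g a x : taut g a x -> pth x = tautp g a.
Proof.
have [m le_m] := ubnP (mdeg (d g a)); elim: m => // m IH in g x le_m *.
move=> xt; have [y -> yt] := tautpE g a.
case: (taut_cases xt) => [[ga ->]|[b [i [x' [bE ia x't ->]]]]].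
  case: (taut_cases yt) => [[_ ->] //|[c [j [y' [_ ja _ _]]]]].
  by rewrite ga eqxx in ja.
case: (taut_cases yt) => [[ga _]|[c [j [y' [cE ja y't ->]]]]].
  by rewrite ga eqxx in ia.
have ltm b' i' : val b' = flip i' (val g) -> val g i' != val a i' -> (mdeg (d b' a) < m)%N.
  by move=> h1 h2; move: le_m; rewrite (closer_mdeg h1 h2) ltnS.
rewrite (IH b x') ?(ltm b i) // (IH c y') ?(ltm c j) //.
pose X i := if insub (flip i (val g)) is Some b' then arr g b' * tautp b' a else 0.
have XE b' i' : val b' = flip i' (val g) -> X i' = arr g b' * tautp b' a.
  by move=> h; rewrite /X -h valK.
rewrite -(XE b i) // -(XE c j) //.
have bF := valP b; rewrite bE in bF; have cF := valP c; rewrite cE in cF.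
apply: (walls_connected (valP g) (valP a) _ ia bF ja cF).
move=> i' j' ia' fi ja' fj ij fij.
pose b' : F := Sub (flip i' (val g)) fi; have bE' : val b' = flip i' (val g) by [].
pose c' : F := Sub (flip j' (val g)) fj; have cE' : val c' = flip j' (val g) by [].
pose e' : F := Sub (flip j' (flip i' (val g))) fij.
have eE : val e' = flip j' (val b') by [].
have eE' : val e' = flip i' (val c') by rewrite eE bE' cE' flipC.
have bj : val b' j' != val a j' by rewrite bE' flip_other // eq_sym.
have ci : val c' i' != val a i' by rewrite cE' flip_other.
have [z zE zt] := tautpE e' a.
have [u uE ut] := arr_taut eE bj zt; have [v vE vt] := arr_taut eE' ci zt.
rewrite (XE b' i') // (XE c' j') // -(IH b' u) ?(ltm b' i') // -(IH c' v) ?(ltm c' j') //.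
rewrite -uE -vE !mulrA; congr (_ * _); apply: arr_square.
- have gb : val g != val b'.
    by apply: contraNneq ia' => E; move: bE'; rewrite -E => /ffunP/(_ i'); rewrite flip_same; case: (val g i').
  have gc : val g != val c'.
    by apply: contraNneq ja' => E; move: cE'; rewrite -E => /ffunP/(_ j'); rewrite flip_same; case: (val g j').
  have ne (p q : svec n) l : p l != q l -> p != q by apply: contraNneq => ->.
  have h1 : val g != val e' by apply: (ne _ _ i'); rewrite eE flip_other // flip_same; case: (val g i').
  have h2 : val b' != val e' by apply: (ne _ _ j'); rewrite eE flip_same; case: (val b' j').
  have h3 : val b' != val c'.
    by apply: (ne _ _ i'); rewrite bE' cE' flip_same flip_other //; case: (val g i').
  have h4 : val e' != val c' by apply: (ne _ _ i'); rewrite eE' flip_same; case: (val c' i').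
  by rewrite /= !inE !negb_or -!val_eqE gb gc h1 h2 h3 h4.
- by apply/sadjP; exists i'.
- by apply/sadjP; exists j'.
- by rewrite /fadj sadj_sym; apply/sadjP; exists i'.
- by rewrite /fadj sadj_sym; apply/sadjP; exists j'.
Qed.

Lemma arr_tautp (g b a : F) i : val b = flip i (val g) -> val g i != val a i ->
  arr g b * tautp b a = tautp g a.
Proof.
move=> bE ia; have [x -> xt] := tautpE b a.
by have [z -> zt] := arr_taut bE ia xt; apply: taut_unique.
Qed.

(** Peel off the first arrow of a path: it either prolongs a taut path or undoes its
    first step, and then the two of them contribute a variable. *)
Lemma pth_taut x u : bweight x = (d (bsrc x) (btgt x) + (u + u))%MM ->
  pth x = tr (bsrc x) u * tautp (bsrc x) (btgt x).
Proof.
have [m le_m] := ubnP (qlength x.1); elim: m => // m IH in x u le_m *.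
case: (pth_cases x) => [[v xE]|[b [x' [gb xE sx' tx' [wE lx']]]]].
  rewrite xE bweight_triv -[btgt _]/(bsrc x) dvecxx add0m => uv.
  have -> : u = v.
    apply/mnmP => i; have := congr1 (fun m : 'X_{1..n} => m i) uv.
    by rewrite !mnmDE; lia.
  by rewrite -(taut_unique (taut_triv (bsrc x))) tr_add addm0.
set g := bsrc x in gb xE wE *; set a := btgt x in tx' *; move=> wu.
have [u' u'E] := parity_half (bweight_parity x').
have := IH x' u' (leq_trans lx' le_m) u'E; rewrite sx' tx' => x'E.
have [y [yE sy ty _]] := arr_pth gb.
have gt v : arr g b * tr b v = tr g v * arr g b by rewrite yE -sy -ty trM.
rewrite xE x'E mulrA gt -mulrA; rewrite sx' tx' in u'E.
have /sadjP[i bE] := gb; case: (boolP (val g i == val a i)) => ia; last first.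
  rewrite (arr_tautp bE ia); congr (pth (btriv _ _) * _).
  apply/mnmP => l; have := congr1 (fun m : 'X_{1..n} => m l) wu; rewrite wE u'E.
  by have := congr1 (fun m : 'X_{1..n} => m l) (closer_dvec bE ia); rewrite !mnmDE; lia.
have bia : val b i != val a i by rewrite bE flip_same -(eqP ia); case: (val g i).
have gE : val g = flip i (val b) by rewrite bE flipK.
have gb' : val g i != val b i by rewrite bE flip_same; case: (val g i).
rewrite -(arr_tautp gE bia) [arr g b * _]mulrA (arr_back gb gb') mulrA tr_add.
congr (pth (btriv _ _) * _).
apply/mnmP => l; have := congr1 (fun m : 'X_{1..n} => m l) wu; rewrite wE u'E.
have := congr1 (fun m : 'X_{1..n} => m l) (closer_dvec gE bia).
have := congr1 (fun m : 'X_{1..n} => m l) (dvec_flip (val g) i); rewrite -bE.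
by rewrite [d b g]dvecC !mnmDE; lia.
Qed.

Theorem pth_eqkey x y : bsrc x = bsrc y -> btgt x = btgt y -> bweight x = bweight y ->
  pth x = pth y.
Proof.
move=> s t e; have [u uE] := parity_half (bweight_parity x).
by rewrite (pth_taut uE) s t -pth_taut // -e uE s t.
Qed.

Lemma path_exists (g a : F) w : parity (val g) (val a) w ->
  exists x : B, [/\ bsrc x = g, btgt x = a & bweight x = w].
Proof.
move=> /parity_half[u ->]; have [x [sx tx wx]] := taut_exists g a.
exists (x.1, (u + x.2)%MM); split=> //.
by rewrite bweight_shift wx addmC.
Qed.

End TautPaths.

(** * The monomial basis of the convolution algebra *)

Section AtildeBasis.
Variables (R : realType) (n k : nat) (A : polarized R n k) (K : fieldType).
Local Notation F := (Fvert A).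
Local Notation adj := (fadj (A := A)).
Local Notation B := (pbasis adj n).
Local Notation T := (palg K adj n).
Local Notation PC := (palg_car K adj n).
Local Notation At := (Atilde A K).
Local Notation d g a := (dvec (val (g : F)) (val (a : F))).
Local Notation q := (qproj (@Atilde_rel_homog R n k A K)).

Lemma q_eq (f h : T) : ideal_gen (@Atilde_rel R n k A K) (f - h) -> q f = q h.
Proof. exact: qalg_eq. Qed.
Lemma qM (f h : T) : q f * q h = q (f * h). Proof. exact: qalg_mul_pi. Qed.
Lemma qD (f h : T) : q f + q h = q (f + h). Proof. exact: (esym (qalg_piD (@Atilde_rel R n k A K) f h)). Qed.
Lemma q0 : q 0 = 0. Proof. exact: (qalg_pi0 (@Atilde_rel R n k A K)). Qed.
Lemma qZ c (f : T) : q (c *: (f : PC)) = ga_scal At c * q f.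
Proof.
rewrite -[ga_scal At c]/(q (ga_scal T c)) qM; congr (\pi_(_) _).
exact: (esym (pscalMl c (f : PC))).
Qed.

Lemma qP c (f g : PC) : q (c *: f + g : PC) = ga_scal At c * q f + q g.
Proof. exact: (etrans (esym (qD (c *: f : PC) g)) (congr1 (fun z => z + q g) (qZ c f))). Qed.

Fact abstract_path : {f : B -> At | forall x, f x = q (bv K x)}. Proof. by eexists. Qed.
Definition pth : B -> At := sval abstract_path.
Lemma pthE x : pth x = q (bv K x). Proof. exact: (svalP abstract_path). Qed.

Lemma pthM x y z : bmul x y = Some z -> pth x * pth y = pth z.
Proof.
move=> E; rewrite (pthE x) (pthE y) (pthE z) qM; congr (q _).
by have := pmU K x y; rewrite E pmE.
Qed.

Lemma pthM0 x y : bmul x y = None -> pth x * pth y = 0.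
Proof.
move=> E; rewrite (pthE x) (pthE y) qM -q0; congr (q _).
by have := pmU K x y; rewrite E pmE.
Qed.

Lemma q_parrow a b : q (parrow K adj n a b) = arr pth a b.
Proof.
rewrite /parrow /arr; case: insub => [w|]; last exact: q0.
by rewrite pthE bvE.
Qed.

Lemma arr_square (a b c e : F) : uniq [:: a; b; c; e] ->
  adj a b -> adj b c -> adj c e -> adj e a ->
  arr pth a b * arr pth b c = arr pth a e * arr pth e c.
Proof.
move=> u ab bc ce ea; rewrite -!q_parrow (qM (parrow K adj n a b)) (qM (parrow K adj n a e)).
by apply: q_eq; apply: ideal_rel; apply: relA2.
Qed.

Lemma arr_back (a b : F) i : adj a b -> val a i != val b i ->
  arr pth a b * arr pth b a = pth (btriv a U_(i)%MM).
Proof.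
move=> ab iab; rewrite -!q_parrow (qM (parrow K adj n a b)).
rewrite (q_eq (ideal_rel (relA3 K ab iab))) pthE; congr (q _).
rewrite -[U_(i)%MM]addm0 -(tvecM K U_(i)%MM (btriv a 0%MM)) pmE.
by congr (_ * _); [apply: tvec_var|apply: pvert_bv].
Qed.

Lemma pth_unbounded (a : F) : ~ bounded A (val a) -> pth (btriv a 0%MM) = 0.
Proof.
move=> ub; rewrite pthE -q0; apply: q_eq; apply: ideal_rel; rewrite -pvert_bv subr0.
exact: relA1.
Qed.

Lemma pth_homog x : homogeneous (ga_gr At) (mdeg (bweight x))%:Z (pth x).
Proof.
rewrite -bdegE pthE bvE.
exact: (qalg_homog (@Atilde_rel_homog R n k A K) (bvec_homog K x)).
Qed.

Lemma At_ind (S : At -> Prop) : S 0 -> (forall u v, S u -> S v -> S (u + v)) ->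
  (forall c x, S (ga_scal At c * pth x)) -> forall u, S u.
Proof.
move=> S0 SD SU; apply: qalg_ind => f; rewrite -[\pi_(_) _]/(q f).
suff H c : S (ga_scal At c * q f) by have := H 1; rewrite rmorph1 mul1r.
move: f c; apply: (@pc_ind R n k A K (fun f => forall c, S (ga_scal At c * q f))).
- by move=> c; rewrite q0 mulr0.
- move=> c f g Sf Sg e.
  have E : ga_scal At e * q (c *: f + g : PC) = ga_scal At (e * c) * q f + ga_scal At e * q g.
    by rewrite rmorphM -mulrA -mulrDr; congr (_ * _); exact: qP.
  rewrite E; exact: SD (Sf _) (Sg _).
- by move=> x c; rewrite -pthE.
Qed.

(** The common class of the paths from [g] to [a] with crossings [w]. *)
Definition mon (g a : F) (w : 'X_{1..n}) : At :=
  if pselect (exists x : B, [/\ bsrc x = g, btgt x = a & bweight x = w]) is left h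
  then pth (projT1 (cid h)) else 0.

Lemma mon_pth x : mon (bsrc x) (btgt x) (bweight x) = pth x.
Proof.
rewrite /mon; case: pselect => [h|[]]; last by exists x.
case: (cid h) => y [s t e] /=.
exact: (pth_eqkey pthM arr_square arr_back s t e).
Qed.

Variant mon_spec (g a : F) (w : 'X_{1..n}) : At -> Prop :=
| MonSpec x of bsrc x = g & btgt x = a & bweight x = w : mon_spec g a w (pth x).

Lemma monP (g a : F) w : parity (val g) (val a) w -> mon_spec g a w (mon g a w).
Proof.
move=> /(path_exists pthM)[x [<- <- <-]]; rewrite mon_pth.
exact: MonSpec.
Qed.

Lemma monM (g b a : F) w u : parity (val g) (val b) w -> parity (val b) (val a) u ->
  mon g b w * mon b a u = mon g a (w + u)%MM.
Proof.
move=> /monP[x sx tx wx] /monP[y sy ty wy].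
have [|z [-> sz tz wz]] := pth_mul pthM (x := x) (y := y); first by rewrite tx sy.
by rewrite -mon_pth sz tz wz sx ty wx wy.
Qed.

Lemma monM0 (g b b' a : F) w u : parity (val g) (val b) w -> parity (val b') (val a) u ->
  b != b' -> mon g b w * mon b' a u = 0.
Proof.
move=> /monP[x sx tx wx] /monP[y sy ty wy] bb; apply: pthM0.
by case: bmulP => // z E; rewrite -tx -sy E eqxx in bb.
Qed.

Lemma mon_ind (S : At -> Prop) : S 0 -> (forall u v, S u -> S v -> S (u + v)) ->
  (forall c (g a : F) w, parity (val g) (val a) w -> S (ga_scal At c * mon g a w)) ->
  forall u, S u.
Proof.
move=> S0 SD SU; apply: At_ind => // c x; rewrite -mon_pth.
by apply: SU; exact: bweight_parity.
Qed.

Lemma mon_homog (g a : F) w : parity (val g) (val a) w ->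
  homogeneous (ga_gr At) (mdeg w)%:Z (mon g a w).
Proof. by move=> /monP[x _ _ <-]; exact: pth_homog. Qed.

Lemma mon_triv (a : F) : mon a a 0%MM = pth (btriv a 0%MM).
Proof. by rewrite -mon_pth bweight_triv addm0. Qed.

(** Reroute the walk through the unbounded chamber. *)
Lemma mon_dead (g a : F) w : parity (val g) (val a) w -> dead g a w -> mon g a w = 0.
Proof.
move=> pw [b [ub /submK bw]]; set v := (w - _)%MM in bw.
have wE : (w = d g b + (d b a + v))%MM by rewrite -bw; apply/mnmP => i; rewrite !mnmDE; lia.
have pg := parity_dvec (val g) (val b).
have pb : parity (val b) (val a) (d b a + v)%MM by apply: (parity_sub _ pg); rewrite -wE.
have p0 : parity (val b) (val b) 0%MM by rewrite -(dvecxx (val b)) parity_dvec.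
rewrite wE -(monM pg pb) -[(_ + v)%MM]add0m -(monM p0 pb) mon_triv pth_unbounded //.
by rewrite mul0r mulr0.
Qed.

Lemma mon_sum1 : \sum_(a : F) mon a a 0%MM = 1.
Proof.
rewrite -[RHS]/(q 1).
have -> : (1 : T) = \sum_(a : F) bv K (btriv a 0%MM).
  by apply: eq_bigr => a _; apply: pvert_bv.
rewrite (big_morph q (fun f h => esym (qD f h)) q0).
by apply: eq_bigr => a _; rewrite mon_triv pthE.
Qed.

Lemma Ae_mon (a : Pvert A) : Ae K a = mon (fvert a) (fvert a) 0%MM.
Proof. by rewrite mon_triv pthE -pvert_bv. Qed.

Lemma Ap_mon (a : Pvert A) i (h : flip i (val a) \in Fset A) :
  Ap K (flip i (val a)) a = mon (Sub (flip i (val a)) h) (fvert a) U_(i)%MM.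
Proof.
set b : F := Sub (flip i (val a)) h; rewrite /Ap; case: insubP => [b' _ bE|]; last by rewrite h.
have -> : b' = b by apply: val_inj; rewrite bE.
rewrite q_parrow; have ba : adj b (fvert a) by rewrite /fadj sadj_sym; apply/sadjP; exists i.
have [x [-> s t w]] := arr_pth pth ba.
by rewrite -mon_pth s t w dvecC dvec_flip.
Qed.

Fact coef_exists : {f : F -> F -> 'X_{1..n} -> At -> K |
  (forall g a w c u v, ~ dead g a w ->
     f g a w (ga_scal At c * u + v) = c * f g a w u + f g a w v) /\
  (forall g a w x, ~ dead g a w ->
     f g a w (pth x) = ((bsrc x == g) && (btgt x == a) && (bweight x == w))%:R)}.
Proof.
exists (fun g a w u => kcoef g a w (repr u)).
have E g a w f : ~ dead g a w -> kcoef g a w (repr (q f)) = kcoef g a w f.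
  move=> nd; have := null_ideal (qalg_repr (@Atilde_rel R n k A K) f) nd.
  set r := repr _; have := kcoefP g a w (-1) f r.
  rewrite scaleN1r addrC mulN1r => E1 E2; have {}E2 := etrans (esym E1) E2.
  by apply/eqP; rewrite -subr_eq0 addrC; apply/eqP.
split=> [g a w c u v nd|g a w x nd]; last by rewrite pthE (E _ _ _ _ nd) kcoefU.
elim/qalg_ind: u => u; elim/qalg_ind: v => v.
rewrite -[\pi_(_) u]/(q u) -[\pi_(_) v]/(q v) -qZ qD (E _ _ _ _ nd) (E _ _ _ _ nd) (E _ _ _ _ nd).
exact: kcoefP.
Qed.

Definition coef : F -> F -> 'X_{1..n} -> At -> K := sval coef_exists.

Lemma coefP g a w c u v : ~ dead g a w ->
  coef g a w (ga_scal At c * u + v) = c * coef g a w u + coef g a w v.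
Proof. exact: (svalP coef_exists).1. Qed.

Lemma coef_mon (g a g' a' : F) w w' : ~ dead g a w -> parity (val g') (val a') w' ->
  coef g a w (mon g' a' w') = ((g' == g) && (a' == a) && (w' == w))%:R.
Proof.
move=> nd /monP[x <- <- <-]; exact: (svalP coef_exists).2.
Qed.

End AtildeBasis.

(** * Standard modules over the convolution algebra *)

(** From here on the algebra is known only through its monomials: they span it, are
    multiplied by adding exponents, and those which are not dead are linearly
    independent. *)
Section MonomialAlgebra.
Variables (R : realType) (n k : nat) (A : polarized R n k) (K : fieldType).
Local Notation F := (Fvert A).
Local Notation P := (Pvert A).
Local Notation d g a := (dvec (val (g : F)) (val (a : F))).
Local Notation par g a w := (parity (val (g : F)) (val (a : F)) w).
Local Notation X_ a := (Defs.basis_of A (val (a : P))).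
Local Notation fv := (@fvert R n k A).

Variables (At : galg K) (mon : F -> F -> 'X_{1..n} -> At) (coef : F -> F -> 'X_{1..n} -> At -> K).
Local Notation sc := (ga_scal At).
Hypothesis monM : forall (g b a : F) w u, par g b w -> par b a u ->
  mon g b w * mon b a u = mon g a (w + u)%MM.
Hypothesis monM0 : forall (g b b' a : F) w u, par g b w -> par b' a u -> b != b' ->
  mon g b w * mon b' a u = 0.
Hypothesis mon_ind : forall S : At -> Prop, S 0 -> (forall u v, S u -> S v -> S (u + v)) ->
  (forall c (g a : F) w, par g a w -> S (sc c * mon g a w)) -> forall u, S u.
Hypothesis mon_homog : forall (g a : F) w, par g a w ->
  homogeneous (ga_gr At) (mdeg w)%:Z (mon g a w).
Hypothesis mon_dead : forall (g a : F) w, par g a w -> dead g a w -> mon g a w = 0.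
Hypothesis mon_sum1 : \sum_(a : F) mon a a 0%MM = 1.
Hypothesis coefP : forall g a w c u v, ~ dead g a w ->
  coef g a w (sc c * u + v) = c * coef g a w u + coef g a w v.
Hypothesis coef_mon : forall (g a g' a' : F) w w', ~ dead g a w -> par g' a' w' ->
  coef g a w (mon g' a' w') = ((g' == g) && (a' == a) && (w' == w))%:R.

Variables (e : P -> At) (arrow : svec n -> P -> At).
Hypothesis eE : forall a : P, e a = mon (fv a) (fv a) 0%MM.
Hypothesis arrowE : forall (a : P) i (h : flip i (val a) \in Fset A),
  arrow (flip i (val a)) a = mon (Sub (flip i (val a)) h) (fv a) U_(i)%MM.

Lemma par0 (a : F) : par a a 0%MM.
Proof. by rewrite -(dvecxx (val a)) parity_dvec. Qed.

Lemma fv_inj : injective fv.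
Proof. by move=> a b /(congr1 val) E; apply: val_inj. Qed.

Lemma notP_unbounded (b : F) : val b \notin Pset A -> ~ bounded A (val b).
Proof. by rewrite inE (valP b) /= => /asboolP. Qed.

Definition toP (b : F) (h : val b \in Pset A) : P := Sub (val b) h.
Lemma toPK (b : F) h : fv (@toP b h) = b. Proof. exact: val_inj. Qed.

Lemma mon_unbounded_l (b a : F) w : par b a w -> val b \notin Pset A -> mon b a w = 0.
Proof.
move=> p ub; apply: mon_dead => //; exists b; split; first exact: notP_unbounded.
by rewrite dvecxx add0m; apply: parity_ge.
Qed.

Lemma eM (a b : P) : e a * e b = if a == b then e a else 0.
Proof.
rewrite !eE; case: eqP => [->|/eqP ab]; first by rewrite monM ?par0 // addm0.
by apply: monM0; rewrite ?par0 // (inj_eq fv_inj).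
Qed.

Lemma big_Pvert (f : F -> At) : (forall b : F, val b \notin Pset A -> f b = 0) ->
  \sum_(b : F) f b = \sum_(a : P) f (fv a).
Proof.
move=> f0; rewrite (bigID (fun b : F => val b \in Pset A)) /= [X in _ + X]big1 ?addr0; last first.
  by move=> b /f0.
transitivity (\sum_(b in fv @: [set: P]) f b); last first.
  rewrite big_imset /=; last by move=> a b _ _; exact: fv_inj.
  by apply: eq_bigl => a; rewrite inE.
apply: eq_bigl => b; apply/idP/imsetP => [h|[a _ ->]]; last exact: (valP a).
by exists (toP h); rewrite ?inE ?toPK.
Qed.

Lemma e_sum : \sum_(a : P) e a = 1.
Proof.
rewrite -mon_sum1 (big_Pvert (f := fun a => mon a a 0%MM)); first by apply: eq_bigr => a _; exact: eE.
by move=> b; apply: mon_unbounded_l; apply: par0.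
Qed.

Lemma scal_homog c i (x : At) : homogeneous (ga_gr At) i x -> homogeneous (ga_gr At) i (sc c * x).
Proof. by move=> hx; rewrite -[i]add0r; apply: ga_mul_homog (ga_scal_homog At c) hx. Qed.

Lemma pr_mon j c (g a : F) w : par g a w ->
  pr (ga_gr At) j (sc c * mon g a w) = if j == (mdeg w)%:Z then sc c * mon g a w else 0.
Proof. by move=> p; apply: pr_homog; apply: scal_homog; apply: mon_homog. Qed.

Lemma A_neg j (x : At) : j < 0 -> pr (ga_gr At) j x = 0.
Proof.
move=> j0; move: x; apply: mon_ind => [|u v hu hv|c g a w p].
- exact: pr0.
- by rewrite prD hu hv addr0.
- by rewrite pr_mon // lt_eqF //; apply: lt_le_trans j0 _.
Qed.

Lemma A_zero x : homogeneous (ga_gr At) 0 x -> exists c : P -> K, x = \sum_a sc (c a) * e a.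
Proof.
move=> <-; move: x; apply: mon_ind => [|u v [c hc] [c' hc']|c g a w p].
- by exists (fun=> 0); rewrite pr0 big1 // => a _; rewrite rmorph0 mul0r.
- exists (fun a => c a + c' a); rewrite prD hc hc' -big_split; apply: eq_bigr => a _.
  by rewrite rmorphD mulrDl.
rewrite pr_mon //; case: eqP => [[E]|_]; last first.
  by exists (fun=> 0); rewrite big1 // => b _; rewrite rmorph0 mul0r.
have w0 : w = 0%MM by apply/eqP; rewrite -mdeg_eq0 -E.
move: p; rewrite w0 => p; have /val_inj ga := parity0 p; rewrite ga in p *.
case: (boolP (val a \in Pset A)) => [h|h]; last first.
  exists (fun=> 0); rewrite mon_unbounded_l // mulr0 big1 // => b _.
  by rewrite rmorph0 mul0r.
exists (fun b => if b == toP h then c else 0); rewrite (bigD1 (toP h)) //= eqxx.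
rewrite big1 ?addr0 => [|b /negPf ->]; last by rewrite rmorph0 mul0r.
by rewrite eE toPK.
Qed.

Lemma A_fd j : exists r (b : 'I_r -> At), forall x,
  homogeneous (ga_gr At) j x -> exists c : 'I_r -> K, x = \sum_i sc (c i) * b i.
Proof.
case: (ltP j 0) => [j0|].
  by exists 0%N, (fun=> 0) => x <-; exists (fun=> 0); rewrite A_neg // big_ord0.
case: j => // m _; pose J := (F * F * 'X_{1..n < m.+1})%type.
pose b (t : J) := mon t.1.1 t.1.2 t.2.
exists #|{: J}|, (fun i => b (enum_val i)) => x <-.
suff [c ->] : exists c : J -> K, pr (ga_gr At) m%:Z x = \sum_t sc (c t) * b t.
  exists (fun i => c (enum_val i)).
  by rewrite -(big_enum_val (fun t : J => sc (c t) * b t)).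
move: x; apply: mon_ind => [|u v [c hc] [c' hc']|c g a w p].
- by exists (fun=> 0); rewrite pr0 big1 // => a _; rewrite rmorph0 mul0r.
- exists (fun a => c a + c' a); rewrite prD hc hc' -big_split; apply: eq_bigr => a _.
  by rewrite rmorphD mulrDl.
rewrite pr_mon //; case: eqP => [[E]|_]; last first.
  by exists (fun=> 0); rewrite big1 // => t _; rewrite rmorph0 mul0r.
have wm : (mdeg w < m.+1)%N by rewrite -E.
pose t0 : J := (g, a, BMultinom wm).
exists (fun t => if t == t0 then c else 0); rewrite (bigD1 t0) //= eqxx.
by rewrite big1 ?addr0 => [//|t /negPf ->]; rewrite rmorph0 mul0r.
Qed.

(** ** The central polynomial subalgebra *)

(** The monomial [t^u] in the central variables. *)
Definition tmon (u : 'X_{1..n}) : At := \sum_(g : F) mon g g (u + u)%MM.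

Lemma tmonMl u (g a : F) w : par g a w -> tmon u * mon g a w = mon g a ((u + u) + w)%MM.
Proof.
move=> p; rewrite /tmon mulr_suml (bigD1 g) //= big1 ?addr0 => [|b bg].
  by rewrite monM // parity2.
by rewrite (monM0 _ p) // parity2.
Qed.

Lemma tmonMr u (g a : F) w : par g a w -> mon g a w * tmon u = mon g a ((u + u) + w)%MM.
Proof.
move=> p; rewrite /tmon mulr_sumr (bigD1 a) //= big1 ?addr0 => [|b ba].
  by rewrite monM ?parity2 // addmC.
by rewrite (monM0 p) ?parity2 // eq_sym.
Qed.

Lemma tmonC u x : tmon u * x = x * tmon u.
Proof.
move: x; apply: mon_ind => [|x y hx hy|c g a w p]; first by rewrite mulr0 mul0r.
  by rewrite mulrDr mulrDl hx hy.
by rewrite -mulrA tmonMr // -(tmonMl u p) !mulrA ga_scalC.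
Qed.

Lemma tmonD u v : tmon u * tmon v = tmon (u + v)%MM.
Proof.
rewrite {2}/tmon mulr_sumr; apply: eq_bigr => g _; rewrite tmonMl ?parity2 //.
by congr mon; apply/mnmP => i; rewrite !mnmDE; lia.
Qed.

Lemma tmon0 : tmon 0%MM = 1.
Proof. by rewrite /tmon -mon_sum1; apply: eq_bigr => g _; rewrite addm0. Qed.

Lemma tmon_homog u : homogeneous (ga_gr At) (2 * mdeg u)%N%:Z (tmon u).
Proof.
rewrite /tmon; elim/big_ind: _ => [||g _]; [exact: homog0|exact: homogD|].
by have := mon_homog (parity2 (val g) u); rewrite mdegD addnn mul2n.
Qed.

Lemma kscalar_or_mem (ts : seq At) z : z \in ts -> kscalar_or (K := K) ts z.
Proof.
elim: ts => // t ts IH; rewrite inE => /orP[/eqP ->|/IH h] /=; first by right.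
by left.
Qed.

(** The algebra is generated by the classes of taut paths as a module over the
    polynomials in the [t_i]. *)
Lemma At_noetherian (M : fgmod At) (N : gsubmod M) : finitely_generated (gsub N).
Proof.
apply: (noetherian_finite_over_central (ts := [seq tmon U_(i)%MM | i : 'I_n])
  (bs := [seq mon t.1 t.2 (d t.1 t.2) | t : F * F])).
  by move=> t a /mapP[i _ ->]; apply: tmonC.
move=> S [S0 SD SZ] Sb.
have St u x : S x -> S (tmon u * x).
  have [m le_m] := ubnP (mdeg u); elim: m => // m IH in u x le_m *; move=> Sx.
  case: (eqVneq u 0%MM) => [->|u0]; first by rewrite tmon0 mul1r.
  have [i ui] : exists i, u i != 0%N.
    apply/existsP; apply: contraNT u0; rewrite negb_exists => /forallP h.
    by apply/eqP/mnmP => i; rewrite mnm0E; have := h i; rewrite negbK => /eqP.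
  have le : (U_(i) <= u)%MM.
    by apply/mnm_lepP => j; rewrite mnm1E; case: eqP => // <-; rewrite lt0n.
  have uE := submK le; move: uE; set v := (u - _)%MM => uE.
  rewrite -uE addmC -tmonD -mulrA; apply: (SZ (tmon U_(i)%MM) (tmon v * x)).
    by apply: kscalar_or_mem; apply/mapP; exists i; rewrite ?mem_enum.
  by apply: IH => //; move: le_m; rewrite -uE mdegD mdeg1 addn1 ltnS.
apply: mon_ind => // c g a w /parity_half[u ->].
apply: (SZ (sc c) (mon g a (d g a + (u + u))%MM)); first by apply: kscalar_or_sub; exists c.
rewrite addmC -tmonMl ?parity_dvec //; apply: St; apply: Sb.
by apply/mapP; exists (g, a); rewrite ?mem_enum.
Qed.

(** ** Monomials at a standard module *)

Local Notation in_cone b g := (agree (X_ b) (val g) (val b)).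

Definition avoids (S : {set 'I_n}) (w : 'X_{1..n}) : Prop := forall i, i \in S -> w i = 0%N.

Lemma avoids_parity S (g a : F) w : avoids S w -> par g a w -> agree S (val g) (val a).
Proof.
by move=> h /parityP p i iS; have := p i; rewrite h // => /esym/negbFE/eqP.
Qed.

Lemma agree_dvec S (g a : F) : agree S (val g) (val a) -> avoids S (d g a).
Proof. by move=> h i iS; rewrite dvecE h // eqxx. Qed.

Lemma agree_sym (S : {set 'I_n}) (g a : svec n) : agree S g a -> agree S a g.
Proof. by move=> h i iS; rewrite h. Qed.
Lemma agree_trans (S : {set 'I_n}) (g b a : svec n) : agree S g b -> agree S b a -> agree S g a.
Proof. by move=> h1 h2 i iS; rewrite h1 // h2. Qed.

(** Monomials that stay in the cone at the vertex of [b] are not killed: a chamber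
    of this cone is bounded. *)
Lemma alive (b : P) (g a : F) w : in_cone b g -> avoids (X_ b) w -> ~ dead g a w.
Proof.
move=> gb av [c [ub /mnm_lepP le]]; apply: ub.
have gc : in_cone b c.
  apply: agree_trans (gb); apply: agree_sym => i iS; apply/eqP; have := le i; rewrite av // mnmDE !dvecE.
  by case: eqP.
have [] := agree_Pset (valP b) (valP c) gc.
by rewrite inE => /andP[_ /asboolP].
Qed.

(** The elements none of whose monomials stays in the cone at the vertex of [b]. *)
Definition off_cone (b : P) (y : At) : Prop := forall (g a : F) w,
  in_cone b g -> avoids (X_ b) w -> par g a w -> coef g a w y = 0.

Lemma coef_scal (g a : F) w c u : ~ dead g a w -> coef g a w (sc c * u) = c * coef g a w u.
Proof.
move=> nd; have c0 : coef g a w 0 = 0.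
  have := coefP 1 0 0 nd; rewrite rmorph1 mul1r addr0 mul1r => h.
  by apply: (addrI (coef g a w 0)); rewrite addr0 -h.
by have := coefP c u 0 nd; rewrite addr0 c0 addr0.
Qed.

Lemma coefD (g a : F) w u v : ~ dead g a w -> coef g a w (u + v) = coef g a w u + coef g a w v.
Proof. by move=> nd; have := coefP 1 u v nd; rewrite rmorph1 !mul1r. Qed.

Lemma coef0 (g a : F) w : ~ dead g a w -> coef g a w 0 = 0.
Proof. by move=> nd; have := coef_scal 0 0 nd; rewrite mulr0 mul0r. Qed.

Lemma off_cone0 b : off_cone b 0.
Proof. by move=> g a w gb av p; apply: coef0; apply: alive gb av. Qed.

Lemma off_coneD b u v : off_cone b u -> off_cone b v -> off_cone b (u + v).
Proof.
move=> hu hv g a w gb av p; rewrite coefD; last exact: alive gb av.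
by rewrite hu // hv // addr0.
Qed.

Lemma off_cone_mon b c (g a : F) w : par g a w -> ~ avoids (X_ b) w -> off_cone b (sc c * mon g a w).
Proof.
move=> p nav g' a' w' gb av p'; have nd := alive gb av (a := a'); rewrite coef_scal // coef_mon //.
by case: eqP => // _; case: eqP => // _; case: eqP => [E|_]; rewrite ?mulr0 //; case: nav; rewrite E.
Qed.

Lemma off_cone_mull b u (c a : F) w : par c a w ->
  (forall (g : F) v, par g c v -> ~ avoids (X_ b) (v + w)%MM) -> off_cone b (u * mon c a w).
Proof.
move=> p h; move: u; apply: mon_ind => [|x y hx hy|s g c' v pv].
- by rewrite mul0r; apply: off_cone0.
- by rewrite mulrDl; apply: off_coneD.
- rewrite -mulrA; case: (eqVneq c' c) => [E|cc].
    subst c'; rewrite monM //; apply: off_cone_mon; first exact: parityD pv p.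
    exact: (h g v pv).
  by rewrite (monM0 pv p cc) mulr0; apply: off_cone0.
Qed.

(** ** The ideal defining a standard module *)

Local Notation in_ideal N x := (((x : At) : gregular At) \in gs_pred N : Prop).

Lemma idealZ (N : gsubmod (gregular At)) (u x : At) : in_ideal N x -> in_ideal N (u * x).
Proof. by move=> h; have [z0 zl] := gs_closed N; have := zl u x 0 h z0; rewrite addr0. Qed.
Lemma idealD (N : gsubmod (gregular At)) (x y : At) :
  in_ideal N x -> in_ideal N y -> in_ideal N (x + y).
Proof. exact: rpredD. Qed.
Lemma ideal0 (N : gsubmod (gregular At)) : in_ideal N 0.
Proof. exact: rpred0. Qed.
Lemma idealB (N : gsubmod (gregular At)) (x y : At) :
  in_ideal N x -> in_ideal N y -> in_ideal N (x - y).
Proof. by move=> hx hy; apply: idealD => //; rewrite -mulN1r; apply: idealZ. Qed.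

Hypothesis e_homog : forall (a : P) (u : unit), homogeneous (gm_gr (gregular At)) 0 (e a).
Hypothesis arrow_homog : forall (a : P) (i : 'I_n),
  homogeneous (gm_gr (gregular At)) 1 (arrow (flip i (val a)) a).

Definition Vsub (a : P) : gsubmod (gregular At) := gspan (mem (X_ a)) (arrow_homog a).

Lemma Vsub_ind a (S : At -> Prop) : S 0 -> (forall x y, S x -> S y -> S (x + y)) ->
  (forall i (h : flip i (val a) \in Fset A) u, i \in X_ a ->
     S (u * mon (Sub (flip i (val a)) h) (fv a) U_(i)%MM)) ->
  forall x : At, in_ideal (Vsub a) x -> S x.
Proof.
move=> S0 SD SU x /asboolP[c ->]; elim/big_ind: _ => // i iS.
have h := flip_feasible (valP a) iS.
rewrite -[_ *: _]/(c i * arrow (flip i (val a)) a) (arrowE h).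
exact: SU.
Qed.

Lemma Vsub_gen a i (h : flip i (val a) \in Fset A) : i \in X_ a ->
  in_ideal (Vsub a) (mon (Sub (flip i (val a)) h) (fv a) U_(i)%MM).
Proof.
move=> iS; apply/asboolP; exists (fun j => (j == i)%:R).
rewrite (bigD1 i) //= eqxx scale1r (arrowE h) big1 ?addr0 // => j /andP[_ /negPf ->].
by rewrite scale0r.
Qed.

(** A monomial crossing one of the hyperplanes through the vertex ends, up to
    reordering, with that crossing. *)
Lemma Vsub_touch (b : P) (g : F) w : par g (fv b) w -> ~ avoids (X_ b) w ->
  in_ideal (Vsub b) (mon g (fv b) w).
Proof.
move=> p /existsNP[i /not_implyP[iS wi]].
have h := flip_feasible (valP b) iS; pose c : F := Sub (flip i (val b)) h.
have pc : par c (fv b) U_(i)%MM.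
  by rewrite -(dvec_flip (val b) i) dvecC; apply: parity_dvec.
have le : (U_(i) <= w)%MM.
  by apply/mnm_lepP => j; rewrite mnm1E; case: eqP => // <-; rewrite lt0n; apply/eqP.
have wE := submK le; set v := (w - _)%MM in wE.
have pg : par g c v.
  apply/parityP => l; move/parityP/(_ l): p; rewrite -wE mnmDE oddD.
  by move/parityP/(_ l): pc => ->; case: (odd _); case: (val c l) (val g l) (val (fv b) l) => [] [] [].
by rewrite -wE -(monM pg pc); apply: idealZ; apply: Vsub_gen.
Qed.

Lemma Vsub_off (b : P) (y : At) : in_ideal (Vsub b) y -> off_cone b y.
Proof.
move: y; apply: Vsub_ind => [|x y|i h u iS]; [exact: off_cone0|exact: off_coneD|].
apply: off_cone_mull => [|g v _ /(_ i iS)].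
  by rewrite -(dvec_flip (val b) i) dvecC; apply: parity_dvec.
by rewrite mnmDE mnm1E eqxx addn1.
Qed.

(** ** Polynomials in the variables off the vertex *)

Section Cone.
Variable b : P.
Local Notation m := #|~: X_ b|.

(** The variables [z_1, ..., z_m] are the [t_i] for [i] off the vertex of [b]; this
    translates exponents. *)
Definition iota (u : 'X_{1..m}) : 'X_{1..n} :=
  [multinom (\sum_(j < m | enum_val j == i) u j)%N | i < n].

Lemma iotaE u j : iota u (enum_val j) = u j.
Proof.
rewrite /iota mnmE (big_pred1 j) // => i.
by rewrite (inj_eq enum_val_inj).
Qed.

Lemma iota_avoids u : avoids (X_ b) (iota u).
Proof.
move=> i iS; rewrite /iota mnmE big1 // => j /eqP ji.
by have := enum_valP j; rewrite ji inE iS.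
Qed.

Lemma iota_surj w : avoids (X_ b) w -> exists u, w = iota u.
Proof.
move=> av; exists [multinom w (enum_val j) | j < m]; apply/mnmP => i.
case: (boolP (i \in X_ b)) => [iS|iS]; first by rewrite av // iota_avoids.
have iC : i \in ~: X_ b by rewrite inE.
by rewrite -(enum_rankK_in iC iC) iotaE mnmE.
Qed.

Lemma iotaD u v : iota (u + v) = (iota u + iota v)%MM.
Proof.
apply/mnmP => i; rewrite mnmDE /iota !mnmE -big_split; apply: eq_bigr => j _.
exact: mnmDE.
Qed.

Lemma iota_inj : injective iota.
Proof.
by move=> u v E; apply/mnmP => j; rewrite -!iotaE E.
Qed.

Lemma iota0 : iota 0%MM = 0%MM.
Proof. by apply/mnmP => i; rewrite /iota mnmE mnm0E big1 // => j _; rewrite mnm0E. Qed.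

Lemma mdeg_iota u : mdeg (iota u) = mdeg u.
Proof.
rewrite !mdegE; under eq_bigr do rewrite /iota mnmE.
rewrite (exchange_big_dep predT) //=; apply: eq_bigr => j _.
by rewrite (big_pred1 (enum_val j)) // => i; rewrite eq_sym.
Qed.

Local Notation poly := (mpoly.mpoly m K).

(** The value of a polynomial in the [z_j] in the center of the algebra. *)
Definition zeval (p : poly) : At := \sum_(u <- mpoly.msupp p) sc p@_u * tmon (iota u).

Lemma zevalE N p : (mpoly.msize p <= N)%N ->
  zeval p = \sum_(u : 'X_{1..m < N}) sc p@_u * tmon (iota u).
Proof.
move=> le; pose I : subFinType _ := 'X_{1..m < N}.
rewrite /zeval (big_mksub I) ?mpoly.msupp_uniq //=; last first.
  by move=> u /mpoly.msize_mdeg_lt /leq_trans; apply.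
by rewrite big_rmcond //= => u /mpoly.memN_msupp_eq0 ->; rewrite rmorph0 mul0r.
Qed.

Lemma zevalP c p q : zeval (c *: p + q) = sc c * zeval p + zeval q.
Proof.
pose N := maxn (mpoly.msize (c *: p + q)) (maxn (mpoly.msize p) (mpoly.msize q)).
rewrite !(@zevalE N) ?leq_max ?leqnn ?orbT //.
rewrite mulr_sumr -big_split; apply: eq_bigr => u _.
by rewrite mpoly.mcoeffD mpoly.mcoeffZ rmorphD rmorphM mulrDl mulrA.
Qed.

Lemma zeval0 : zeval 0 = 0.
Proof. by rewrite /zeval mpoly.msupp0 big_nil. Qed.
Lemma zevalD p q : zeval (p + q) = zeval p + zeval q.
Proof. by have := zevalP 1 p q; rewrite scale1r rmorph1 mul1r. Qed.
Lemma zevalZ c p : zeval (c *: p) = sc c * zeval p.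
Proof. by have := zevalP c p 0; rewrite zeval0 !addr0. Qed.
Lemma zevalX u : zeval 'X_[u] = tmon (iota u).
Proof. by rewrite /zeval mpoly.msuppX big_seq1 mpoly.mcoeffX eqxx rmorph1 mul1r. Qed.
Lemma zeval1 : zeval 1 = 1.
Proof. by rewrite -mpoly.mpolyX0 zevalX iota0 tmon0. Qed.

Lemma zevalC p x : zeval p * x = x * zeval p.
Proof.
rewrite /zeval mulr_suml mulr_sumr; apply: eq_bigr => u _.
by rewrite -mulrA tmonC mulrA ga_scalC mulrA.
Qed.

Lemma zevalM p q : zeval (p * q) = zeval p * zeval q.
Proof.
have X1 u q' : zeval ('X_[u] * q') = tmon (iota u) * zeval q'.
  elim/mpoly.mpolyind: q' => [|c v q' _ _ IH]; first by rewrite mulr0 zeval0 mulr0.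
  rewrite mulrDr -scalerAr -mpoly.mpolyXD !zevalP IH !zevalX iotaD -tmonD mulrDr.
  by rewrite !mulrA ga_scalC.
elim/mpoly.mpolyind: p => [|c u p _ _ IH]; first by rewrite mul0r zeval0 mul0r.
by rewrite mulrDl -scalerAl !zevalP IH X1 zevalX mulrDl mulrA.
Qed.

Definition wt2 : 'I_m -> nat := fun=> 2.

Lemma whomogE j (p : poly) : whomog wt2 j p <->
  forall u, u \in mpoly.msupp p -> (2 * mdeg u)%N%:Z = j.
Proof.
have E (u : 'X_{1..m}) : (\sum_i wt2 i * u i)%N = (2 * mdeg u)%N by rewrite mdegE big_distrr.
by split=> h u /h; rewrite E.
Qed.

Lemma zeval_homog j (p : poly) : whomog wt2 j p -> homogeneous (ga_gr At) j (zeval p).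
Proof.
move=> /whomogE h; rewrite /zeval big_seq.
elim/big_ind: _ => [||u us]; [exact: homog0|exact: homogD|].
by apply: scal_homog; rewrite -(h u us) -mdeg_iota; apply: tmon_homog.
Qed.

Definition wpart (j : int) (p : poly) : poly :=
  \sum_(u <- mpoly.msupp p | (2 * mdeg u)%N%:Z == j) p@_u *: 'X_[u].

Lemma mcoeff_wpart j p u : (wpart j p)@_u = if (2 * mdeg u)%N%:Z == j then p@_u else 0.
Proof.
rewrite /wpart linear_sum /=.
under eq_bigr do rewrite mpoly.mcoeffZ mpoly.mcoeffX.
case: (boolP (u \in mpoly.msupp p)) => us; last first.
  rewrite mpoly.memN_msupp_eq0 // if_same big_seq_cond big1 // => v /andP[vs _].
  by case: eqP => [E|]; rewrite ?mulr0 //; rewrite E (negPf us) in vs.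
rewrite big_mkcond (bigD1_seq u) ?mpoly.msupp_uniq //= eqxx mulr1 big1 ?addr0 // => v /negPf vu.
by rewrite vu mulr0; case: ifP.
Qed.

Lemma wpart_homog j p : whomog wt2 j (wpart j p).
Proof.
apply/whomogE => u; rewrite mpoly.mcoeff_msupp mcoeff_wpart.
by case: ifP => [/eqP //|_]; rewrite eqxx.
Qed.

Lemma wpart_id j (p : poly) : whomog wt2 j p -> wpart j p = p.
Proof.
move=> /whomogE h; apply/mpoly.mpolyP => u; rewrite mcoeff_wpart.
case: (boolP (u \in mpoly.msupp p)) => [/h ->|us]; first by rewrite eqxx.
by rewrite mpoly.memN_msupp_eq0 // if_same.
Qed.

Lemma wpartP j c p q : wpart j (c *: p + q) = c *: wpart j p + wpart j q.
Proof.
apply/mpoly.mpolyP => u; rewrite mpoly.mcoeffD mpoly.mcoeffZ !mcoeff_wpart.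
by rewrite mpoly.mcoeffD mpoly.mcoeffZ; case: ifP => // _; rewrite mulr0 addr0.
Qed.

Lemma pr_zeval j p (x : At) i : homogeneous (ga_gr At) i x ->
  pr (ga_gr At) j (zeval p * x) = zeval (wpart (j - i) p) * x.
Proof.
move=> hx; rewrite /wpart (big_morph zeval zevalD zeval0) {1}/zeval mulr_suml pr_bigsum mulr_suml.
rewrite [RHS]big_mkcond; apply: eq_bigr => u _; rewrite zevalZ zevalX.
have h : homogeneous (ga_gr At) ((2 * mdeg u)%N%:Z + i) (sc p@_u * tmon (iota u) * x).
  by apply: ga_mul_homog => //; apply: scal_homog; rewrite -mdeg_iota; apply: tmon_homog.
by rewrite (pr_homog _ h) -subr_eq eq_sym.
Qed.

(** ** The cone at the vertex *)

(** Modulo the ideal, only the monomials that stay in the cone survive; from a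
    given chamber they are the products of one of them with polynomials in the
    variables off the vertex. *)
Lemma cone_span (x : At) (g : F) : in_cone b g ->
  exists p, in_ideal (Vsub b) (mon g g 0%MM * x * e b - zeval p * mon g (fv b) (d g (fv b))).
Proof.
move=> gb; move: x; apply: mon_ind => [|x y [p hp] [q hq]|c g' a w pw].
- by exists 0; rewrite mulr0 mul0r zeval0 mul0r subrr; apply: ideal0.
- exists (p + q); rewrite mulrDr mulrDl zevalD mulrDl opprD addrACA.
  exact: idealD.
have E : mon g g 0%MM * (sc c * mon g' a w) * e b =
    if (g' == g) && (a == fv b) then sc c * mon g (fv b) w else 0.
  rewrite eE mulrA -ga_scalC -!mulrA; case: (eqVneq a (fv b)) pw => [->|ab] pw; last first.
    by rewrite (monM0 pw (par0 (fv b)) ab) mulr0 mulr0 andbF.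
  rewrite (monM pw (par0 _)) addm0 andbT; case: eqVneq pw => [->|gg] pw.
    by rewrite monM ?par0 // add0m.
  by rewrite (monM0 (par0 g) pw) ?mulr0 // eq_sym.
case: eqP E => [gE|_] E; last by exists 0; rewrite E zeval0 mul0r subr0; apply: ideal0.
case: eqP E => [aE|_] E; last by exists 0; rewrite E zeval0 mul0r subr0; apply: ideal0.
rewrite (E : _ = sc c * mon g (fv b) w); rewrite gE aE in pw.
have [av|nav] := pselect (avoids (X_ b) w); last first.
  by exists 0; rewrite zeval0 mul0r subr0; apply: idealZ; apply: Vsub_touch.
have [v wE] := parity_half pw.
have [u vE] : exists u, v = iota u.
  apply: iota_surj => i iS; have := av i iS; rewrite wE !mnmDE.
  by case: (v i) => // j; rewrite addnS addnS.
exists (c *: 'X_[u]); rewrite zevalZ zevalX -mulrA tmonMl ?parity_dvec // -vE wE addmC.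
by rewrite subrr; apply: ideal0.
Qed.

Lemma cone_span_off (x : At) (g : F) : ~ in_cone b g ->
  in_ideal (Vsub b) (mon g g 0%MM * x * e b).
Proof.
move=> gb; move: x; apply: mon_ind => [|x y hx hy|c g' a w pw].
- by rewrite mulr0 mul0r; apply: ideal0.
- by rewrite mulrDr mulrDl; apply: idealD.
rewrite eE mulrA -ga_scalC -!mulrA; case: (eqVneq a (fv b)) pw => [->|ab] pw; last first.
  by rewrite (monM0 pw (par0 (fv b)) ab) mulr0 mulr0; apply: ideal0.
rewrite (monM pw (par0 _)) addm0; case: (eqVneq g g') pw => [<-|gg] pw; last first.
  by rewrite (monM0 (par0 g) pw) // mulr0; apply: ideal0.
rewrite monM ?par0 // add0m; apply: idealZ; apply: Vsub_touch => //.
by move=> av; apply: gb; apply: avoids_parity av pw.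
Qed.

(** The monomials that stay in the cone are not dead, so their coefficients recover
    those of [p]. *)
Lemma cone_free p (g a : F) w : par g a w -> in_cone b g -> avoids (X_ b) w ->
  off_cone b (zeval p * mon g a w) -> p = 0.
Proof.
move=> pw gb av off; apply/mpoly.mpolyP => u; rewrite mpoly.mcoeff0.
set v := (iota u + iota u + w)%MM.
have vav : avoids (X_ b) v by move=> i iS; rewrite !mnmDE iota_avoids // av.
have pv : par g a v := parityD (parity2 _ _) pw.
have nd := alive gb vav (a := a).
rewrite -(off g a v gb vav pv) /zeval mulr_suml.
rewrite (big_morph _ (fun x y => coefD x y nd) (coef0 nd)).
have E t : coef g a v (sc p@_t * tmon (iota t) * mon g a w) = p@_t * (t == u)%:R.
  rewrite -mulrA tmonMl // coef_scal // (coef_mon nd); last exact: parityD (parity2 _ _) pw.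
  rewrite !eqxx /=; congr (_ * (nat_of_bool _)%:R); apply/eqP/eqP => [h|-> //].
  apply: iota_inj; apply/mnmP => i; have := congr1 (fun z : 'X_{1..n} => z i) h.
  by rewrite !mnmDE; lia.
under eq_bigr do rewrite E.
case: (boolP (u \in mpoly.msupp p)) => us; last first.
  rewrite mpoly.memN_msupp_eq0 // big_seq big1 // => t ts.
  by case: eqP => [tu|]; rewrite ?mulr0 //; rewrite tu (negPf us) in ts.
rewrite (bigD1_seq u) ?mpoly.msupp_uniq //= eqxx mulr1 big1 ?addr0 // => t /negPf ->.
by rewrite mulr0.
Qed.

End Cone.

(** ** Standard modules *)

Local Notation C := (gmodcat At).
Local Notation Pm := (Pmod e_homog).
Local Notation Pg := (Pgen e_homog eM).

Definition Vmod (a : P) : fgmod At :=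
  FGMod (gquot_fg (grestrict (gspan predT (e_homog a)) (Vsub a)) (gsub_span_fg predT (e_homog a))).

Definition rho a : ghom (Pm a) (Vmod a) := gproj (grestrict (gspan predT (e_homog a)) (Vsub a)).

Definition vgen a : Vmod a := rho a (Pg a).

Lemma rho_eq0 a (x : Pm a) : rho a x = 0 <-> in_ideal (Vsub a) (val x).
Proof. exact: gproj_eq0. Qed.

Lemma rho_surj a y : exists x, rho a x = y.
Proof. exact: gproj_surj. Qed.

Lemma vgen_homog a : homogeneous (gm_gr (Vmod a)) 0 (vgen a).
Proof. by apply: gh_homog; apply: Pgen_homog. Qed.

Lemma vgen_e a : e a *: vgen a = vgen a.
Proof. by rewrite -ghomZ Pgen_e. Qed.

Lemma rhoE a (x : Pm a) : rho a x = (val x : At) *: vgen a.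
Proof. by rewrite -ghomZ -Pgen_gen. Qed.

Lemma vgen_gen a y : exists x : At, y = x *: vgen a.
Proof. by have [x <-] := rho_surj y; exists (val x : At); rewrite -rhoE. Qed.

Lemma mon_e (g : F) (b : P) w : par g (fv b) w -> mon g (fv b) w * e b = mon g (fv b) w.
Proof. by move=> p; rewrite eE monM ?par0 // addm0. Qed.

Lemma vgen_eq0 a (x : At) : x *: vgen a = 0 <-> in_ideal (Vsub a) (x * e a).
Proof. by rewrite -ghomZ rho_eq0. Qed.

Lemma Vsub_e a (x : At) : in_ideal (Vsub a) x -> x * e a = x.
Proof.
move: x; apply: Vsub_ind => [|x y hx hy|i h u iS]; first by rewrite mul0r.
  by rewrite mulrDl hx hy.
by rewrite -mulrA mon_e // -(dvec_flip (val a) i) dvecC; apply: parity_dvec.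
Qed.

Lemma Vsub_vgen a (x : At) : in_ideal (Vsub a) x -> x *: vgen a = 0.
Proof. by move=> h; apply/vgen_eq0; rewrite Vsub_e. Qed.

Local Notation vmon b g := (mon g (fv b) (d g (fv b)) *: vgen b).

(** Together with [V_inj]: at a chamber of the cone, the weight space of the standard
    module is free of rank one over the polynomials in the variables off the
    vertex. *)
Lemma V_weight b (g : F) y : in_cone b g -> mon g g 0%MM *: y = y ->
  exists p, y = zeval (b := b) p *: vmon b g.
Proof.
move=> gb gy; have [x yE] := vgen_gen y; have [p hp] := cone_span x gb; exists p.
rewrite -gy yE -(vgen_e b) !scalerA; apply/eqP; rewrite -subr_eq0 -scalerBl; apply/eqP.
rewrite -[zeval p * _ * e b]mulrA mon_e ?parity_dvec //.
exact: Vsub_vgen.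
Qed.

Lemma V_weight_off b (g : F) (y : Vmod b) : ~ in_cone b g ->
  mon g g 0%MM *: y = y -> y = 0.
Proof.
move=> gb gy; have [x yE] := vgen_gen y.
rewrite -gy yE -(vgen_e b) !scalerA.
by apply: Vsub_vgen; apply: cone_span_off.
Qed.

Lemma pr_vgen j a (x : At) : pr (gm_gr (Vmod a)) j (x *: vgen a) = pr (ga_gr At) j x *: vgen a.
Proof. by rewrite (pr_scale_homogeneous _ _ (vgen_homog a)) subr0. Qed.

Lemma V_weight_homog b (g : F) y j : in_cone b g -> mon g g 0%MM *: y = y ->
  homogeneous (gm_gr (Vmod b)) j y ->
  exists p, whomog (wt2 (b := b)) (j - (mdeg (d g (fv b)))%:Z) p /\ y = zeval p *: vmon b g.
Proof.
move=> gb gy hy; have [p yE] := V_weight gb gy.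
exists (wpart (j - (mdeg (d g (fv b)))%:Z) p); split; first exact: wpart_homog.
have hm := mon_homog (parity_dvec (val g) (val (fv b))).
by rewrite -hy yE !scalerA pr_vgen (pr_zeval _ _ hm).
Qed.

Lemma V_free b (g : F) p : in_cone b g -> zeval (b := b) p *: vmon b g = 0 -> p = 0.
Proof.
move=> gb; rewrite scalerA => /vgen_eq0; rewrite -mulrA mon_e ?parity_dvec // => /Vsub_off.
apply: cone_free => //; first exact: parity_dvec.
exact: agree_dvec.
Qed.

Lemma V_inj b (g : F) p q : in_cone b g ->
  zeval (b := b) p *: vmon b g = zeval q *: vmon b g -> p = q.
Proof.
move=> gb E; apply/eqP; rewrite -subr_eq0; apply/eqP; apply: (V_free gb).
by rewrite -[- q]scaleN1r addrC zevalP rmorphN1 mulN1r addrC scalerBl E subrr.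
Qed.

(** ** Endomorphisms of standard modules *)

Section Endomorphisms.
Variable b : P.
Local Notation m := #|~: X_ b|.
Local Notation poly := (mpoly.mpoly m K).

Definition zhom j (p : poly) (hp : whomog (wt2 (b := b)) j p) (M : gmod At) : ghom (gshift j M) M.
Proof.
refine (@GHom _ At (gshift j M) M (fun y : M => zeval p *: y) _ _) => [x y y'|i y hy].
  by rewrite scalerDr !scalerA zevalC.
have := gm_act_homog (zeval_homog hp) (hy : homogeneous (gm_gr M) (i - j) y).
by rewrite addrC subrK.
Defined.

Definition phi j (p : poly) : ghom (gshift j (Vmod b)) (Vmod b) :=
  zhom (@wpart_homog b j p) (Vmod b).

Lemma phiE j p y : phi j p y = zeval (wpart j p) *: y. Proof. by []. Qed.

Fact phi_linear j : linear (phi j).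
Proof.
move=> c p q; apply: ghomP => y.
rewrite -[RHS]/(sc c *: phi j p y + phi j q y) !phiE wpartP zevalP scalerDl.
by rewrite scalerA.
Qed.

HB.instance Definition _ j :=
  GRing.isLinear.Build K poly (ghom (gshift j (Vmod b)) (Vmod b)) *:%R (phi j) (phi_linear j).

Lemma Vhom_ext i (M : gmod At) (f g : ghom (gshift i (Vmod b)) M) : f (vgen b) = g (vgen b) -> f = g.
Proof.
move=> E; apply: ghomP => y; have [x ->] := vgen_gen y.
by rewrite (ghomZ f) (ghomZ g) E.
Qed.

Lemma agree_fv : in_cone b (fv b). Proof. by []. Qed.

Lemma vmon_self : vmon b (fv b) = vgen b.
Proof. by rewrite dvecxx -eE vgen_e. Qed.

Lemma phi_surj j (f : ghom (gshift j (Vmod b)) (Vmod b)) :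
  exists! p, whomog (wt2 (b := b)) j p /\ phi j p = f.
Proof.
pose y := f (vgen b).
have ey : mon (fv b) (fv b) 0%MM *: y = y by rewrite -eE -(ghomZ f) vgen_e.
have hy : homogeneous (gm_gr (Vmod b)) j y.
  by apply: (gh_homog f); rewrite /homogeneous [LHS]/= subrr; exact: vgen_homog.
have [p [hp yE]] := V_weight_homog agree_fv ey hy.
rewrite dvecxx mdeg0 subr0 in hp; rewrite vmon_self in yE.
exists p; split; first by split=> //; apply: Vhom_ext; rewrite phiE wpart_id.
move=> q [hq qf]; apply: (V_inj agree_fv).
by rewrite vmon_self -yE /y -qf phiE wpart_id.
Qed.

(** An endomorphism is given by the image of the generator, a vector of weight [b];
    these vectors are the multiples of the generator by polynomials. *)
Lemma phw2_Vmod : @phw2 K C (Vmod b).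
Proof.
exists m, (wt2 (b := b)), (fun j => phi j); split=> //.
- exact: phi_surj.
- apply: ghomP => y; rewrite phiE wpart_id ?zeval1 ?scale1r //.
  by apply/whomogE => u; rewrite mpoly.msupp1 inE => /eqP ->; rewrite mdeg0.
- move=> i j l E p q hp hq; apply: ghomP => y.
  rewrite phiE wpart_id; last first.
    apply/whomogE => u /mpoly.msuppM_le/allpairsP[[u1 u2] /= [h1 h2 ->]].
    move/whomogE/(_ _ h1): hp => hp1; move/whomogE/(_ _ h2): hq => hq1.
    by rewrite E -hp1 -hq1 mdegD mulnDr PoszD addrC.
  rewrite zevalM zevalC -scalerA -[RHS]/(phi j q (phi i p y)) !phiE.
  by rewrite (wpart_id hp) (wpart_id hq).
Qed.

End Endomorphisms.

(** [Hom(P_a, V_b)] is the weight space of [V_b] at [a]: free of rank one if [a] lies in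
    the cone at the vertex of [b], and zero otherwise. *)
Lemma phw3_Vmod a b : @phw3 K C (Pm a) (Vmod b).
Proof.
have wa i (f : ghom (gshift i (Pm a)) (Vmod b)) :
    mon (fv a) (fv a) 0%MM *: f (Pg a) = f (Pg a) /\ homogeneous (gm_gr (Vmod b)) i (f (Pg a)).
  split; first by rewrite -eE -(ghomZ f) Pgen_e.
  by apply: (gh_homog f); rewrite /homogeneous [LHS]/= subrr; exact: Pgen_homog.
have [ab|nab] := pselect (in_cone b (fv a)); last first.
  exists 0%N, (fun=> 0), (fun j => 0) => i f; exists (fun j => 0); split.
    rewrite big_ord0; apply: (Phom_ext (eM := eM)).
    by have [w1 _] := wa i f; rewrite (V_weight_off nab w1).
  by move=> g _; apply: functional_extensionality_dep => -[].
set l := (mdeg (d (fv a) (fv b)))%:Z; set y0 := vmon b (fv a).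
have hy0 : homogeneous (gm_gr (Vmod b)) l y0.
  rewrite -[l]addr0; apply: gm_act_homog (vgen_homog b).
  by apply: mon_homog; apply: parity_dvec.
have ey0 : e a *: y0 = y0.
  by rewrite /y0 scalerA eE monM ?par0 ?parity_dvec // add0m.
exists 1%N, (fun=> l), (fun=> Phom e_homog a hy0) => i f.
have [w1 w2] := wa i f; have [p [hp pE]] := V_weight_homog ab w1 w2.
exists (fun=> phi (i - l) p); split.
  rewrite big_ord1; apply: (Phom_ext (eM := eM)).
  rewrite -[RHS]/(phi (i - l) p (Phom e_homog a hy0 (Pg a))) phiE wpart_id // pE.
  by rewrite (PhomE e_homog eM).
move=> bb; rewrite big_ord1 => fE; apply: functional_extensionality_dep => j; rewrite ord1.
have [q [[hq qE] _]] := phi_surj (bb ord0).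
rewrite -qE; congr phi; apply: (V_inj ab).
rewrite -/y0 -pE fE -[LHS]/(bb ord0 (Phom e_homog a hy0 (Pg a))) (PhomE e_homog eM) //.
by rewrite -qE phiE wpart_id.
Qed.

(** ** Standard modules as largest quotients *)

Variable chi : P -> {rmorphism At -> K}.
Hypothesis chi_scal : forall a c, chi a (sc c) = c.
Hypothesis chi_homog : forall a j x, homogeneous (ga_gr At) j x -> j != 0 -> chi a x = 0.
Hypothesis chi_e : forall a b, chi a (e b) = (b == a)%:R.
Local Notation L := (Lchar chi_scal chi_homog).

Lemma agree_Ple (a b : P) : in_cone a b -> Ple b a.
Proof. by move=> h; have [] := agree_Pset (valP a) (valP (fv b)) h. Qed.

Lemma Ple_height (a b : P) : Ple a b -> a = b \/ height A (X_ a) < height A (X_ b).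
Proof.
move=> /Ble_height[E|]; last by right.
by left; apply: val_inj; apply: basis_of_inj E; apply: valP.
Qed.

Lemma flip_notPle (a b : P) i : i \in X_ a -> val b = flip i (val a) -> ~ Ple b a.
Proof.
move=> iS bE /Ple_height[ba|].
  by have := flip_same (val a) i; rewrite -bE ba; case: (val a i).
have := flip_height (valP a) iS; rewrite -bE => /(_ (valP b)) h1 h2.
by have := lt_trans h1 h2; rewrite ltxx.
Qed.

(** The weights of the standard module of [a] lie in the cone at the vertex of [a],
    hence below [a].  Conversely, the relations that define it hold in every quotient
    with composition factors below [a], because the chambers across the hyperplanes
    through the vertex are not below [a]. *)
Lemma standard_quotient_Vmod a : @standard_quotient K C P L (@Ple R n k A) a (Pm a) (Vmod a) (rho a).
Proof.
split.
- by apply/epi_surj; exact: rho_surj.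
- move=> b i [X [f [p [/mono_inj fi /epi_surj ps]]]].
  have [x xE] := ps (1 : K); pose y := e b *: x.
  have py : p y = (1 : K) by rewrite ghomZ xE [LHS](_ : _ = chi b (e b) * 1) // chi_e eqxx mulr1.
  apply: agree_Ple; apply: contrapT => nab.
  have fy : f y = 0.
    apply: (V_weight_off (b := a) (g := fv b)) => //.
    by rewrite -eE -ghomZ scalerA eM eqxx.
  by have := congr1 p (fi _ fy); rewrite py ghom0 => /eqP; rewrite oner_eq0.
move=> Q p /epi_surj ps fb.
have pV (x : Pm a) : in_ideal (Vsub a) (val x) -> p x = 0.
  pose S (z : At) := (val x = z :> At) -> p x = 0.
  have pz : forall z : At, in_ideal (Vsub a) z -> z *: p (Pg a) = 0.
    apply: Vsub_ind => [|u v hu hv|i h u iS]; first by rewrite scale0r.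
      by rewrite scalerDl hu hv addr0.
    rewrite -scalerA; set c : F := Sub _ _; set w := mon _ _ _.
    have pc : par c (fv a) U_(i)%MM.
      by rewrite -(dvec_flip (val a) i) dvecC; apply: parity_dvec.
    case: (boolP (val c \in Pset A)) => [cP|cP]; last first.
      by rewrite /w mon_unbounded_l // scale0r scaler0.
    have [-> |/eqP wp] := eqVneq (w *: p (Pg a)) 0; first by rewrite scaler0.
    case: (@flip_notPle a (toP cP) i iS erefl).
    apply: (fb (toP cP) 1).
    apply: (weight_subquotient A_neg A_zero eM chi_scal chi_homog chi_e wp).
      have := gm_act_homog (mon_homog pc) (gh_homog p (Pgen_homog e_homog eM a)).
      by rewrite mdeg1 addr0.
    by rewrite scalerA eE toPK monM ?par0 // add0m.
  by move=> xV; rewrite [x](Pgen_gen eM) (ghomZ p) pz.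
pose N := grestrict (gspan predT (e_homog a)) (Vsub a).
exists (@gdescend K At (Pm a) Q N p pV : ghom (Vmod a) Q).
by apply: ghomP => x; exact: gdescendE.
Qed.

(** ** The standard filtration of a projective module *)

Definition height_le (b c : P) : bool := height A (X_ b) <= height A (X_ c).

Definition by_height : seq P := sort height_le (enum {: P}).
Definition rank (b : P) : nat := index b by_height.

Lemma mem_by_height b : b \in by_height.
Proof. by rewrite mem_sort mem_enum. Qed.

Lemma rank_lt b c : height A (X_ b) < height A (X_ c) -> (rank b < rank c)%N.
Proof.
move=> bc; rewrite ltnNge; apply/negP => cb.
have tot : total height_le by move=> x y; exact: le_total.
have tr : transitive height_le by move=> x y z; exact: le_trans.
have rf : reflexive height_le by move=> x; exact: lexx.
have := sorted_leq_index tr rf (sort_sorted tot (enum {: P})) _ _ (mem_by_height c) (mem_by_height b) cb.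
by rewrite /height_le leNgt bc.
Qed.

Lemma rank_inj : injective rank.
Proof.
move=> b c E; rewrite -(nth_index b (mem_by_height b)) -/(rank b) E.
exact: nth_index (mem_by_height c).
Qed.

Lemma rank_surj r : (r < size by_height)%N -> exists c, rank c = r.
Proof.
case E : by_height => [//|c0 s]; rewrite -E => h; exists (nth c0 by_height r).
by rewrite /rank index_uniq // sort_uniq enum_uniq.
Qed.

Lemma rank_size b : (rank b < size by_height)%N.
Proof. by rewrite index_mem mem_by_height. Qed.

Lemma Ple_rank a b : Ple a b -> (rank a <= rank b)%N.
Proof. by move=> /Ple_height[->|/rank_lt/ltnW]. Qed.

Definition Jgen (a c : P) : At := mon (fv c) (fv a) (d (fv c) (fv a)).

Lemma Jgen_homog a c : homogeneous (gm_gr (gregular At)) (mdeg (d (fv c) (fv a)))%:Z (Jgen a c).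
Proof. by apply: mon_homog; apply: parity_dvec. Qed.

(** Spanned by the walks to [a] that visit a chamber of rank at least [r]; from such a
    chamber they may be assumed to go on along a taut path. *)
Definition Jsub (a : P) (r : nat) : gsubmod (gregular At) :=
  gspan (fun c => r <= rank c)%N (Jgen_homog a).

Local Notation in_J x a r := (in_ideal (Jsub a r) x).

Lemma Jgen_mem a c r u : (r <= rank c)%N -> in_J (u * Jgen a c) a r.
Proof.
move=> rc; apply: idealZ; apply/asboolP; exists (fun c' => (c' == c)%:R).
rewrite (bigD1 c) //= eqxx scale1r big1 ?addr0 // => c' /andP[_ /negPf ->].
by rewrite scale0r.
Qed.

Lemma Jsub_ind a r (S : At -> Prop) : S 0 -> (forall x y, S x -> S y -> S (x + y)) ->
  (forall c u, (r <= rank c)%N -> S (u * Jgen a c)) -> forall x, in_J x a r -> S x.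
Proof.
move=> S0 SD SU x /asboolP[c ->]; elim/big_ind: _ => // b rb.
exact: SU.
Qed.

Lemma Jsub_mono a r r' x : (r <= r')%N -> in_J x a r' -> in_J x a r.
Proof.
move=> rr; move: x; apply: Jsub_ind => [|x y|c u rc]; [exact: ideal0|exact: idealD|].
by apply: Jgen_mem; apply: leq_trans rc.
Qed.

Lemma Jsub_e a r x : in_J x a r -> x * e a = x.
Proof.
move: x; apply: Jsub_ind => [|x y hx hy|c u _]; first by rewrite mul0r.
  by rewrite mulrDl hx hy.
by rewrite -mulrA mon_e ?parity_dvec.
Qed.

(** The chamber across a hyperplane through the vertex of [c] is unbounded, so that
    these paths vanish, or of higher rank than [c]. *)
Lemma Jsub_flip a c i (h : flip i (val c) \in Fset A) u : i \in X_ c ->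
  let b : F := Sub (flip i (val c)) h in in_J (u * mon b (fv a) (d b (fv a))) a (rank c).+1.
Proof.
move=> iS b; case: (boolP (val b \in Pset A)) => [bP|bP]; last first.
  by rewrite mon_unbounded_l ?parity_dvec // mulr0; apply: ideal0.
have := @Jgen_mem a (toP bP) (rank c).+1 u; rewrite /Jgen toPK; apply.
by apply: rank_lt; apply: (flip_height (valP c) iS).
Qed.

(** If [a] is not in the cone at the vertex of [c], the walk from [c] to [a] can start
    by crossing a hyperplane through that vertex. *)
Lemma Jgen_disagree a c : ~ in_cone c a -> in_J (Jgen a c) a (rank c).+1.
Proof.
move=> /existsNP[i /not_implyP[iS ia]]; have h := flip_feasible (valP c) iS.
pose b : F := Sub (flip i (val c)) h.
have bE : val b = flip i (val (fv c)) by [].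
have ca : val (fv c) i != val (fv a) i by apply/eqP => E; apply: ia; exact: esym.
rewrite /Jgen -(closer_dvec bE ca) -(monM (parity_dvec _ _) (parity_dvec _ _)).
exact: Jsub_flip.
Qed.

Lemma Vsub_Jgen a c (x : At) : in_cone c a ->
  in_ideal (Vsub c) x -> in_J (x * Jgen a c) a (rank c).+1.
Proof.
move=> ac; move: x; apply: Vsub_ind => [|x y hx hy|i h u iS].
- by rewrite mul0r; apply: ideal0.
- by rewrite mulrDl; apply: idealD.
pose b : F := Sub (flip i (val c)) h.
have cE : val (fv c) = flip i (val b) by rewrite flipK.
have ba : val b i != val (fv a) i by rewrite /= flip_same ac //; case: (val c i).
have UE : (U_(i) = d b (fv c))%MM by rewrite dvecC dvec_flip.
rewrite -mulrA -/b UE (monM (parity_dvec _ _) (parity_dvec _ _)) (closer_dvec cE ba).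
exact: Jsub_flip.
Qed.

(** The chambers in the cone at the vertex of [c] have rank at most that of [c]. *)
Lemma Jsub_off a c y : in_cone c a -> in_J y a (rank c).+1 -> off_cone c y.
Proof.
move=> ac; move: y; apply: Jsub_ind => [|x y|b u rb]; [exact: off_cone0|exact: off_coneD|].
apply: off_cone_mull => [|g v pv av]; first exact: parity_dvec.
have av' : avoids (X_ c) (d (fv b) (fv a)).
  by move=> i iS; have := av i iS; rewrite mnmDE => /eqP; rewrite addn_eq0 => /andP[_ /eqP].
have bc : in_cone c b.
  apply: agree_trans ac; exact: avoids_parity av' (parity_dvec _ _).
by have := Ple_rank (agree_Ple bc); rewrite leqNgt rb.
Qed.

(** Multiplication by the taut path from [c] to [a] embeds the standard module of [c]
    in the layer of the filtration: the monomials of the cone remain independent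
    of the next layer by [Jsub_off]. *)
Lemma Jgen_inj a c (x : At) : in_cone c a -> x * e c = x ->
  in_J (x * Jgen a c) a (rank c).+1 -> in_ideal (Vsub c) x.
Proof.
move=> ac xe xJ; have -> : x = \sum_(g : F) mon g g 0%MM * x by rewrite -mulr_suml mon_sum1 mul1r.
elim/big_ind: _ => [|u v|g _]; [exact: ideal0|exact: idealD|].
rewrite -xe mulrA /=; have [gc|gc] := pselect (in_cone c g); last exact: cone_span_off.
have [p hp] := cone_span x gc; set y := mon g g 0%MM * x * e c in hp *.
have yJ : in_J (y * Jgen a c) a (rank c).+1.
  by rewrite /y -[_ * x * e c]mulrA xe -mulrA; apply: idealZ.
set w := mon g (fv c) _ in hp.
have zJ : in_J (zeval p * w * Jgen a c) a (rank c).+1.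
  have -> : zeval p * w * Jgen a c = y * Jgen a c - (y - zeval p * w) * Jgen a c.
    by rewrite mulrBl opprB addrC subrK.
  by apply: idealB yJ _; apply: Vsub_Jgen.
have p0 : p = 0.
  move/(Jsub_off ac): zJ; rewrite -mulrA monM ?parity_dvec //.
  apply: cone_free => //; first exact: parityD (parity_dvec _ _) (parity_dvec _ _).
  have h1 : agree (X_ c) (val (fv c)) (val (fv a)) by apply: agree_sym.
  by move=> i iS; rewrite mnmDE (@agree_dvec (X_ c) g (fv c) gc) // (@agree_dvec (X_ c) (fv c) (fv a) h1).
by move: hp; rewrite p0 zeval0 mul0r subr0.
Qed.

(** So the filtration starts with the kernel of the projection onto the standard
    module of [a]. *)
Lemma Vsub_J a (x : At) : in_ideal (Vsub a) x <-> in_J x a (rank a).+1.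
Proof.
have aa : in_cone a a by [].
have gE : Jgen a a = e a by rewrite eE /Jgen dvecxx.
split=> [h|h]; first by have := Vsub_Jgen aa h; rewrite gE Vsub_e.
by apply: (Jgen_inj aa); rewrite ?gE ?(Jsub_e h).
Qed.

Lemma Jsub_split a c (x : At) : in_J x a (rank c) -> exists u, in_J (x - u * Jgen a c) a (rank c).+1.
Proof.
move: x; apply: Jsub_ind => [|x y [u hu] [v hv]|b u].
- by exists 0; rewrite mul0r subrr; apply: ideal0.
- by exists (u + v); rewrite mulrDl opprD addrACA; apply: idealD.
rewrite leq_eqVlt => /orP[/eqP/rank_inj ->|cb]; first by exists u; rewrite subrr; apply: ideal0.
by exists 0; rewrite mul0r subr0; apply: Jgen_mem.
Qed.

Lemma Jsub_top a r x : (size by_height <= r)%N -> in_J x a r -> x = 0.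
Proof.
move=> sr; move: x; apply: Jsub_ind => [//|x y -> ->|c u rc]; first exact: addr0.
by have := leq_trans sr rc; rewrite leqNgt rank_size.
Qed.

Section ShiftAdjunction.
Variables (l : int) (M N : gmod At).

Definition gshift_adj (f : ghom (gshift l M) N) : ghom M (gshift (- l) N).
Proof.
refine (@GHom _ At M (gshift (- l) N) f (gh_linear f) _) => i x hx.
rewrite /homogeneous /= opprK; apply: (gh_homog f).
by rewrite /homogeneous /= addrK.
Defined.

Definition gshift_adjV (f : ghom M (gshift (- l) N)) : ghom (gshift l M) N.
Proof.
refine (@GHom _ At (gshift l M) N f (gh_linear f) _) => i x hx.
have := gh_homog f (hx : homogeneous (gm_gr M) (i - l) x).
by rewrite /homogeneous /= opprK subrK.
Defined.
End ShiftAdjunction.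

Section Filtration.
Variable a : P.
Local Notation Pa := (gspan predT (e_homog a)).
Local Notation NJ r := (grestrict Pa (Jsub a r)).

Definition Jmod r : fgmod At := fgsub At_noetherian (M := Pm a) (NJ r).

Lemma Jmod_val r (x : Jmod r) : in_J (val (val x)) a r.
Proof. exact: (valP x). Qed.

Lemma J_in_P r (x : At) : in_J x a r -> (x : gregular At) \in gs_pred Pa.
Proof. by move=> h; apply/(mem_Pmod e_homog eM); apply: Jsub_e h. Qed.

Definition Jelt r (x : At) (h : in_J x a r) : Jmod r :=
  @Sub _ _ (sub_car (NJ r)) (Sub (x : gregular At) (J_in_P h) : gsub Pa) h.

Lemma Jmod_inj r (x y : Jmod r) : val (val x) = val (val y) :> At -> x = y.
Proof. by move=> E; do 2 apply: val_inj. Qed.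

(** The layer of index [rank b] is generated by the taut path from [b] to [a]; it is
    the standard module of [b] if [a] lies in the cone at the vertex of [b], and zero
    otherwise. *)
Lemma Jlayer r (j : ghom (Jmod r.+1) (Jmod r)) (Z : C) (c : ghom (Jmod r) Z) :
  (rank a < r)%N -> (forall x, val (val (j x)) = val (val x) :> At) ->
  @cokernel K C _ _ j Z c ->
  zero_object Z \/ exists b l, (Ple a b /\ a <> b) /\ isomorphic Z (@sh K C l (Vmod b)).
Proof.
move=> ar jE cc; have cs := cokernel_surj cc; have ck := cokernel_ker cc.
have c0 x : in_J (val (val x)) a r.+1 -> c x = 0.
  by move=> h; apply/ck; exists (Jelt h); apply: Jmod_inj; rewrite jE.
have zero : (forall x : At, in_J x a r -> in_J x a r.+1) -> zero_object Z.
  move=> h; apply/zero_objectP => z; have [x <-] := cs z; apply: c0.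
  by apply: h; apply: Jmod_val.
case: (ltnP r (size by_height)) => [/rank_surj[b rb]|rs]; last first.
  by left; apply: zero => x /(Jsub_top rs) ->; apply: ideal0.
subst r; have [ab|ab] := pselect (in_cone b a); last first.
  left; apply: zero => x /Jsub_split[u hu]; rewrite -[x](subrK (u * Jgen a b)).
  by apply: idealD => //; apply: idealZ; apply: Jgen_disagree.
right; pose l := (mdeg (d (fv b) (fv a)))%:Z; exists b, l; split.
  by split; [apply: agree_Ple|move=> E; rewrite E ltnn in ar].
have gJ : in_J (Jgen a b) a (rank b) by rewrite -[Jgen a b]mul1r; apply: Jgen_mem.
pose y := Jelt gJ.
have hy : homogeneous (gm_gr (Jmod (rank b))) l y.
  by apply: Jmod_inj; exact: (Jgen_homog a b).
have ey : e b *: y = y.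
  by apply: Jmod_inj; rewrite /= -[LHS]/(e b * Jgen a b) eE monM ?par0 ?parity_dvec // add0m.
pose f : ghom (gshift l (Pm b)) Z := gcomp c (Phom e_homog b hy).
have fE x : f x = c (Phom e_homog b hy x) by [].
have vE x : val (val (Phom e_homog b hy x)) = (val x : At) * Jgen a b :> At by [].
have fV x : in_ideal (Vsub b) (val x) -> gshift_adj f x = 0.
  by move=> xV; apply: (c0 (Phom e_homog b hy x)); rewrite vE; apply: Vsub_Jgen.
pose N := grestrict (gspan predT (e_homog b)) (Vsub b).
pose psi : ghom (gshift l (Vmod b)) Z := gshift_adjV (@gdescend K At (Pm b) _ N (gshift_adj f) fV).
have psiE x : psi (rho b x) = f x by exact: (@gdescendE K At (Pm b) _ N (gshift_adj f) fV x).
apply: isomorphic_sym; exists psi; apply/iso_bij; split=> [v|z].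
  have [x <-] := rho_surj v; rewrite psiE fE => /ck[x' x'E].
  apply/rho_eq0; apply: (Jgen_inj ab); first exact: (Pmod_e eM).
  by rewrite -vE -x'E jE; apply: Jmod_val.
have [x <-] := cs z; have [u hu] := Jsub_split (Jmod_val x).
exists (rho b (u *: Pg b)); rewrite psiE fE; apply/eqP; rewrite -subr_eq0 -ghomB; apply/eqP; apply: c0.
have -> : val (val (Phom e_homog b hy (u *: Pg b) - x)) = - (val (val x) - u * Jgen a b) :> At.
  rewrite opprB /= -[_ *: _]/((u * e b) * Jgen a b).
  rewrite -mulrA eE monM ?par0 ?parity_dvec // add0m; by [].
by rewrite -sub0r; apply: idealB => //; apply: ideal0.
Qed.

(** By [Vsub_J] the kernel is the part of rank greater than that of [a], which gives the
    shift [r0]; the filtration is finite because the ranks are bounded. *)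
Lemma phw1_Vmod : @phw1 K C P (@Ple R n k A) Pm Vmod rho a.
Proof.
pose r0 := (rank a).+1; pose Z := Jmod r0.
have inZ r (x : Jmod r) : (r0 <= r)%N -> val x \in gs_pred (NJ r0).
  by move=> h; apply: (Jsub_mono h); apply: Jmod_val.
pose X m := Jmod (m + r0).
pose im m : ghom (X m) Z := @gcorestrict K At (Pm a) (X m) (NJ r0) (gsub_inc (NJ (m + r0)))
  (fun x => inZ _ x (leq_addl _ _)).
have imE m x : val (val (im m x)) = val (val x) :> At by [].
have imI m x : im m x = 0 -> x = 0.
  by move=> /(congr1 val)/(congr1 val) E; apply: Jmod_inj; rewrite -imE E.
exists Z, (gsub_inc (NJ r0)); split.
  apply: kernelP => [z|x]; first exact: gsub_inc_inj.
  split=> [/rho_eq0/Vsub_J h|[z <-]]; last by apply/rho_eq0/Vsub_J; exact: Jmod_val.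
  by exists (Jelt h); apply: val_inj.
exists X, im; split.
- split=> [m|m|Y g h].
  + by apply/mono_inj; apply: imI.
  + apply/(factorsP _ (@imI m)) => x.
    have h : in_J (val (val x)) a (m + r0) by apply: Jsub_mono (Jmod_val x); rewrite leq_add2r.
    by exists (Jelt h); apply: Jmod_inj.
  + apply: ghomP => v; have [u E] := h (size by_height); rewrite -E /=.
    have u0 : u v = 0.
      apply: Jmod_inj; apply: (Jsub_top _ (Jmod_val (u v))).
      exact: leq_addr.
    by rewrite u0; apply: Jmod_inj.
- apply/iso_bij; split=> [x|z]; first exact: imI.
  have h : in_J (val (val z)) a (0 + r0) by apply: Jmod_val.
  by exists (Jelt h); apply: Jmod_inj.
- move=> m j Q c jE cc; apply: (Jlayer (r := m + r0) _ _ cc); first by rewrite ltn_addl.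
  by move=> x; rewrite -(imE m.+1) -jE.
Qed.

End Filtration.

Lemma Ple_partial_order : partial_order (@Ple R n k A).
Proof.
split=> [a|a b ab ba|a b c ab bc]; [exact: rt_refl| |exact: rt_trans ab bc].
case: (Ple_height ab) (Ple_height ba) => [//|h1] [//|h2].
by have := lt_trans h1 h2; rewrite ltxx.
Qed.

Lemma phw_Vmod : @polynomial_highest_weight K C P L (@Ple R n k A) Vmod.
Proof.
exists Pm, (Ptop e_homog chi_scal chi_homog), rho; split.
- exact: (noetherian_laurentian_gmod At_noetherian A_neg A_zero A_fd e_homog eM e_sum
    chi_scal chi_homog chi_e).
- exact: Ple_partial_order.
- exact: standard_quotient_Vmod.
- by move=> a; split=> [||b]; [exact: phw1_Vmod|exact: phw2_Vmod|exact: phw3_Vmod].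
Qed.

End MonomialAlgebra.

Theorem theorem4p3 (K : closedFieldType) (R : realType) (n k : nat)
    (A : polarized R n k) :
  @polynomial_highest_weight K (gmodcat (Atilde A K)) (Pvert A)
    (@Lsimple R n k A K) (@Ple R n k A) (@Vtilde R n k A K).
Proof.
pose chi a : {rmorphism Atilde A K -> K} :=
  qchi (rel_homog := @Atilde_rel_homog R n k A K) (@pchar_rel R n k A K a).
have chi_e a b : chi a (Ae K b) = (b == a)%:R.
  by rewrite [LHS]qchi_pi [LHS]pchar_vert (inj_eq (@fv_inj R n k A)).
exact: (phw_Vmod (@monM R n k A K) (@monM0 R n k A K) (@mon_ind R n k A K)
  (@mon_homog R n k A K) (@mon_dead R n k A K) (@mon_sum1 R n k A K)
  (@coefP R n k A K) (@coef_mon R n k A K) (@Ae_mon R n k A K) (@Ap_mon R n k A K)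
  (@Ae_homog R n k A K) (@Ap_homog R n k A K)
  (fun a => qchi_scal (@Atilde_rel_homog R n k A K) (@pchar_rel R n k A K a)
    (@pchar_scal K (Fvert A) (@fadj R n k A) n _))
  (fun a => qchi_homog (@pchar_rel R n k A K a)
    (@pchar_homog K (Fvert A) (@fadj R n k A) n _)) chi_e).
Qed.
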